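(* Let $H>0$, let $G:\mathbb{R}\to\mathbb{R}$ be any real-valued function that is locally integrable ($L^1$ on every bounded interval), and let $f$ be a (complex-valued) continuous function on $[0,H]$. Then $$\liminf_{T\to\infty}\int_0^H \left|f(t)-G(t+T)\,\zeta\!\left(\tfrac12+iT+it\right)\right|dt\;\geq\;\frac{2}{\pi}\int_0^H |f(t)|\,dt,$$ where $\zeta$ denotes the Riemann zeta-function. *)

(* Defs.v *)
From HB Require Import structures.
From mathcomp Require Import all_boot all_order all_algebra.
From mathcomp Require Export complex.
From mathcomp Require Import all_classical all_reals all_analysis.

Set Implicit Arguments.
Unset Strict Implicit.
Unset Printing Implicit Defensive.

Import Order.TTheory GRing.Theory Num.Theory.
Import numFieldNormedType.Exports.

Local Open Scope classical_set_scope.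
Local Open Scope ring_scope.
Local Open Scope complex_scope.

(* R[i]^o is the field R[i] seen as a normed space over itself: the library   *)
(* puts the topology of a numFieldType K on K^o.                              *)
Notation CC R := (R[i]^o) (only parsing).

Section Zeta.
Context {R : realType}.
Implicit Types (s z a : CC R) (Z : CC R -> CC R) (G : R -> R).

Definition cexp z : CC R :=
  expR (complex.Re z) * cos (complex.Im z) +i*
  (expR (complex.Re z) * sin (complex.Im z)).

(* n ^ s, for n > 0 *)
Definition natpowc (n : nat) s : CC R := cexp (s * (ln (n%:R : R))%:C).

Definition analytic_at Z a :=
  exists c : nat -> CC R,
    \forall z \near a, series (fun n => c n * (z - a) ^+ n) @ \oo --> Z z.

(* Z is the analytic continuation to C \ {1} of the Dirichlet series          *)
(* \sum_(n >= 1) n ^ - s, Re s > 1. This determines Z on C \ {1}; Z 1 is      *)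
(* left arbitrary.                                                            *)
Definition is_riemann_zeta Z :=
  (forall s, 1 < complex.Re s ->
     series (fun n => natpowc n.+1 (- s)) @ \oo --> Z s) /\
  (forall s, s != 1 -> analytic_at Z s).

(* Integrability, hence measurability, is relative to the completed measure:  *)
(* G is Lebesgue, and not necessarily Borel, measurable.                      *)
Definition L1_on_bounded_intervals G :=
  forall a b : R,
    completed_lebesgue_measure.-integrable `[a, b] (fun t => (G t)%:E).

End Zeta.

(* Main.v *)
(* On the critical line G zeta has a known phase. Write Gam (w) = pi ^ (- w) Gamma (w)
   and theta for the Jacobi theta function. The Mellin representation of the completed
   zeta function and the symmetry of theta show that Gam (1/4 + i y) zeta (1/2 + 2 i y)
   is real. Hence, with y = (T + t) / 2 and M = Gam (1/4 + i y),
   |M| |f - G zeta| >= |Im (M (f - G zeta))| = |Im (M f)|, whatever the real function G.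
   By Stirling the argument of M on a window of bounded length is, up to o(1), an affine
   function of t whose slope tends to infinity with T. So the lower bound behaves like
   |f| |sin (arg f + al + la t)|, and the mean of |sin| over a period is 2 / pi.

   The functional equation of theta is obtained by Polya's method: averaging
   (2 cos) ^ (2 m) over the roots of unity gives a finite identity for binomial
   coefficients, whose limit is the functional equation. Applying a second difference
   operator to theta - 1 kills the two exponentials responsible for the poles of the
   completed zeta function; its Mellin transform is then analytic across the critical
   strip, and the identity theorem along a horizontal line reaches Re s = 1/2. *)
From HB Require Import structures.
Require Import Defs.
From mathcomp Require Import all_boot all_order all_algebra.
From mathcomp Require Import all_classical all_reals all_analysis.
From mathcomp Require Import measurable_realfun ring lra zify.
Import Order.TTheory GRing.Theory Num.Theory.
Import numFieldNormedType.Exports.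
Local Open Scope classical_set_scope.
Local Open Scope ring_scope.
Local Open Scope complex_scope.

Set Implicit Arguments.
Unset Strict Implicit.
Unset Printing Implicit Defensive.

(** * The functional equation of theta *)

(** The substitution x = e^v turns every Mellin transform into a two-sided Laplace transform, that
    is, a pair of real integrals. The variable w of the transform and the argument s of zeta satisfy
    s = 2 w, hence the constant 1/4: Re s = 1/2 is Re w = 1/4. The ordinate stays fixed during the
    continuation, so analyticity is used in the single real variable Re w and takes the form of
    geometric bounds on Taylor remainders.

    On the Gamma side the obstacle is to control a phase over a whole window that moves to infinity.
    For a given height y, Gamma (w + n) has an almost explicit argument once n is large compared
    with y^2, because its integrand concentrates; the n steps back to w contribute arctangents. The
    error of linearisation in t and the lower bound for the slope are both uniform in n, so n may be
    chosen after T.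

    In the functional equation of theta, one parameter, the number of roots of unity, rules both
    limits: the angles see x and the binomial coefficients see 1/x. *)

Section Tannery.
Context {R : realType}.

Lemma series_sub_nonneg (d : nat -> R) K n : (K <= n)%N -> (forall k, 0 <= d k) ->
  cvgn (series d) -> \sum_(K <= k < n) d k <= limn (series d) - series d K.
Proof.
move=> Kn d0 dcv; rewrite -sub_series_geq// lerD2r.
apply: nondecreasing_cvgn_le => //.
by apply: nondecreasing_series => i _ _; exact: d0.
Qed.

Lemma series_tail_lt (d : nat -> R) (e : R) : (forall k, 0 <= d k) ->
  cvgn (series d) -> 0 < e ->
  exists K, forall n, (K <= n)%N -> \sum_(K <= k < n) d k < e.
Proof.
move=> d0 dcv e0.
have /cvgrPdist_lt /(_ _ e0) [K _ KP] := dcv.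
exists K => n Kn; apply: le_lt_trans (KP K (leqnn K)).
by apply: le_trans (ler_norm _); exact: series_sub_nonneg.
Qed.

(** Dominated convergence for sums of variable length. Past a cut-off [K] the tail of [d] controls
    everything uniformly in [m]; below it there are finitely many limits. The vanishing condition
    settles the case where [N m] lies below [K]. *)
Lemma tannery (a : nat -> nat -> R) (d l : nat -> R) (N : nat -> nat) :
  (forall m k, `|a m k| <= d k) -> cvgn (series d) ->
  (forall k, a ^~ k @ \oo --> l k) ->
  (forall m k, (N m <= k)%N -> a m k = 0) ->
  (fun m => \sum_(0 <= k < N m) a m k) @ \oo --> limn (series l).
Proof.
move=> ad dcv al aN.
have d0 k : 0 <= d k by exact: le_trans (ad 0%N k).
have ld k : `|l k| <= d k.
  rewrite leNgt; apply/negP => dl.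
  have h0 : (fun m => `|a m k|) @ \oo --> `|l k| by exact: cvg_norm (al k).
  move/cvgrPdist_lt: h0 => /(_ (`|l k| - d k)); rewrite subr_gt0 => /(_ dl) [M _ /(_ M (leqnn M))] /=.
  move=> /(le_lt_trans (ler_norm _)); rewrite ltrD2l ltrN2 => /lt_le_trans h2.
  by have := h2 _ (ad M k); rewrite ltxx.
have lcv : cvgn (series l).
  by apply: normed_cvg; apply: series_le_cvg dcv => // n; exact: normr_ge0.
apply/cvgrPdist_lt => e e0.
have e3 : 0 < e / 4 by rewrite divr_gt0.
have [K1 K1P] := series_tail_lt d0 dcv e3.
have /cvgrPdist_lt /(_ _ e3) [K2 _ K2P] := lcv.
pose K := maxn K1 K2.
have tail n : (K <= n)%N -> \sum_(K <= k < n) d k < e / 4.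
  move=> Kn; apply: le_lt_trans (K1P n _); last by rewrite (leq_trans _ Kn)// leq_maxl.
  rewrite [leRHS](@big_cat_nat _ _ _ K)//= ?leq_maxl// lerDr.
  by apply: sumr_ge0 => i _.
have cvK : (fun m => \sum_(0 <= k < K) a m k) @ \oo --> \sum_(0 <= k < K) l k.
  elim: (K) => [|j IHj]; first by under eq_fun do rewrite big_nil; rewrite big_nil; exact: cvg_cst.
  under eq_fun do rewrite big_nat_recr//=.
  by rewrite big_nat_recr//=; apply: cvgD.
have /cvgrPdist_lt /(_ _ e3) [M _ MP] := cvK.
exists M => // m Mm /=.
have h1 := MP m Mm; have h2 := K2P K (leq_maxr _ _).
have h3 : `|\sum_(0 <= k < K) a m k - \sum_(0 <= k < N m) a m k| <= e / 4.
  have [KN|NK] := leqP K (N m).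
    rewrite (@big_cat_nat _ _ _ K _ (N m))//= opprD addrA subrr add0r normrN.
    apply: le_trans (ltW (tail _ KN)).
    by apply: le_trans (ler_norm_sum _ _ _) _; apply: ler_sum => i _.
  rewrite (@big_cat_nat _ _ _ (N m) _ K)//= ?(ltnW NK)//.
  rewrite addrAC subrr add0r big_nat big1 ?normr0 ?ltW// => i /andP[Ni _].
  exact: aN.
have -> : limn (series l) - \sum_(0 <= k < N m) a m k =
  (limn (series l) - series l K) +
  ((\sum_(0 <= k < K) l k - \sum_(0 <= k < K) a m k) +
   (\sum_(0 <= k < K) a m k - \sum_(0 <= k < N m) a m k)).
  by rewrite /series /=; ring.
apply: le_lt_trans (ler_normD _ _) _.
have := ler_normD (\sum_(0 <= k < K) l k - \sum_(0 <= k < K) a m k)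
   (\sum_(0 <= k < K) a m k - \sum_(0 <= k < N m) a m k).
move: h1 h2 h3 => /=; lra.
Qed.

End Tannery.

(** * Polya's finite identity for binomial coefficients *)

Section FiniteTheta.
Context {R : realType}.
Implicit Types (al be : R).

Lemma sum_binS (c : nat -> R) n :
  \sum_(0 <= r < n.+1) 'C(n, r)%:R * (c r + c r.+1) =
  \sum_(0 <= r < n.+2) 'C(n.+1, r)%:R * c r.
Proof.
rewrite [RHS]big_nat_recl//= bin0 mul1r.
under [in RHS]eq_bigr do rewrite binS natrD mulrDl.
rewrite big_split/= [in RHS]big_nat_recr//= bin_small// mul0r addr0.
under eq_bigr do rewrite mulrDr.
rewrite big_split/= addrA; congr (_ + _).
by rewrite big_nat_recl//= bin0 mul1r.
Qed.

(** The binomial expansion of (e^(i al) + e^(-i al))^n in real form; the induction step is Pascal's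
    rule in the shape of [sum_binS]. *)
Lemma cos_pow al n : (2 * cos al) ^+ n =
  \sum_(0 <= r < n.+1) 'C(n, r)%:R * cos ((n%:R - 2 * r%:R) * al).
Proof.
elim: n => [|n IH].
  by rewrite expr0 big_nat1 bin0 mul1r mulr0 subr0 mul0r cos0.
rewrite exprS IH mulr_sumr.
rewrite -(sum_binS (fun r => cos ((n.+1%:R - 2 * r%:R) * al))).
apply: eq_bigr => r _; rewrite mulrCA; congr (_ * _).
have -> : (n.+1%:R - 2 * r%:R) * al = (n%:R - 2 * r%:R) * al + al.
  by rewrite -natr1; ring.
have -> : (n.+1%:R - 2 * r.+1%:R) * al = (n%:R - 2 * r%:R) * al - al.
  by rewrite -!natr1; ring.
by rewrite cosD cosB; ring.
Qed.

Lemma cos_natpi2 (n : nat) : cos (n%:R * (2 * pi)) = 1 :> R.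
Proof.
have := periodicn (@cosD2pi R) n 0.
by rewrite add0r cos0 -[pi *+ 2]mulr_natl -[X in cos X]mulr_natl.
Qed.

Lemma sin_natpi2 (n : nat) : sin (n%:R * (2 * pi)) = 0 :> R.
Proof.
have := periodicn (@sinD2pi R) n 0.
by rewrite add0r sin0 -[pi *+ 2]mulr_natl -[X in sin X]mulr_natl.
Qed.

Lemma sin_natpi_div_neq0 (d l : nat) : (0 < l)%N -> ~~ (l %| d)%N ->
  sin (d%:R * pi / l%:R) != 0 :> R.
Proof.
move=> l0 ld.
have lR : l%:R != 0 :> R by rewrite pnatr_eq0 -lt0n.
rewrite (divn_eq d l) natrD natrM 2!mulrDl.
have -> : (d %/ l)%:R * l%:R * pi / l%:R = pi * (d %/ l)%:R :> R by field.
rewrite addrC mulr_natr alternatingn; last exact: sinDpi.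
rewrite mulf_neq0// ?signr_eq0// gt_eqF// sin_gt0_pi//.
have e0 : (0 < d %% l)%N by rewrite lt0n.
apply/andP; split.
  by rewrite mulr_gt0 ?invr_gt0 ?ltr0n// mulr_gt0 ?ltr0n// pi_gt0.
rewrite ltr_pdivrMr ?ltr0n// mulrC ltr_pM2l ?pi_gt0//.
by rewrite ltr_nat ltn_mod.
Qed.

(** Orthogonality of roots of unity. When l does not divide d, multiplication by 2 sin (be / 2),
    nonzero by [sin_natpi_div_neq0], makes the sum telescope. *)
Lemma sum_cos_roots (d l : nat) : (0 < l)%N ->
  \sum_(0 <= k < l) cos (k%:R * (2 * d%:R * pi / l%:R)) =
  (if (l %| d)%N then l%:R else 0) :> R.
Proof.
move=> l0; have lR : l%:R != 0 :> R by rewrite pnatr_eq0 -lt0n.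
case: ifPn => [/dvdnP[q ->]|ld].
  under eq_bigr => k _.
    rewrite natrM; have -> : k%:R * (2 * (q%:R * l%:R) * pi / l%:R) =
      (k * q)%:R * (2 * pi) :> R by rewrite natrM; field.
    rewrite cos_natpi2; over.
  by rewrite big_const_nat subn0 iter_addr addr0.
have s0 := sin_natpi_div_neq0 l0 ld.
set be := 2 * d%:R * pi / l%:R.
have bE : d%:R * pi / l%:R = be / 2 :> R by rewrite /be; field.
rewrite bE in s0.
apply: (mulfI (mulf_neq0 (_ : 2 != 0 :> R) s0)) => //.
rewrite mulr0 mulr_sumr.
under eq_bigr => k _.
  have -> : 2 * sin (be / 2) * cos (k%:R * be) =
     sin (k.+1%:R * be - be / 2) - sin (k%:R * be - be / 2).
    have -> : k.+1%:R * be - be / 2 = k%:R * be + be / 2.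
      by rewrite -natr1; field.
    by rewrite sinD sinB; ring.
  over.
rewrite telescope_sumr// mul0r sub0r sinN opprK.
have -> : l%:R * be - be / 2 = d%:R * (2 * pi) - be / 2 by rewrite /be; field.
by rewrite sinB sin_natpi2 cos_natpi2; ring.
Qed.

Lemma sum_sym (g : nat -> R) m :
  (forall j, (j <= m)%N -> g (m - j)%N = g (m + j)%N) ->
  \sum_(0 <= r < m.*2.+1) g r = g m + 2 * \sum_(0 <= j < m) g (m + j.+1)%N.
Proof.
move=> gs; rewrite (@big_cat_nat _ _ _ m)//=; last by lia.
rewrite [X in _ + X]big_ltn; last by lia.
have -> : \sum_(0 <= i < m) g i = \sum_(0 <= j < m) g (m + j.+1)%N.
  rewrite big_nat_rev/= !big_nat; apply: eq_bigr => i /andP[_ im].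
  by rewrite add0n gs.
have -> : \sum_(m.+1 <= i < m.*2.+1) g i = \sum_(0 <= j < m) g (m + j.+1)%N.
  rewrite -{1}[m.+1]add0n big_addn.
  have -> : (m.*2.+1 - m.+1 = m)%N by lia.
  by apply: eq_bigr => i _; congr g; lia.
by ring.
Qed.

Lemma sum_dvd (h : nat -> R) l n : (0 < l)%N ->
  \sum_(0 <= j < n * l) (if (l %| j.+1)%N then h j.+1 else 0) =
  \sum_(0 <= k < n) h (k.+1 * l)%N.
Proof.
move=> l0; elim: n => [|n IH]; first by rewrite mul0n !big_nil.
rewrite big_nat_recr//= -IH (@big_cat_nat _ _ _ (n * l)%N)//=; last by lia.
congr (_ + _); rewrite mulSn.
have -> : (l + n * l = (l.-1 + n * l).+1)%N by lia.
rewrite big_nat_recr/=; last by lia.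
rewrite big_nat big1 ?add0r.
  have -> : (l.-1 + n * l).+1 = (n.+1 * l)%N by lia.
  by rewrite dvdn_mull.
move=> i /andP[h1 h2]; case: ifP => // /dvdnP[q qE]; exfalso.
have : (n < q)%N by rewrite -(ltn_pmul2r l0) -qE ltnS.
have : (q < n.+1)%N by rewrite -(ltn_pmul2r l0) -qE; lia.
by lia.
Qed.

(** Discrete counterpart of the Gaussian e^(-j^2/m). Division by the central coefficient leaves a
    single factor, independent of j, whose limit is treated in [bin_mid_cvg]. *)
Definition binratio m j : R := 'C(m.*2, m + j)%:R / 'C(m.*2, m)%:R.

Lemma binratio_gt m j : (m < j)%N -> binratio m j = 0.
Proof. by move=> mj; rewrite /binratio bin_small ?mul0r//; lia. Qed.

Lemma bin_mid_neq0 m : 'C(m.*2, m)%:R != 0 :> R.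
Proof. by rewrite pnatr_eq0 -lt0n bin_gt0; lia. Qed.

Lemma binratio0 m : binratio m 0 = 1.
Proof. by rewrite /binratio addn0 divff// bin_mid_neq0. Qed.

Lemma binratioS m j : (j < m)%N ->
  binratio m j.+1 = binratio m j * ((m - j)%:R / (m + j).+1%:R).
Proof.
move=> jm; rewrite /binratio mulrAC; congr (_ / _).
have h : ('C(m.*2, m + j.+1) * (m + j).+1 = 'C(m.*2, m + j) * (m - j))%N.
  have := mul_bin_left m.*2 (m + j).
  have -> : (m.*2 - (m + j) = m - j)%N by lia.
  by rewrite addnS mulnC => ->; rewrite mulnC.
by rewrite mulrA -natrM -h natrM mulfK// pnatr_eq0.
Qed.

(** Averaging (2 cos)^(2m) over the angles k pi / l keeps the coefficients C(2m, r) with l dividing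
    m - r. As l is odd, the nonzero angles pair off under k -> l - k without a middle one, and the
    even exponent hides the change of sign; both sides thus acquire the shape 1 + 2 sum of theta. *)
Lemma cos_sum_binratio m q (l := q.*2.+1) :
  1 + 2 * \sum_(0 <= k < q) cos (k.+1%:R * pi / l%:R) ^+ m.*2 =
  l%:R * ('C(m.*2, m)%:R / 4 ^+ m) *
  (1 + 2 * \sum_(0 <= k < m) binratio m (k.+1 * l)) :> R.
Proof.
have l0 : (0 < l)%N by [].
have lR : l%:R != 0 :> R by rewrite pnatr_eq0.
have E1 : 1 + 2 * \sum_(0 <= k < q) cos (k.+1%:R * pi / l%:R) ^+ m.*2 =
   \sum_(0 <= k < l) cos (k%:R * pi / l%:R) ^+ m.*2 :> R.
  rewrite big_nat_recl//= !mul0r cos0 expr1n; congr (_ + _).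
  rewrite [in RHS](@big_cat_nat _ _ _ q)//=; last by lia.
  have -> : \sum_(q <= i < q.*2) cos (i.+1%:R * pi / l%:R) ^+ m.*2 =
      \sum_(0 <= i < q) cos (i.+1%:R * pi / l%:R) ^+ m.*2 :> R.
    rewrite -{1}[q]add0n big_addn.
    have -> : (q.*2 - q = q)%N by lia.
    rewrite big_nat_rev/= !big_nat; apply: eq_bigr => i /andP[_ iq].
    rewrite -!mul2n !exprM; congr (_ ^+ m).
    have -> : (0 + q - i.+1 + q).+1%:R = l%:R - i.+1%:R :> R.
      by rewrite -natrB; [congr (_%:R); lia|lia].
    have -> : (l%:R - i.+1%:R) * pi / l%:R = pi - i.+1%:R * pi / l%:R :> R.
      by field.
    rewrite cosB cospi sinpi.
    by rewrite mul0r addr0 mulN1r sqrrN.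
  by ring.
rewrite E1.
have p4 : 4 ^+ m != 0 :> R by rewrite expf_neq0.
apply: (mulfI p4).
(* With truncated subtraction, [(m - r) + (r - m)] is the distance |m - r|. *)
have -> : 4 ^+ m * \sum_(0 <= k < l) cos (k%:R * pi / l%:R) ^+ m.*2 =
   \sum_(0 <= r < m.*2.+1) 'C(m.*2, r)%:R *
     (if (l %| (m - r) + (r - m))%N then l%:R else 0) :> R.
  under [RHS]eq_bigr => r _ do rewrite -sum_cos_roots// mulr_sumr.
  rewrite exchange_big/= mulr_sumr; apply: eq_bigr => k _.
  have -> : 4 ^+ m = 2 ^+ m.*2 :> R by rewrite -mul2n exprM; congr (_ ^+ m); ring.
  rewrite -exprMn cos_pow; apply: eq_bigr => r _; congr (_ * _).
  have [mr|rm] := leqP m r.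
    have -> : (m - r + (r - m) = r - m)%N by lia.
    rewrite -cosN; congr cos; rewrite natrB// -mul2n natrM; ring.
  have -> : (m - r + (r - m) = m - r)%N by lia.
  congr cos; rewrite (natrB _ (ltnW rm)) -mul2n natrM; ring.
rewrite (sum_sym (g := fun r => 'C(m.*2, r)%:R *
     (if (l %| (m - r) + (r - m))%N then l%:R else 0))); last first.
  move=> j jm; congr (_%:R * _).
    by rewrite -[RHS]bin_sub; [congr binomial; lia|lia].
  by have -> : (m - (m - j) + (m - j - m) = m - (m + j) + (m + j - m))%N by lia.
have -> : \sum_(0 <= j < m) 'C(m.*2, m + j.+1)%:R *
     (if (l %| m - (m + j.+1) + (m + j.+1 - m))%N then l%:R else 0) =
   l%:R * 'C(m.*2, m)%:R * \sum_(0 <= k < m) binratio m (k.+1 * l) :> R.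
  (* The range is enlarged from m to m * l, where [sum_dvd] applies; the added terms vanish because
     [binratio m] is zero beyond m. *)
  rewrite -(sum_dvd (binratio m))// [in RHS](@big_cat_nat _ _ _ m)//=; last by lia.
  rewrite [X in _ * (_ + X)]big_nat [X in _ * (_ + X)]big1 ?addr0; last first.
    by move=> i /andP[mi _]; case: ifP => // _; rewrite binratio_gt.
  rewrite mulr_sumr; apply: eq_bigr => j _.
  have -> : (m - (m + j.+1) + (m + j.+1 - m) = j.+1)%N by lia.
  case: ifP => _; last by rewrite !mulr0.
  by rewrite /binratio; field; exact: bin_mid_neq0.
rewrite subnn addn0 dvdn0.
by field.
Qed.

End FiniteTheta.

(** * Gaussian limits of powers of cosines and of binomial ratios *)

Section ThetaLimit.
Context {R : realType}.
Implicit Types (x y c r s : R).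

Lemma cvg_sqr (f : nat -> R) (a : R) :
  f @ \oo --> a -> (fun n => f n ^+ 2) @ \oo --> a ^+ 2.
Proof.
move=> fa; rewrite expr2; under eq_fun do rewrite expr2.
exact: (cvgM fa fa).
Qed.

Lemma sin_mvt y : 0 < y -> exists2 t : R, 0 < t < y & sin y = cos t * y.
Proof.
move=> y0.
have [|t] := @MVT R sin cos 0 y y0 (fun x _ => is_derive_sin x).
  exact/continuous_subspaceT/continuous_sin.
by rewrite in_itv/= sin0 !subr0; exists t.
Qed.

Lemma sin_le_id y : 0 <= y -> sin y <= y.
Proof.
rewrite le_eqVlt => /predU1P[<-|y0]; first by rewrite sin0.
have [t _ ->] := sin_mvt y0.
by rewrite ler_piMl ?cos_le1// ltW.
Qed.

Lemma sin_double y : sin y = 2 * (sin (y / 2) * cos (y / 2)).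
Proof. rewrite [in LHS](_ : y = y / 2 + y / 2); last by field.
by rewrite sinD; ring.
Qed.

Lemma cos_double y : cos y = 1 - 2 * sin (y / 2) ^+ 2.
Proof.
rewrite [in LHS](_ : y = y / 2 + y / 2); last by field.
by rewrite cosD -!expr2 cos2sin2; ring.
Qed.

Lemma cos_ge_quad y : 0 <= y -> 1 - y ^+ 2 / 2 <= cos y.
Proof.
move=> y0; rewrite cos_double.
have y4 : y ^+ 2 = 4 * ((y / 2) * (y / 2)) by field.
have [s0|s0] := leP 0 (sin (y / 2)).
  have h := sin_le_id (divr_ge0 y0 (ler0n R 2)).
  have : sin (y / 2) * sin (y / 2) <= (y / 2) * (y / 2) by apply: ler_pM.
  by rewrite y4 expr2; lra.
have p := @pi_ge2 R.
have y2 : 1 < y / 2.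
  rewrite ltNge; apply/negP => y2.
  have : 0 <= sin (y / 2) by apply: sin_ge0_pi; apply/andP; split; lra.
  by rewrite leNgt s0.
have : 1 * 1 <= (y / 2) * (y / 2) by apply: ler_pM => //; exact: ltW.
have : sin (y / 2) ^+ 2 <= 1 by rewrite sin2cos2 gerBl sqr_ge0.
by rewrite y4; lra.
Qed.

(** The inequality y <= tan y with the denominator cleared, which keeps it meaningful up to pi. *)
Lemma sin_ge_cos y : 0 <= y <= pi -> y * cos y <= sin y.
Proof.
move=> /andP[]; rewrite le_eqVlt => /predU1P[<-|y0 ypi].
  by rewrite mul0r sin0.
have [t /andP[t0 ty] ->] := sin_mvt y0.
rewrite mulrC ler_pM2r// ltW// ltr_cos// in_itv/=.
- by rewrite (ltW t0) (le_trans (ltW ty)).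
- by rewrite (ltW y0).
Qed.

Lemma sin_ge_half y : 0 <= y <= pi / 2 -> y / 2 <= sin y.
Proof.
move=> /andP[y0 ypi].
have p := @pi_gt0 R.
rewrite sin_double.
have h : y / 2 * cos (y / 2) <= sin (y / 2).
  by apply: sin_ge_cos; apply/andP; split; lra.
have c0 : 0 <= cos (y / 2) by apply: cos_ge0_pihalf; apply/andP; split; lra.
have c2 : 2^-1 <= cos (y / 2) ^+ 2.
  have : 0 <= cos y by apply: cos_ge0_pihalf; apply/andP; split; lra.
  by rewrite cos_double cos2sin2; lra.
have : y / 2 * cos (y / 2) * cos (y / 2) <= sin (y / 2) * cos (y / 2).
  by rewrite ler_wpM2r.
have : y / 2 * 2^-1 <= y / 2 * cos (y / 2) ^+ 2 by rewrite ler_wpM2l// divr_ge0.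
by rewrite expr2 -mulrA; lra.
Qed.

Lemma exp_lower s : s < 1 -> expR (- (s / (1 - s))) <= 1 - s.
Proof.
move=> s1; have h : 0 < 1 - s by lra.
rewrite expRN invf_ple ?posrE ?expR_gt0//.
apply: le_trans (expR_ge1Dx _).
by rewrite le_eqVlt; apply/orP; left; apply/eqP; field; lra.
Qed.

Lemma exp_upper s : 1 - s <= expR (- s).
Proof. exact: expR_ge1Dx. Qed.

(** The dominating bound for Tannery's theorem: valid up to pi / 2, with the lossy constant 1/4 that
    comes from sin y >= y / 2. The next two lemmas have the exact constant as y tends to 0 and give
    the limit. *)
Lemma cos_pow_dom y m : 0 <= y <= pi / 2 ->
  0 <= cos y ^+ m.*2 <= expR (- (m%:R * y ^+ 2 / 4)).
Proof.
move=> yp; rewrite -mul2n exprM; apply/andP; split.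
  by rewrite exprn_ge0// sqr_ge0.
have -> : - (m%:R * y ^+ 2 / 4) = m%:R * (- (y ^+ 2 / 4)) by ring.
rewrite expRM_natl; apply: lerXn2r; rewrite ?nnegrE ?sqr_ge0 ?expR_ge0//.
rewrite cos2sin2; apply: le_trans (exp_upper _).
have := sin_ge_half yp; move/andP: yp => [y0 _]; nra.
Qed.

Lemma cos_pow_lower y m : 0 <= y < 1 ->
  expR (- (m%:R * y ^+ 2 / (1 - y ^+ 2))) <= cos y ^+ m.*2.
Proof.
move=> /andP[y0 y1]; rewrite -mul2n exprM.
have -> : - (m%:R * y ^+ 2 / (1 - y ^+ 2)) = m%:R * (- (y ^+ 2 / (1 - y ^+ 2))).
  by ring.
rewrite expRM_natl; apply: lerXn2r; rewrite ?nnegrE ?sqr_ge0 ?expR_ge0//.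
apply: le_trans (exp_lower _) _; first by nra.
have := cos_ge_quad y0; have := @cos_geN1 R y; nra.
Qed.

Lemma cos_pow_upper y m : 0 <= y < 1 ->
  cos y ^+ m.*2 <= expR (- (m%:R * y ^+ 2 * (1 - y ^+ 2 / 2) ^+ 2)).
Proof.
move=> /andP[y0 y1]; rewrite -mul2n exprM.
have -> : - (m%:R * y ^+ 2 * (1 - y ^+ 2 / 2) ^+ 2) =
  m%:R * (- (y ^+ 2 * (1 - y ^+ 2 / 2) ^+ 2)) by ring.
rewrite expRM_natl; apply: lerXn2r; rewrite ?nnegrE ?sqr_ge0 ?expR_ge0//.
rewrite cos2sin2; apply: le_trans (exp_upper _).
have p := @pi_ge2 R.
have h1 := cos_ge_quad y0.
have h2 : y * cos y <= sin y by apply: sin_ge_cos; apply/andP; split; lra.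
have h3 : y * (1 - y ^+ 2 / 2) <= sin y.
  by apply: le_trans h2; rewrite ler_wpM2l.
have h4 : 0 <= y * (1 - y ^+ 2 / 2) by rewrite mulr_ge0//; nra.
rewrite lerD2l lerN2 -exprMn; apply: lerXn2r => //.
by rewrite nnegrE (le_trans h4).
Qed.

(** Consecutive ratios are 1 / (1 + (2 i + 1) / (m - i)), and the odd numbers 2 i + 1 for i < j add
    up to j^2. The bound [J] freezes the denominators so that the exponents can be added. *)
Lemma binratio_lower m j J : (j <= J)%N -> (J < m)%N ->
  expR (- (j%:R ^+ 2 / (m - J)%:R)) <= @binratio R m j.
Proof.
move=> + Jm; elim: j => [|j IH] jJ.
  by rewrite expr0n/= mul0r oppr0 expR0 binratio0.
rewrite binratioS; last by lia.
have -> : - (j.+1%:R ^+ 2 / (m - J)%:R) =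
   - (j%:R ^+ 2 / (m - J)%:R) + - ((j.*2.+1)%:R / (m - J)%:R) :> R.
  by rewrite -natr1 -[j.*2.+1%:R]natr1 -mul2n natrM; ring.
rewrite expRD; apply: ler_pM; rewrite ?expR_ge0//; first exact: (IH (ltnW jJ)).
have mj : 0 < (m - j)%:R :> R by rewrite ltr0n; lia.
rewrite expRN -[leRHS]invf_div lef_pV2 ?posrE ?expR_gt0// ?divr_gt0//.
have -> : (m + j).+1%:R / (m - j)%:R = 1 + j.*2.+1%:R / (m - j)%:R :> R.
  have -> : (m + j).+1%:R = (m - j)%:R + j.*2.+1%:R :> R.
    by rewrite -natrD; congr (_%:R); lia.
  by field; lra.
apply: le_trans (expR_ge1Dx _) _; rewrite ler_expR.
rewrite ler_wpM2l ?ler0n// lef_pV2 ?posrE ?ltr0n ?ler_nat; lia.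
Qed.

Lemma binratio_upper m j J : (j <= J)%N -> (J <= m)%N ->
  0 <= @binratio R m j <= expR (- (j%:R ^+ 2 / (m + J)%:R)).
Proof.
move=> + Jm; rewrite {1}/binratio divr_ge0//=; elim: j => [|j IH] jJ.
  by rewrite expr0n/= mul0r oppr0 expR0 binratio0.
rewrite binratioS; last by lia.
have -> : - (j.+1%:R ^+ 2 / (m + J)%:R) =
   - (j%:R ^+ 2 / (m + J)%:R) + - ((j.*2.+1)%:R / (m + J)%:R) :> R.
  by rewrite -natr1 -[j.*2.+1%:R]natr1 -mul2n natrM; ring.
rewrite expRD; apply: ler_pM; rewrite ?divr_ge0//; first exact: (IH (ltnW jJ)).
have mj : 0 < (m + j).+1%:R :> R by rewrite ltr0n.
have -> : (m - j)%:R / (m + j).+1%:R = 1 - j.*2.+1%:R / (m + j).+1%:R :> R.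
  have -> : (m - j)%:R = (m + j).+1%:R - j.*2.+1%:R :> R.
    by rewrite -natrB; [congr (_%:R); lia | lia].
  by field; lra.
apply: le_trans (exp_upper _) _; rewrite ler_expR lerN2.
rewrite ler_wpM2l ?ler0n// lef_pV2 ?posrE ?ltr0n ?ler_nat; lia.
Qed.

Definition theta_term x k : R := expR (- (pi * k.+1%:R ^+ 2 * x)).
(** The Jacobi theta function is 1 + 2 [theta_tail]. *)
Definition theta_tail x : R := limn (series (theta_term x)).

Lemma exp_sq_series_cvg c : 0 < c ->
  cvgn (series (fun k => expR (- (c * k.+1%:R ^+ 2)) : R)).
Proof.
move=> c0; apply: (@series_le_cvg _ _ (geometric 1 (expR (- c)))).
- by move=> k; rewrite expR_ge0.
- by move=> k; rewrite /geometric/= mul1r exprn_ge0 ?expR_ge0.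
- move=> k; rewrite /geometric/= mul1r -expRM_natl ler_expR mulrN lerN2 mulrC.
  rewrite ler_pM2l// -natrX ler_nat; nia.
- by apply: is_cvg_geometric_series; rewrite ger0_norm ?expR_ge0// expR_lt1; lra.
Qed.

Lemma theta_series_cvg x : 0 < x -> cvgn (series (theta_term x)).
Proof.
move=> x0; have -> : theta_term x = (fun k => expR (- (pi * x * k.+1%:R ^+ 2))).
  by apply/funext => k; congr (expR (- _)); ring.
by apply: exp_sq_series_cvg; rewrite mulr_gt0 ?pi_gt0.
Qed.

Lemma theta_tail_ge0 x : 0 < x -> 0 <= theta_tail x.
Proof.
move=> x0; apply: limr_ge; first exact: theta_series_cvg.
by near=> n; apply: sumr_ge0 => i _; exact: expR_ge0.
Unshelve. all: by end_near. Qed.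

(* (2 theta_q + 1) / sqrt m tends to sqrt (pi / x): this is the number of roots of unity
   over which (2 cos) ^ (2 m) is averaged. *)
Definition theta_q x m : nat := Num.truncn (Num.sqrt (pi / x) * Num.sqrt m%:R / 2).

Lemma theta_qP x m : 0 < x ->
  Num.sqrt (pi / x) * Num.sqrt m%:R - 1 <= (theta_q x m).*2.+1%:R
    <= Num.sqrt (pi / x) * Num.sqrt m%:R + 1.
Proof.
move=> x0; rewrite /theta_q; set u := Num.sqrt (pi / x) * _.
have u0 : 0 <= u / 2 by rewrite divr_ge0// mulr_ge0// sqrtr_ge0.
have := truncn_itv u0; set q := Num.truncn _ => /andP[h1 h2].
move: h2; rewrite -[q.+1%:R]natr1 -[q.*2.+1%:R]natr1 -mul2n natrM => h2.
by apply/andP; split; lra.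
Qed.

Lemma cvg_sqrtV0 : (fun m : nat => (Num.sqrt m%:R)^-1 : R) @ \oo --> (0 : R).
Proof.
apply/cvgrPdist_lt => e e0.
exists (Num.truncn (e^-1 ^+ 2)).+1 => // m /= hm.
have ei : 0 < e^-1 by rewrite invr_gt0.
have h : e^-1 ^+ 2 < m%:R.
  by apply: lt_le_trans (truncnS_gt _) _; rewrite ler_nat.
have m0 : 0 < m%:R :> R by apply: le_lt_trans h; exact: sqr_ge0.
have h' : e^-1 < Num.sqrt m%:R.
  by rewrite -(@ltr_pXn2r _ 2)// ?nnegrE ?sqrtr_ge0 ?ltW// sqr_sqrtr// ltW.
rewrite sub0r normrN ger0_norm ?invr_ge0 ?sqrtr_ge0//.
by rewrite invf_plt ?posrE// sqrtr_gt0.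
Qed.

(** [l] counts the roots of unity and [s] is the vanishing scale m^(-1/2). Both limits below are
    expressed by [r], which converges, and [s], which tends to 0. *)
Let l x m : R := (theta_q x m).*2.+1%:R.
Let s m : R := (Num.sqrt m%:R)^-1.
Let r x m : R := l x m * s m.

Lemma theta_r_cvg x : 0 < x -> r x @ \oo --> Num.sqrt (pi / x).
Proof.
move=> x0; set c := Num.sqrt _.
have h1 : (fun m => c - s m) @ \oo --> c.
  by rewrite -[X in _ --> X]subr0; apply: cvgB; [exact: cvg_cst|exact: cvg_sqrtV0].
have h2 : (fun m => c + s m) @ \oo --> c.
  by rewrite -[X in _ --> X]addr0; apply: cvgD; [exact: cvg_cst|exact: cvg_sqrtV0].
apply: (squeeze_cvgr _ h1 h2); exists 1%N => // m /= m0.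
have sm : 0 < Num.sqrt m%:R :> R by rewrite sqrtr_gt0 ltr0n.
have /andP[lo hi] := theta_qP m x0.
rewrite -/c in lo hi; rewrite /r /l /s.
rewrite -(ler_pM2r sm) -[X in _ && X](ler_pM2r sm) mulfVK ?gt_eqF//.
by rewrite mulrBl mulrDl mulVf ?gt_eqF// lo hi.
Qed.

Lemma theta_sqE m : (0 < m)%N -> m%:R * s m ^+ 2 = 1 :> R.
Proof.
move=> m0; rewrite /s exprVn sqr_sqrtr ?ler0n// mulfV// pnatr_eq0 -lt0n//.
Qed.

Lemma theta_s_gt0 m : (0 < m)%N -> 0 < s m.
Proof. by move=> m0; rewrite invr_gt0 sqrtr_gt0 ltr0n. Qed.

Lemma theta_sV m : (0 < m)%N -> m%:R = (s m ^+ 2)^-1.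
Proof.
move=> m0; have s0 : s m ^+ 2 != 0 by rewrite expf_neq0// gt_eqF// theta_s_gt0.
by apply: (mulIf s0); rewrite mulVf// theta_sqE.
Qed.

(** For the angle y = (k + 1) pi / l, the product m y^2 tends to (k + 1)^2 pi^2 / (pi / x), the
    exponent of the theta term at x; [cos_pow_lower] and [cos_pow_upper] squeeze the power. *)
Lemma theta_cvg_cos x k : 0 < x ->
  (fun m => cos (k.+1%:R * pi / l x m) ^+ m.*2) @ \oo --> theta_term x k.
Proof.
move=> x0; have rc := theta_r_cvg x0; have sc : s @ \oo --> 0 := cvg_sqrtV0.
have p0 := @pi_gt0 R.
set c := Num.sqrt (pi / x) in rc.
have c0 : 0 < c by rewrite sqrtr_gt0 divr_gt0.
pose A : R := (k.+1%:R * pi) ^+ 2.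
have AE : A / c ^+ 2 = pi * k.+1%:R ^+ 2 * x.
  have pn : pi != 0 :> R by rewrite gt_eqF.
  have xn : x != 0 by rewrite gt_eqF.
  rewrite sqr_sqrtr; last by rewrite divr_ge0// ltW.
  by rewrite /A invf_div mulrA; apply: (mulIf pn); rewrite mulfVK//; ring.
have irc : (fun m => A / r x m ^+ 2) @ \oo --> A / c ^+ 2.
  apply: cvgM; first exact: cvg_cst.
  apply: cvgV; first by rewrite expf_neq0// gt_eqF.
  exact: cvg_sqr.
have s2 : (fun m => s m ^+ 2) @ \oo --> (0 : R).
  by have := cvg_sqr sc; rewrite expr0n.
have yc : (fun m => A / r x m ^+ 2 * s m ^+ 2) @ \oo --> (0 : R).
  by rewrite -(mulr0 (A / c ^+ 2)); apply: cvgM.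
have ec : forall g : nat -> R, g @ \oo --> A / c ^+ 2 ->
    (fun m => expR (- g m)) @ \oo --> theta_term x k.
  move=> g gc; rewrite /theta_term -AE.
  by apply: (cvg_comp _ _ (cvgN gc)); exact: continuous_expR.
have l1 : (fun m => A / r x m ^+ 2 / (1 - A / r x m ^+ 2 * s m ^+ 2)) @ \oo -->
    A / c ^+ 2.
  rewrite -[X in _ --> X]divr1; apply: cvgM => //.
  rewrite -[X in X^-1]subr0; apply: cvgV; first by rewrite subr0 oner_eq0.
  by apply: cvgB => //; exact: cvg_cst.
have l2 : (fun m => A / r x m ^+ 2 * (1 - A / r x m ^+ 2 * s m ^+ 2 / 2) ^+ 2) @ \oo
    --> A / c ^+ 2.
  rewrite -[X in _ --> X]mulr1; apply: cvgM => //.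
  have h : (fun m => 1 - A / r x m ^+ 2 * s m ^+ 2 / 2) @ \oo --> (1 : R).
    rewrite -[X in _ --> X]subr0; apply: cvgB; first exact: cvg_cst.
    by rewrite -(mul0r 2^-1); apply: cvgM => //; exact: cvg_cst.
  by have := cvg_sqr h; rewrite expr1n.
apply: (squeeze_cvgr _ (ec _ l1) (ec _ l2)).
have /cvgrPdist_lt /(_ _ ltr01) ysm := yc.
near=> m.
have m0 : (0 < m)%N by near: m; exists 1%N.
have l0 : 0 < l x m by rewrite ltr0n.
have sE := theta_sqE m0.
have s0 : s m != 0 by rewrite gt_eqF// theta_s_gt0.
have mi := theta_sV m0.
have y2 : (k.+1%:R * pi / l x m) ^+ 2 = A / r x m ^+ 2 * s m ^+ 2.
  by rewrite /A /r; field; rewrite s0 gt_eqF.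
have my2 : m%:R * (k.+1%:R * pi / l x m) ^+ 2 = A / r x m ^+ 2.
  by rewrite y2 mulrCA sE mulr1.
have yr : 0 <= k.+1%:R * pi / l x m < 1.
  apply/andP; split; first by rewrite divr_ge0 ?mulr_ge0 ?ler0n// ltW.
  rewrite -[ltRHS](expr1n _ 1) -(@ltr_pXn2r _ 2)// ?nnegrE ?expr1n//; last first.
    by rewrite divr_ge0 ?mulr_ge0 ?ler0n// ltW.
  rewrite y2; apply: le_lt_trans (ler_norm _) _.
  by rewrite -normrN -sub0r; near: m; exact: ysm.
have := cos_pow_lower m yr; have := cos_pow_upper m yr.
by rewrite my2 y2 => -> ->.
Unshelve. all: by end_near. Qed.

(** Here j = (k + 1) l and j^2 / m tends to (k + 1)^2 pi / x. The same [l] that puts x into the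
    angles puts 1 / x into the binomial coefficients. *)
Lemma theta_cvg_bin x k : 0 < x ->
  (fun m => binratio m (k.+1 * (theta_q x m).*2.+1) : R) @ \oo -->
  theta_term x^-1 k.
Proof.
move=> x0; have rc := theta_r_cvg x0; have sc : s @ \oo --> 0 := cvg_sqrtV0.
have p0 := @pi_gt0 R.
set c := Num.sqrt (pi / x) in rc.
have c0 : 0 < c by rewrite sqrtr_gt0 divr_gt0.
set b : R := k.+1%:R.
have AE : (b * c) ^+ 2 = pi * k.+1%:R ^+ 2 * x^-1.
  by rewrite exprMn sqr_sqrtr ?divr_ge0 ?ltW// /b; ring.
have brc : (fun m => b * r x m) @ \oo --> b * c.
  by apply: cvgM => //; exact: cvg_cst.
have br2 : (fun m => (b * r x m) ^+ 2) @ \oo --> (b * c) ^+ 2.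
  exact: cvg_sqr.
have brs : (fun m => b * r x m * s m) @ \oo --> (0 : R).
  by rewrite -(mulr0 (b * c)); exact: cvgM.
have ec : forall g : nat -> R, g @ \oo --> (b * c) ^+ 2 ->
    (fun m => expR (- g m)) @ \oo --> theta_term x^-1 k.
  move=> g gc; rewrite /theta_term -AE.
  by apply: (cvg_comp _ _ (cvgN gc)); exact: continuous_expR.
have l1 : (fun m => (b * r x m) ^+ 2 / (1 - b * r x m * s m)) @ \oo --> (b * c) ^+ 2.
  rewrite -[X in _ --> X]divr1; apply: cvgM => //.
  rewrite -[X in X^-1]subr0; apply: cvgV; first by rewrite subr0 oner_eq0.
  by apply: cvgB => //; exact: cvg_cst.
have l2 : (fun m => (b * r x m) ^+ 2 / (1 + b * r x m * s m)) @ \oo --> (b * c) ^+ 2.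
  rewrite -[X in _ --> X]divr1; apply: cvgM => //.
  rewrite -[X in X^-1]addr0; apply: cvgV; first by rewrite addr0 oner_eq0.
  by apply: cvgD => //; exact: cvg_cst.
apply: (squeeze_cvgr _ (ec _ l1) (ec _ l2)).
have /cvgrPdist_lt /(_ _ ltr01) ysm := brs.
near=> m.
have m0 : (0 < m)%N by near: m; exists 1%N.
have mR : 0 < m%:R :> R by rewrite ltr0n.
have sE := theta_sqE m0.
have s0 : s m != 0 by rewrite gt_eqF// theta_s_gt0.
have sp := theta_s_gt0 m0.
set J := (k.+1 * (theta_q x m).*2.+1)%N.
have JE : J%:R = b * l x m by rewrite /J natrM.
have brsE : b * r x m * s m = J%:R / m%:R.
  rewrite (theta_sV m0).
  by rewrite JE /r; field; rewrite s0.
have Jm : (J < m)%N.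
  rewrite -(ltr_nat R) -[ltRHS]mul1r -ltr_pdivrMr// -brsE.
  apply: le_lt_trans (ler_norm _) _.
  by rewrite -normrN -sub0r; near: m; exact: ysm.
have J2 : (b * r x m) ^+ 2 = J%:R ^+ 2 / m%:R.
  rewrite (theta_sV m0).
  by rewrite JE /r; field; rewrite s0.
have := binratio_lower (leqnn J) Jm; have /andP[_] := binratio_upper (leqnn J) (ltnW Jm).
rewrite natrB ?(ltnW Jm)// natrD.
have -> : J%:R ^+ 2 / (m%:R + J%:R) = (b * r x m) ^+ 2 / (1 + b * r x m * s m).
  rewrite brsE J2; field; rewrite !gt_eqF//= -?natrD ?ltr0n//; lia.
have -> : J%:R ^+ 2 / (m%:R - J%:R) = (b * r x m) ^+ 2 / (1 - b * r x m * s m).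
  rewrite brsE J2; field; rewrite !gt_eqF//= -?natrB ?(ltnW Jm)// ltr0n; lia.
by move=> -> ->.
Unshelve. all: by end_near. Qed.

End ThetaLimit.

(** * The functional equation as a uniqueness of limits *)

Section ThetaFunctional.
Context {R : realType}.

Let K m : R := 'C(m.*2, m)%:R / 4 ^+ m * Num.sqrt m%:R.

(** The finite identity is solved for the central coefficient. The sequence [K] does not depend on
    x, whereas the expression found for its limit does. *)
Lemma bin_mid_cvg (x : R) : 0 < x ->
  K @ \oo --> (1 + 2 * theta_tail x) /
     (1 + 2 * theta_tail x^-1) / Num.sqrt (pi / x).
Proof.
move=> x0; have xi0 : 0 < x^-1 by rewrite invr_gt0.
have p0 := @pi_gt0 R.
set c := Num.sqrt (pi / x); have c0 : 0 < c by rewrite sqrtr_gt0 divr_gt0.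
pose l m : R := (theta_q x m).*2.+1%:R.
have sm m : (0 < m)%N -> 0 < Num.sqrt m%:R :> R by rewrite sqrtr_gt0 ltr0n.
have sm1 m : (0 < m)%N -> 1 <= Num.sqrt m%:R :> R.
  by move=> m0; rewrite -[leLHS](@sqrtr1 R) ler_wsqrtr// ler1n.
have lhi m : (0 < m)%N -> l m <= (c + 1) * Num.sqrt m%:R.
  move=> m0; have /andP[_] := theta_qP m x0; rewrite -/c -/(l m).
  by have := sm1 _ m0; lra.
(* Half the sum of l >= c sqrt m - 1 and l >= 1. *)
have llo m : c / 2 * Num.sqrt m%:R <= l m.
  have /andP[+ _] := theta_qP m x0; rewrite -/c -/(l m).
  have l1 : 1 <= l m by rewrite /l ler1n.
  by set u := Num.sqrt m%:R; nra.
have A : (fun m => 1 + 2 * \sum_(0 <= k < theta_q x m)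
     cos (k.+1%:R * pi / l m) ^+ m.*2) @ \oo --> 1 + 2 * theta_tail x.
  apply: cvgD; first exact: cvg_cst.
  apply: cvgM; first exact: cvg_cst.
  (* From [cos_pow_dom] and l <= (c + 1) sqrt m: m y^2 / 4 is at least [de] (k + 1)^2. *)
  set de := pi ^+ 2 / (4 * (c + 1) ^+ 2).
  have de0 : 0 < de by rewrite divr_gt0 ?mulr_gt0 ?exprn_gt0//; lra.
  pose a m k := if (k < theta_q x m)%N then cos (k.+1%:R * pi / l m) ^+ m.*2 else 0 : R.
  have -> : (fun m => \sum_(0 <= k < theta_q x m) cos (k.+1%:R * pi / l m) ^+ m.*2) =
            (fun m => \sum_(0 <= k < theta_q x m) a m k).
    apply/funext => m; rewrite !big_nat; apply: eq_bigr => i /andP[_ h].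
    by rewrite /a h.
  apply: (tannery (d := fun k => expR (- (de * k.+1%:R ^+ 2)))).
  - move=> m k; rewrite /a; case: ifP => [kq|_]; last by rewrite normr0 expR_ge0.
    have m0 : (0 < m)%N.
      rewrite lt0n; apply/eqP => m0; move: kq.
      by rewrite m0 /theta_q sqrtr0 mulr0 mul0r truncn0.
    have l0 : 0 < l m by rewrite ltr0n.
    have yp : 0 <= k.+1%:R * pi / l m <= pi / 2.
      apply/andP; split; first by rewrite divr_ge0 ?mulr_ge0 ?ler0n ?ltW.
      rewrite ler_pdivrMr//.
      have : (k.+1.*2%:R : R) <= l m by rewrite ler_nat; lia.
      rewrite -mul2n natrM -(ler_pM2r p0); lra.
    have /andP[h1 h2] := cos_pow_dom m yp.
    rewrite ger0_norm//; apply: le_trans h2 _; rewrite ler_expR lerN2 /de.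
    have h3 := lhi _ m0.
    have -> : m%:R * (k.+1%:R * pi / l m) ^+ 2 / 4 =
       (pi ^+ 2 * k.+1%:R ^+ 2 / 4) * (m%:R / l m ^+ 2) :> R.
      by field; rewrite gt_eqF.
    have -> : pi ^+ 2 / (4 * (c + 1) ^+ 2) * k.+1%:R ^+ 2 =
       (pi ^+ 2 * k.+1%:R ^+ 2 / 4) * ((c + 1) ^+ 2)^-1 :> R by field; lra.
    rewrite ler_wpM2l ?divr_ge0 ?mulr_ge0 ?sqr_ge0 ?(ltW p0)//.
    rewrite ler_pdivlMr ?exprn_gt0// mulrC ler_pdivrMr ?exprn_gt0//; last by lra.
    apply: (@le_trans _ _ (((c + 1) * Num.sqrt m%:R) ^+ 2)).
      by apply: lerXn2r => //; rewrite nnegrE ltW//; apply: lt_le_trans h3.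
    by rewrite exprMn sqr_sqrtr ?ler0n// mulrC.
  - exact: exp_sq_series_cvg.
  - move=> k; have := @theta_cvg_cos R x k x0; apply: cvg_trans; apply: near_eq_cvg.
    have kc : (fun m => (Num.sqrt m%:R)^-1 : R) @ \oo --> (0:R) := cvg_sqrtV0.
    have e0 : 0 < c / (2 * k%:R + 3) by rewrite divr_gt0// ltr_wpDl ?mulr_ge0.
    have /cvgrPdist_lt /(_ _ e0) hn := kc.
    near=> m; rewrite /a ifT//.
    have m0 : (0 < m)%N by near: m; exists 1%N.
    have : `|0 - (Num.sqrt m%:R)^-1| < c / (2 * k%:R + 3) by near: m; exact: hn.
    rewrite sub0r normrN ger0_norm ?invr_ge0 ?sqrtr_ge0//.
    rewrite invf_plt ?posrE ?sm// invf_div ltr_pdivrMr// => h.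
    have /andP[] := theta_qP m x0; rewrite -/c => h1 _.
    have : (k.*2.+1%:R : R) < (theta_q x m).*2.+1%:R.
      by rewrite -[k.*2.+1%:R]natr1 -mul2n natrM; lra.
    by rewrite ltr_nat; lia.
  - by move=> m k; rewrite /a ltnNge => ->.
have B : (fun m => 1 + 2 * \sum_(0 <= k < m)
     binratio m (k.+1 * (theta_q x m).*2.+1)) @ \oo --> 1 + 2 * theta_tail x^-1.
  apply: cvgD; first exact: cvg_cst.
  apply: cvgM; first exact: cvg_cst.
  (* From [binratio_upper] with J = j <= m, so that m + J <= 2 m, and l >= c sqrt m / 2. *)
  set de := c ^+ 2 / 8.
  have de0 : 0 < de by rewrite divr_gt0 ?exprn_gt0.
  apply: (tannery (a := fun m k => binratio m (k.+1 * (theta_q x m).*2.+1))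
     (d := fun k => expR (- (de * k.+1%:R ^+ 2))) (N := id)).
  - move=> m k; set j := (_ * _)%N.
    have [jm|mj] := leqP j m; last by rewrite binratio_gt// normr0 expR_ge0.
    have m0 : (0 < m)%N by apply: leq_trans jm; rewrite muln_gt0.
    have /andP[h1 h2] := @binratio_upper R _ _ _ jm (leqnn m).
    rewrite ger0_norm//; apply: le_trans h2 _; rewrite ler_expR lerN2 /de.
    have jE : j%:R = k.+1%:R * l m by rewrite /j natrM.
    rewrite jE ler_pdivlMr; last by rewrite ltr0n; lia.
    rewrite natrD.
    have h4 : (c / 2 * Num.sqrt m%:R) ^+ 2 <= l m ^+ 2.
      apply: lerXn2r => //; rewrite nnegrE ?ler0n//.
      by rewrite mulr_ge0 ?sqrtr_ge0// ltW// divr_gt0.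
    move: h4; rewrite exprMn sqr_sqrtr ?ler0n// => h4.
    have := ler_wpM2l (sqr_ge0 (k.+1%:R : R)) h4.
    by rewrite exprMn; lra.
  - exact: exp_sq_series_cvg.
  - by move=> k; exact: theta_cvg_bin.
  - by move=> m k mk; rewrite binratio_gt//; nia.
have t0 y : 0 < y -> 0 < 1 + 2 * theta_tail y :> R.
  by move=> y0; have := theta_tail_ge0 y0; lra.
have rc := theta_r_cvg x0; rewrite -/c in rc.
have hh := cvgM (cvgM A (cvgV (lt0r_neq0 (t0 _ xi0)) B)) (cvgV (lt0r_neq0 c0) rc).
apply: cvg_trans (hh _ _ _ _); apply: near_eq_cvg; near=> m.
have m0 : (0 < m)%N by near: m; exists 1%N.
have b1 : 0 < 1 + 2 * \sum_(0 <= k < m) binratio m (k.+1 * (theta_q x m).*2.+1) :> R.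
  rewrite ltr_wpDr// mulr_ge0// sumr_ge0// => i _.
  by rewrite /binratio divr_ge0.
rewrite /= (cos_sum_binratio m (theta_q x m)) /K -/(l m).
have l0 : 0 < l m by rewrite ltr0n.
field.
by rewrite !gt_eqF ?sm// ?exprn_gt0.
Unshelve. all: by end_near. Qed.

(** Compare the limits of [K] given by [bin_mid_cvg] at x and at 1: at 1 the two theta values cancel
    and 1 / sqrt pi remains. *)
Lemma theta_functional (x : R) : 0 < x ->
  1 + 2 * theta_tail x^-1 = Num.sqrt x * (1 + 2 * theta_tail x).
Proof.
move=> x0; have p0 := @pi_gt0 R; have xi0 : 0 < x^-1 by rewrite invr_gt0.
have t0 y : 0 < y -> 1 + 2 * theta_tail y != 0 :> R.
  by move=> y0; rewrite gt_eqF//; have := theta_tail_ge0 y0; lra.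
have := cvg_unique _ (bin_mid_cvg x0) (bin_mid_cvg ltr01).
move=> /(_ (@norm_hausdorff _ _) _) h.
rewrite invr1 divff ?t0// mulr1 mul1r in h.
have s0 : Num.sqrt pi != 0 :> R by rewrite gt_eqF// sqrtr_gt0.
have sx : Num.sqrt x != 0 by rewrite gt_eqF// sqrtr_gt0.
move: h; rewrite sqrtrM ?ltW// sqrtrV ?ltW// => h.
set a := 1 + 2 * theta_tail x in h *; set b := 1 + 2 * theta_tail x^-1 in h *.
have b0 : b != 0 by exact: t0.
have -> : Num.sqrt x * a = a / b / (Num.sqrt pi / Num.sqrt x) * (b * Num.sqrt pi).
  by field; rewrite s0 sx b0.
by rewrite h; field.
Qed.

End ThetaFunctional.

(** * Laplace transforms on the line *)

(* Locked, since unification otherwise unfolds the integral. *)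
HB.lock Definition I (R : realType) (f : R -> R) : R :=
  \int[@lebesgue_measure R]_x f x.

(** * Integrals over the whole line: shifts, reflection, total derivatives *)

Section RealIntegral.
Context {R : realType}.
Notation mu := (@lebesgue_measure R).
Implicit Types (f g : R -> R) (c e : R).

Definition itg f := mu.-integrable setT (EFin \o f).

Lemma itg_measurable f : itg f -> measurable_fun setT f.
Proof. by move=> /(measurable_int mu) /measurable_EFinP. Qed.

Lemma itgD f g : itg f -> itg g -> itg (fun x => f x + g x).
Proof. by move=> hf hg; apply: eq_integrable (integrableD measurableT hf hg). Qed.

Lemma itgZ c f : itg f -> itg (fun x => c * f x).
Proof. by move=> hf; apply: eq_integrable (integrableZl measurableT c hf). Qed.

Lemma itgB f g : itg f -> itg g -> itg (fun x => f x - g x).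
Proof. by move=> hf hg; apply: eq_integrable (integrableB measurableT hf hg). Qed.

Lemma I_D f g : itg f -> itg g -> I (fun x => f x + g x) = I f + I g.
Proof. by move=> *; rewrite I.unlock RintegralD. Qed.

Lemma I_B f g : itg f -> itg g -> I (fun x => f x - g x) = I f - I g.
Proof. by move=> *; rewrite I.unlock RintegralB. Qed.

Lemma I_Z c f : itg f -> I (fun x => c * f x) = c * I f.
Proof. by move=> *; rewrite I.unlock RintegralZl. Qed.

Lemma I_le f g : itg f -> itg g -> (forall x, f x <= g x) -> I f <= I g.
Proof. by move=> hf hg fg; rewrite I.unlock; apply: le_Rintegral. Qed.

Lemma I_ge0 f : (forall x, 0 <= f x) -> 0 <= I f.
Proof. by move=> f0; rewrite I.unlock; apply: Rintegral_ge0. Qed.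

Lemma itg_dom f g : measurable_fun setT f -> (forall x, `|f x| <= g x) ->
  itg g -> itg f.
Proof.
move=> mf fg; apply: le_integrable => //; first exact/measurable_EFinP.
move=> x _ /=; rewrite lee_fin; apply: le_trans (fg x) _; exact: ler_norm.
Qed.

Lemma itg_norm f : itg f -> itg (fun x => `|f x|).
Proof. by move=> hf; exact: integrable_norm. Qed.

Lemma I_dom f g : itg f -> itg g -> (forall x, `|f x| <= g x) -> `|I f| <= I g.
Proof.
move=> hf hg fg; rewrite I.unlock; apply: le_trans (le_normr_Rintegral measurableT hf) _.
by apply: le_Rintegral => //; exact: itg_norm.
Qed.

Section affine.
Let T := measurableTypeR R.
Variables (phi : T -> T) (mphi : measurable_fun setT phi).
Hypothesis phi_itv : forall a b : R, a < b -> mu (phi @^-1` `]a, b]) = (b - a)%:E.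

Let phi_mixin := isMeasurableFun.Build _ _ _ _ _ mphi.
HB.instance Definition _ := phi_mixin.

(** Lebesgue measure is determined by its values on half-open intervals; translation and reflection
    are both treated through this. *)
Let mu_phiE A : measurable A -> mu A = pushforward mu phi A.
Proof.
apply: (@lebesgue_measure_unique R (pushforward mu phi)) => X.
move=> /ocitvP[->|[[a b]/= ab ->]]; first by rewrite !measure0.
by rewrite /pushforward phi_itv// lebesgue_measure_itv/= lte_fin ab EFinB.
Qed.

Lemma itg_affine f : itg f -> itg (f \o phi).
Proof.
move=> hf; have mf := itg_measurable hf.
apply/integrableP; split.
  by apply/measurable_EFinP; exact: measurableT_comp.
have /integrableP[_] := hf.
rewrite (@eq_measure_integral _ _ _ setT (pushforward mu phi)); last first.
  by move=> A mA _; exact: mu_phiE.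
rewrite ge0_integral_pushforward//.
by apply: measurableT_comp => //; exact/measurable_EFinP.
Qed.

Lemma I_affine f : itg f -> I (f \o phi) = I f.
Proof.
move=> hf; have mf := itg_measurable hf.
rewrite I.unlock /Rintegral; congr fine.
rewrite [RHS](@eq_measure_integral _ _ _ setT (pushforward mu phi)); last first.
  by move=> A mA _; exact: mu_phiE.
rewrite integral_pushforward//; first exact/measurable_EFinP.
by rewrite preimage_setT; exact: (itg_affine hf).
Qed.
End affine.

Lemma measurable_shift c : measurable_fun setT (fun x : R => x + c).
Proof. exact: measurable_funD. Qed.

Let shift_itv c (a b : R) : a < b -> mu ((fun x => x + c) @^-1` `]a, b]) = (b - a)%:E.
Proof.
move=> ab; have -> : (fun x => x + c) @^-1` `]a, b] = `]a - c, b - c]%classic.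
  by apply/seteqP; split => x /=; rewrite !in_itv/= ltrBlDr lerBrDr.
by rewrite lebesgue_measure_itv/= lte_fin ltrD2r ab -EFinB; congr EFin; ring.
Qed.

Lemma itg_shift c f : itg f -> itg (fun x => f (x + c)).
Proof. exact: itg_affine (@measurable_shift c) (@shift_itv c) _. Qed.

Lemma I_shift c f : itg f -> I (fun x => f (x + c)) = I f.
Proof. exact: I_affine (@measurable_shift c) (@shift_itv c) _. Qed.

Let opp_itv (a b : R) : a < b -> mu (-%R @^-1` `]a, b]) = (b - a)%:E.
Proof.
move=> ab; have -> : -%R @^-1` `]a, b] = `[- b, - a[%classic.
  by apply/seteqP; split => x /=; rewrite !in_itv/= lerNl ltrNr andbC.
by rewrite lebesgue_measure_itv/= lte_fin ltrN2 ab -EFinB; congr EFin; ring.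
Qed.

Lemma measurable_opp : measurable_fun setT (-%R : R -> R).
Proof. exact: measurable_funN. Qed.

Lemma itg_opp f : itg f -> itg (fun x => f (- x)).
Proof. exact: itg_affine measurable_opp opp_itv _. Qed.

Lemma I_opp f : itg f -> I (fun x => f (- x)) = I f.
Proof. exact: I_affine measurable_opp opp_itv _. Qed.

Lemma continuous_expZ c : continuous (fun x : R => expR (c * x)).
Proof.
move=> x; apply: continuous_comp; last exact: continuous_expR.
by apply: continuousM; [exact: cst_continuous|].
Qed.

Lemma cont_cst c : continuous (fun _ : R => c).
Proof. by move=> x; exact: cst_continuous. Qed.

Lemma cont_mul f g : continuous f -> continuous g -> continuous (fun x => f x * g x).
Proof. by move=> cf cg x; apply: cvgM; [exact: cf|exact: cg]. Qed.

Lemma cont_add f g : continuous f -> continuous g -> continuous (fun x => f x + g x).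
Proof. by move=> cf cg x; apply: cvgD; [exact: cf|exact: cg]. Qed.

Lemma cont_sub f g : continuous f -> continuous g -> continuous (fun x => f x - g x).
Proof. by move=> cf cg x; apply: cvgB; [exact: cf|exact: cg]. Qed.

Lemma measurable_expZ c : measurable_fun setT (fun x : R => expR (c * x)).
Proof. by apply: continuous_measurable_fun; exact: continuous_expZ. Qed.

Lemma itg_exp_abs e : 0 < e -> itg (fun x => expR (- (e * `|x|))).
Proof.
move=> e0; have hp := integrable_exponential_pdf e0.
pose g x := e^-1 * (exponential_pdf e x + exponential_pdf e (- x)).
have hg : itg g.
  apply: itgZ; apply: itgD => //; exact: (itg_opp hp).
apply: itg_dom hg.
  apply: continuous_measurable_fun => x; apply: continuous_comp; last exact: continuous_expR.
  apply: continuousN; apply: continuousM; first exact: cst_continuous.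
  exact: norm_continuous.
have e00 : 0 <= e by exact: ltW.
move=> x; rewrite ger0_norm ?expR_ge0// /g ler_pdivlMl//.
have [x0|x0] := leP 0 x.
  rewrite exponential_pdfE// ger0_norm// mulNr lerDl.
  exact: exponential_pdf_ge0.
rewrite addrC exponential_pdfE; last by lra.
by rewrite ltr0_norm// mulNr lerDl; exact: exponential_pdf_ge0.
Qed.

(** Plays the part of integration by parts: the fundamental theorem on [-n, n], then dominated
    convergence. [Gam_step] applies it to the real and imaginary parts of a product. *)
Lemma I_derive0 (F f : R -> R) : (forall x : R, is_derive x (1 : R) F (f x)) ->
  continuous f -> itg f ->
  (fun n : nat => F n%:R) @ \oo --> (0 : R) ->
  (fun n : nat => F (- n%:R)) @ \oo --> (0 : R) -> I f = 0.
Proof.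
move=> dF cf hf F1 F2.
pose f_ n := EFin \o (f \_ `[(- n%:R), n%:R]).
have [|||||_ _] := @dominated_convergence _ _ _ mu setT measurableT f_ (EFin \o f)
   (EFin \o (fun x => `|f x|)).
- move=> n; apply/measurable_EFinP.
  apply/measurable_restrict => //.
  by apply: measurable_funTS; exact: itg_measurable.
- by apply/measurable_EFinP; exact: itg_measurable.
- apply: aeW => x _; apply: cvg_near_cst.
  exists (Num.truncn `|x|).+1 => // n /= xn; rewrite /f_ /= patchE mem_set//=.
  have : `|x| <= n%:R by rewrite (le_trans (ltW (truncnS_gt _)))// ler_nat.
  by rewrite in_itv/= ler_norml.
- exact: itg_norm.
- apply: aeW => x n _; rewrite /f_ /= lee_fin patchE.
  by case: ifP => //; rewrite normr0.
have E n : (0 < n)%N -> (\int[mu]_(x in setT) f_ n x = (F n%:R - F (- n%:R))%:E)%E.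
  move=> n0; rewrite /f_ -restrict_EFin -integral_mkcond.
  have cF x : {for x, continuous F}.
    by apply/differentiable_continuous/derivable1_diffP; have [] := dF x.
  have n0R : 0 < n%:R :> R by rewrite ltr0n.
  rewrite (@continuous_FTC2 _ f F) ?EFinB//.
  - by rewrite gtrN.
  - exact: continuous_subspaceT.
  - split; first by move=> x _; have [] := dF x.
    + by apply/cvg_at_right_filter; exact: cF.
    + by apply/cvg_at_left_filter; exact: cF.
  - by move=> x _; rewrite derive1E; have [_ ->] := dF x.
move=> h.
have h2 : (fun n : nat => (F n%:R - F (- n%:R))%:E) @ \oo --> (0%R)%:E.
  apply: cvg_EFin; first exact: nearW.
  by rewrite -[X in _ --> X](subr0 0) ; exact: (cvgB F1 F2).
have h3 : (fun n => \int[mu]_(x in setT) f_ n x)%E @ \oo --> (0%R)%:E.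
  apply: cvg_trans h2; apply: near_eq_cvg; exists 1%N => // n /= n0.
  by rewrite E.
rewrite I.unlock /Rintegral.
have -> : (\int[mu]_x (f x)%:E = 0)%E by apply: (cvg_unique _ h h3).
by [].
Qed.

End RealIntegral.

(** * Modulus and exponential in real coordinates *)

Section Complex.
Context {R : realType}.
Local Notation C := (R[i]).
Local Notation normc := (@Normc.normc R).
Implicit Types (z w : C) (x y c : R).

Lemma cexpD z w : cexp (z + w) = cexp z * cexp w :> C.
Proof.
case: z w => [a b] [a' b']; rewrite /cexp /= expRD cosD sinD; simpc.
by congr (_ +i* _); ring.
Qed.

Lemma cexp0 : cexp 0 = 1 :> C.
Proof. by rewrite /cexp /= expR0 cos0 sin0 mulr1 mulr0. Qed.

Lemma normc_ge0 z : 0 <= normc z.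
Proof. by case: z => a b; rewrite /normc/= sqrtr_ge0. Qed.

Lemma normc_sqr z : normc z ^+ 2 = complex.Re z ^+ 2 + complex.Im z ^+ 2.
Proof. by case: z => a b; rewrite /normc/= sqr_sqrtr// addr_ge0// sqr_ge0. Qed.

Lemma normc_cexp z : normc (cexp z) = expR (complex.Re z).
Proof.
apply: (@pexpIrn _ 2) => //; rewrite ?nnegrE ?normc_ge0 ?expR_ge0//.
rewrite normc_sqr /= !exprMn -mulrDr cos2Dsin2 mulr1//.
Qed.

Lemma Re_le_normc z : `|complex.Re z| <= normc z.
Proof.
rewrite -(@ler_pXn2r _ 2)// ?nnegrE ?normc_ge0// normc_sqr real_normK ?num_real//.
by rewrite lerDl sqr_ge0.
Qed.

Lemma Im_le_normc z : `|complex.Im z| <= normc z.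
Proof.
rewrite -(@ler_pXn2r _ 2)// ?nnegrE ?normc_ge0// normc_sqr real_normK ?num_real//.
by rewrite lerDr sqr_ge0.
Qed.

Lemma normc_le_sum z : normc z <= `|complex.Re z| + `|complex.Im z|.
Proof.
rewrite -(@ler_pXn2r _ 2)// ?nnegrE ?normc_ge0 ?addr_ge0// normc_sqr.
rewrite sqrrD !real_normK ?num_real// addrAC lerDl.
by rewrite mulrn_wge0// mulr_ge0.
Qed.

Lemma normc_real x : normc x%:C = `|x|.
Proof. by rewrite /normc/= expr0n addr0 sqrtr_sqr. Qed.

Lemma le_normc_sub z w : normc (z + w) <= normc z + normc w.
Proof. exact: le_normcD. Qed.

Lemma normcX z n : normc (z ^+ n) = normc z ^+ n.
Proof.
elim: n => [|n IH]; first by rewrite !expr0 Normc.normc1.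
by rewrite !exprS Normc.normcM IH.
Qed.

Lemma normc_sum (F : nat -> C) (a b : nat) :
  normc (\sum_(a <= i < b) F i) <= \sum_(a <= i < b) normc (F i).
Proof.
elim/big_ind2: _ => //; first by rewrite Normc.normc0.
by move=> x1 x2 y1 y2 h1 h2; apply: le_trans (le_normcD _ _) _; rewrite lerD.
Qed.

End Complex.

(** * The two-sided Laplace transform *)

Section Laplace.
Context {R : realType}.
Local Notation C := (R[i]).
Local Notation normc := (@Normc.normc R).
Implicit Types (g : R -> R) (rho y c : R).

(* Lap g rho y = \int g(v) e^{(rho + i y) v} dv *)
Definition Lap g rho y : C :=
  (I (fun v => g v * (expR (rho * v) * cos (y * v)))) +i*
  (I (fun v => g v * (expR (rho * v) * sin (y * v)))).

(** Absolute convergence of the transform on the whole vertical line of abscissa [rho]. *)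
Definition adm g rho :=
  measurable_fun setT g /\ itg (fun v => `|g v| * expR (rho * v)).

Lemma measurable_cosZ y : measurable_fun setT (fun v : R => cos (y * v)).
Proof.
apply: continuous_measurable_fun => x; apply: continuous_comp; last exact: continuous_cos.
by apply: continuousM; [exact: cst_continuous|].
Qed.

Lemma measurable_sinZ y : measurable_fun setT (fun v : R => sin (y * v)).
Proof.
apply: continuous_measurable_fun => x; apply: continuous_comp; last exact: continuous_sin.
by apply: continuousM; [exact: cst_continuous|].
Qed.

Lemma adm_cos g rho y : adm g rho ->
  itg (fun v => g v * (expR (rho * v) * cos (y * v))).
Proof.
move=> [mg ig]; apply: itg_dom ig.
  apply: measurable_funM => //; apply: measurable_funM.
    exact: measurable_expZ.
  exact: measurable_cosZ.
move=> v; rewrite !normrM ler_wpM2l// (ger0_norm (expR_ge0 _)).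
by rewrite ler_piMr ?expR_ge0// cos_max.
Qed.

Lemma adm_sin g rho y : adm g rho ->
  itg (fun v => g v * (expR (rho * v) * sin (y * v))).
Proof.
move=> [mg ig]; apply: itg_dom ig.
  apply: measurable_funM => //; apply: measurable_funM.
    exact: measurable_expZ.
  exact: measurable_sinZ.
move=> v; rewrite !normrM ler_wpM2l// (ger0_norm (expR_ge0 _)).
by rewrite ler_piMr ?expR_ge0// sin_max.
Qed.

Lemma admD g1 g2 rho : adm g1 rho -> adm g2 rho -> adm (fun v => g1 v + g2 v) rho.
Proof.
move=> [m1 i1] [m2 i2]; split; first exact: measurable_funD.
apply: itg_dom (itgD i1 i2).
  apply: measurable_funM; last exact: measurable_expZ.
  by apply: measurableT_comp => //; exact: measurable_funD.
move=> v; rewrite normrM normr_id (ger0_norm (expR_ge0 _)) -mulrDl.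
by rewrite ler_wpM2r ?expR_ge0// ler_normD.
Qed.

Lemma admZ c g rho : adm g rho -> adm (fun v => c * g v) rho.
Proof.
move=> [m1 i1]; split; first exact: measurable_funM.
apply: eq_integrable (itgZ `|c| i1) => // v _ /=.
by rewrite normrM mulrA.
Qed.

Lemma adm_dom g h rho : measurable_fun setT g -> (forall v, `|g v| <= h v) ->
  adm h rho -> adm g rho.
Proof.
move=> mg gh [mh ih]; split => //; apply: itg_dom ih.
  apply: measurable_funM; last exact: measurable_expZ.
  exact: measurableT_comp.
move=> v; rewrite normrM normr_id (ger0_norm (expR_ge0 _)).
by rewrite ler_wpM2r ?expR_ge0// (le_trans (gh v))// ler_norm.
Qed.

Lemma Lap_D g1 g2 rho y : adm g1 rho -> adm g2 rho ->
  Lap (fun v => g1 v + g2 v) rho y = Lap g1 rho y + Lap g2 rho y.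
Proof.
move=> a1 a2; rewrite /Lap; simpc; congr (_ +i* _).
  rewrite -I_D; [|exact: adm_cos|exact: adm_cos].
  by congr I; apply/funext => v; rewrite mulrDl.
rewrite -I_D; [|exact: adm_sin|exact: adm_sin].
by congr I; apply/funext => v; rewrite mulrDl.
Qed.

Lemma Lap_Z c g rho y : adm g rho ->
  Lap (fun v => c * g v) rho y = c%:C * Lap g rho y.
Proof.
move=> a1; rewrite /Lap; simpc; congr (_ +i* _).
  rewrite -I_Z; last exact: adm_cos.
  by congr I; apply/funext => v; ring.
rewrite -I_Z; last exact: adm_sin.
by congr I; apply/funext => v; ring.
Qed.

Lemma adm_shift c g rho : adm g rho -> adm (fun v => g (v + c)) rho.
Proof.
move=> [m1 i1]; split; first by apply: measurableT_comp => //; exact: measurable_shift.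
have := itgZ (expR (- (rho * c))) (itg_shift c i1).
apply: eq_integrable => // v _ /=.
by rewrite mulrCA -expRD; congr (_ * expR _)%:E; ring.
Qed.

Lemma Lap_shift c g rho y : adm g rho ->
  Lap (fun v => g (v + c)) rho y = cexp ((- (c * rho)) +i* (- (c * y))) * Lap g rho y.
Proof.
move=> a1; have hc := adm_cos y a1; have hs := adm_sin y a1.
have hc' := itg_shift c hc; have hs' := itg_shift c hs.
rewrite /Lap -(I_shift c hc) -(I_shift c hs) /cexp /=; simpc.
have E v : expR (rho * v) = expR (- (c * rho)) * expR (rho * (v + c)).
  by rewrite -expRD; congr expR; ring.
have Ec v : cos (y * v) = cos (y * (v + c)) * cos (- (c * y)) - sin (y * (v + c)) * sin (- (c * y)).
  by rewrite -cosD; congr cos; ring.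
have Es v : sin (y * v) = sin (y * (v + c)) * cos (- (c * y)) + cos (y * (v + c)) * sin (- (c * y)).
  by rewrite -sinD; congr sin; ring.
congr (_ +i* _); rewrite -!I_Z//.
  rewrite -I_B; [|exact: itgZ|exact: itgZ].
  by congr I; apply/funext => v; rewrite E Ec; ring.
rewrite -I_D; [|exact: itgZ|exact: itgZ].
by congr I; apply/funext => v; rewrite E Es; ring.
Qed.

Lemma adm_exp c g rho : adm g (rho + c) -> adm (fun v => expR (c * v) * g v) rho.
Proof.
move=> [m1 i1]; split.
  by apply: measurable_funM => //; exact: measurable_expZ.
apply: eq_integrable i1 => // v _ /=.
by rewrite normrM (ger0_norm (expR_ge0 _)) mulrDl expRD; congr _%:E; ring.
Qed.

Lemma Lap_exp c g rho y :
  Lap (fun v => expR (c * v) * g v) rho y = Lap g (rho + c) y.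
Proof.
rewrite /Lap; congr (_ +i* _); congr (I _); apply/funext => v.
  by rewrite mulrDl expRD; ring.
by rewrite mulrDl expRD; ring.
Qed.

Lemma Lap_bound g rho y : adm g rho ->
  normc (Lap g rho y) <= 2 * I (fun v => `|g v| * expR (rho * v)).
Proof.
move=> a1; have hc := adm_cos y a1; have hs := adm_sin y a1.
apply: le_trans (normc_le_sum _) _; rewrite mulr_natl mulr2n /=; apply: lerD.
- apply: I_dom => //; first by case: a1.
  move=> v; rewrite !normrM ler_wpM2l// (ger0_norm (expR_ge0 _)).
  by rewrite ler_piMr ?expR_ge0// cos_max.
- apply: I_dom => //; first by case: a1.
  move=> v; rewrite !normrM ler_wpM2l// (ger0_norm (expR_ge0 _)).
  by rewrite ler_piMr ?expR_ge0// sin_max.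
Qed.

(** The weighted function is even, so its product with the sine is odd. *)
Lemma Lap_even_real g rho y : adm g rho ->
  (forall v, g (- v) * expR (rho * - v) = g v * expR (rho * v)) ->
  complex.Im (Lap g rho y) = 0.
Proof.
move=> a1 ev; have hs := adm_sin y a1; rewrite /=.
have := I_opp hs.
have -> : (fun x => g (- x) * (expR (rho * - x) * sin (y * - x))) =
          (fun x => -1 * (g x * (expR (rho * x) * sin (y * x)))).
  by apply/funext => v; rewrite mulrA ev mulrN sinN; ring.
by rewrite I_Z// => h; lra.
Qed.

End Laplace.

(** * The Gamma function as a Laplace transform *)

Section Gamma.
Context {R : realType}.
Local Notation C := (R[i]).
Local Notation normc := (@Normc.normc R).
Implicit Types (v rho y c : R) (g : R -> R).

(* Gamma kernel: Lap ker rho y = pi ^ (- w) * Gamma w with w = rho + i y *)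
Definition ker v : R := expR (- (pi * expR v)).

Lemma ker_gt0 v : 0 < ker v. Proof. exact: expR_gt0. Qed.

Lemma continuous_ker : continuous ker.
Proof.
move=> x; apply: continuous_comp; last exact: continuous_expR.
apply: continuousN; apply: continuousM; first exact: cst_continuous.
exact: continuous_expR.
Qed.

Lemma measurable_ker : measurable_fun setT ker.
Proof. exact: continuous_measurable_fun continuous_ker. Qed.

Lemma ker_le1 v : ker v <= 1.
Proof. by rewrite /ker expR_le1 oppr_le0 mulr_ge0 ?pi_ge0 ?expR_ge0. Qed.

Lemma expN_le (x : R) n : 0 < x -> expR (- x) <= n`!%:R / x ^+ n.
Proof.
move=> x0; rewrite expRN -invf_div lef_pV2 ?posrE ?expR_gt0//; last first.
  by rewrite divr_gt0 ?exprn_gt0 ?ltr0n ?fact_gt0.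
case: n => [|n]; first by rewrite expr0 divr1 -expR0 ler_expR ltW.
by apply: le_trans (expR_ge1Dxn n (ltW x0)); rewrite lerDr.
Qed.

Lemma ker_le n v : ker v <= n`!%:R * expR (- (n%:R * v)).
Proof.
have pe : 0 < pi * expR v by rewrite mulr_gt0 ?pi_gt0 ?expR_gt0.
apply: le_trans (expN_le n pe) _; rewrite ler_wpM2l// exprMn invfM.
rewrite -expRM_natl -expRN ler_piMl ?expR_ge0// invf_le1 ?exprn_gt0 ?pi_gt0//.
by rewrite exprn_ege1// (le_trans _ (@pi_ge2 R))// ler1n.
Qed.

(** Decay at each end of the line is faster than e^(-rho v) by a margin; the smaller margin [e]
    gives the integrable majorant e^(-e |v|). *)
Lemma adm_two_sided g rho (A a b : R) : measurable_fun setT g ->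
  a < rho < b ->
  (forall v, `|g v| <= A * expR (- (a * v))) ->
  (forall v, `|g v| <= A * expR (- (b * v))) -> adm g rho.
Proof.
move=> mg /andP[ar rb] h1 h2; split => //.
pose e := Num.min (rho - a) (b - rho).
have e0 : 0 < e by rewrite lt_min !subr_gt0 ar rb.
have A0 : 0 <= A.
  have := le_trans (normr_ge0 _) (h1 0).
  by rewrite mulr0 oppr0 expR0 mulr1.
apply: itg_dom (itgZ A (itg_exp_abs e0)).
  apply: measurable_funM; last exact: measurable_expZ.
  exact: measurableT_comp.
move=> v; rewrite normrM normr_id (ger0_norm (expR_ge0 _)).
have [v0|v0] := leP 0 v.
  apply: (@le_trans _ _ (A * expR (- (b * v)) * expR (rho * v))).
    by rewrite ler_wpM2r ?expR_ge0.
  rewrite -mulrA -expRD ler_wpM2l// ler_expR ger0_norm//.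
  have : e <= b - rho by rewrite ge_min lexx orbT.
  by move=> he; have := ler_wpM2r v0 he; lra.
apply: (@le_trans _ _ (A * expR (- (a * v)) * expR (rho * v))).
  by rewrite ler_wpM2r ?expR_ge0.
rewrite -mulrA -expRD ler_wpM2l// ler_expR ltr0_norm//.
have he : e <= rho - a by rewrite ge_min lexx.
have nv : 0 <= - v by lra.
by have := ler_wpM2r nv he; lra.
Qed.

Lemma adm_ker rho : 0 < rho -> adm ker rho.
Proof.
move=> r0; pose n := (Num.truncn rho).+1.
have f1 : 1 <= n`!%:R :> R by rewrite ler1n fact_gt0.
apply: (@adm_two_sided _ _ n`!%:R 0 n%:R).
- exact: measurable_ker.
- by rewrite r0 truncnS_gt.
- move=> v; rewrite mul0r oppr0 expR0 mulr1 ger0_norm ?expR_ge0//.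
  exact: le_trans (ker_le1 _) f1.
- by move=> v; rewrite ger0_norm ?expR_ge0// ker_le.
Qed.

Definition Gam rho y : C := Lap ker rho y.

(** This is Gamma (w + 1) = w Gamma (w). Since ker' = - pi e^v ker, the derivative of ker v e^(w v)
    is the difference of the two integrands, and it integrates to 0; real and imaginary parts are
    treated separately. *)
Lemma Gam_step rho y : 0 < rho ->
  pi%:C * Gam (rho + 1) y = (rho +i* y) * Gam rho y.
Proof.
move=> r0; have r1 : 0 < rho + 1 by lra.
have a0 := adm_ker r0; have a1 := adm_ker r1.
have hc0 := adm_cos y a0; have hs0 := adm_sin y a0.
have hc1 := adm_cos y a1; have hs1 := adm_sin y a1.
have dk v : is_derive v (1 : R) ker (- (pi * expR v) * ker v).
  rewrite /ker; apply: is_derive_eq.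
  by rewrite /GRing.scale/=; ring.
have de v : is_derive v (1:R) (fun v => expR (rho * v)) (rho * expR (rho * v)).
  by apply: is_derive_eq; rewrite /GRing.scale/=; ring.
have dcs v : is_derive v (1:R) (fun v => cos (y * v)) (- (y * sin (y * v))).
  by apply: is_derive_eq; rewrite /GRing.scale/=; ring.
have dsn v : is_derive v (1:R) (fun v => sin (y * v)) (y * cos (y * v)).
  by apply: is_derive_eq; rewrite /GRing.scale/=; ring.
have DE (v : R) (f : R -> R) (a b : R) : is_derive v (1:R) f a -> a = b ->
    is_derive v (1:R) f b by move=> ? <-.
have ce c : continuous (fun v : R => expR (c * v)) := @continuous_expZ R c.
have cc : continuous (fun v : R => cos (y * v)).
  move=> x; apply: continuous_comp; last exact: continuous_cos.
  by apply: continuousM; [exact: cst_continuous|].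
have cs : continuous (fun v : R => sin (y * v)).
  move=> x; apply: continuous_comp; last exact: continuous_sin.
  by apply: continuousM; [exact: cst_continuous|].
(* Boundary terms: at +oo [ker_le] with an integer exponent [N] above rho wins, at -oo the factor
   e^(rho v) does. *)
have bd (h : R -> R) : (forall v, `|h v| <= 1) ->
    (fun n : nat => ker n%:R * (expR (rho * n%:R) * h n%:R)) @ \oo --> (0 : R) /\
    (fun n : nat => ker (- n%:R) * (expR (rho * - n%:R) * h (- n%:R))) @ \oo --> (0 : R).
  move=> h1.
  pose N := (Num.truncn rho).+1.
  have rN : rho < N%:R by exact: truncnS_gt.
  have expc (c : R) : 0 < c -> (fun n : nat => expR (- (c * n%:R))) @ \oo --> (0 : R).
    move=> c0; have -> : (fun n : nat => expR (- (c * n%:R))) = geometric 1 (expR (- c)).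
      by apply/funext => n; rewrite /geometric/= mul1r -expRM_natr mulNr.
    by apply: cvg_geometric; rewrite ger0_norm ?expR_ge0// expR_lt1; lra.
  split; apply/norm_cvg0P.
  - have l2 : (fun n : nat => N`!%:R * expR (- ((N%:R - rho) * n%:R))) @ \oo --> (0 : R).
      rewrite -(mulr0 N`!%:R); apply: cvgM; first exact: cvg_cst.
      by apply: expc; lra.
    apply: (squeeze_cvgr _ (cvg_cst 0) l2); near=> n.
    rewrite normr_ge0/= !normrM (ger0_norm (ltW (ker_gt0 _))) (ger0_norm (expR_ge0 _)).
    apply: (@le_trans _ _ (N`!%:R * expR (- (N%:R * n%:R)) * (expR (rho * n%:R) * 1))).
      apply: ler_pM; rewrite ?(ltW (ker_gt0 _)) ?mulr_ge0 ?expR_ge0 ?ker_le//.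
      by rewrite ler_wpM2l ?expR_ge0.
    by rewrite mulr1 -mulrA -expRD ler_wpM2l// ler_expR; lra.
  - apply: (squeeze_cvgr _ (cvg_cst 0) (expc _ r0)); near=> n.
    rewrite normr_ge0/= !normrM (ger0_norm (ltW (ker_gt0 _))) (ger0_norm (expR_ge0 _)).
    rewrite mulrN -[leRHS]mul1r; apply: ler_pM; rewrite ?(ltW (ker_gt0 _)) ?mulr_ge0 ?expR_ge0 ?ker_le1//.
    by rewrite -[leRHS]mulr1 ler_wpM2l ?expR_ge0.
have EcR : I (fun v => rho * (ker v * (expR (rho * v) * cos (y * v)))
    - y * (ker v * (expR (rho * v) * sin (y * v)))
    - pi * (ker v * (expR ((rho + 1) * v) * cos (y * v)))) = 0.
  have [b1 b2] := bd (fun v => cos (y * v)) (fun v => cos_max _).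
  have dF v : is_derive v (1:R) (fun v => ker v * (expR (rho * v) * cos (y * v)))
     (rho * (ker v * (expR (rho * v) * cos (y * v)))
    - y * (ker v * (expR (rho * v) * sin (y * v)))
    - pi * (ker v * (expR ((rho + 1) * v) * cos (y * v)))).
    apply: (DE _ _ _ _ (is_deriveM (dk v) (is_deriveM (de v) (dcs v)))).
    rewrite !fctE /GRing.scale/= (_ : (rho + 1) * v = rho * v + v); last by ring.
    by rewrite expRD; ring.
  apply: (I_derive0 dF _ _ b1 b2); last first.
    by apply: itgB; [apply: itgB|]; exact: itgZ.
  have cK (h : R -> R) c r : continuous h -> continuous (fun v => c * (ker v * (expR (r * v) * h v))).
    move=> ch.
    apply: cont_mul; first exact: cont_cst.
    by apply: cont_mul; [exact: continuous_ker|apply: cont_mul].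
  by apply: cont_sub; [apply: cont_sub|]; exact: cK.
have EsR : I (fun v => rho * (ker v * (expR (rho * v) * sin (y * v)))
    + y * (ker v * (expR (rho * v) * cos (y * v)))
    - pi * (ker v * (expR ((rho + 1) * v) * sin (y * v)))) = 0.
  have [b1 b2] := bd (fun v => sin (y * v)) (fun v => sin_max _).
  have dF v : is_derive v (1:R) (fun v => ker v * (expR (rho * v) * sin (y * v)))
     (rho * (ker v * (expR (rho * v) * sin (y * v)))
    + y * (ker v * (expR (rho * v) * cos (y * v)))
    - pi * (ker v * (expR ((rho + 1) * v) * sin (y * v)))).
    apply: (DE _ _ _ _ (is_deriveM (dk v) (is_deriveM (de v) (dsn v)))).
    rewrite !fctE /GRing.scale/= (_ : (rho + 1) * v = rho * v + v); last by ring.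
    by rewrite expRD; ring.
  apply: (I_derive0 dF _ _ b1 b2); last first.
    by apply: itgB; [apply: itgD|]; exact: itgZ.
  have cK (h : R -> R) c r : continuous h -> continuous (fun v => c * (ker v * (expR (r * v) * h v))).
    move=> ch.
    apply: cont_mul; first exact: cont_cst.
    by apply: cont_mul; [exact: continuous_ker|apply: cont_mul].
  by apply: cont_sub; [apply: cont_add|]; exact: cK.
move: EcR; rewrite I_B; [|by apply: itgB; exact: itgZ|exact: itgZ].
rewrite I_B; [|exact: itgZ|exact: itgZ]; rewrite !I_Z// => EcR.
move: EsR; rewrite I_B; [|by apply: itgD; exact: itgZ|exact: itgZ].
rewrite I_D; [|exact: itgZ|exact: itgZ]; rewrite !I_Z// => EsR.
by rewrite /Gam /Lap; simpc; congr (_ +i* _); lra.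
Unshelve. all: by end_near. Qed.

End Gamma.

(** * Analytic identity along a horizontal line *)

Section Analytic.
Context {R : realType}.
Local Notation C := (R[i]).
Local Notation normc := (@Normc.normc R).
Implicit Types (F : R -> C) (a h : R).

Lemma ler_geo (A1 A K1 K x : R) n : 0 <= A1 -> A1 <= A -> 0 <= K1 -> K1 <= K -> 0 <= x ->
  A1 * (K1 * x) ^+ n <= A * (K * x) ^+ n.
Proof.
move=> A10 A1A K10 K1K x0.
have K1x : 0 <= K1 * x by rewrite mulr_ge0.
have KK : K1 * x <= K * x by rewrite ler_wpM2r.
have Kx : 0 <= K * x by apply: le_trans KK.
by apply: ler_pM => //; [rewrite exprn_ge0|apply: lerXn2r].
Qed.

Definition tpoly (c : nat -> C) n h : C := \sum_(0 <= k < n) c k * h%:C ^+ k.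

(* Real-analyticity of F at a, phrased as geometric control of all Taylor remainders. *)
Definition ana F a := exists (c : nat -> C) (A K d : R),
  [/\ 0 < A, 0 < K, 0 < d, K * d <= 1 & forall n h, `|h| < d ->
    normc (F (a + h) - tpoly c n h) <= A * (K * `|h|) ^+ n].

Lemma anaI F a (c : nat -> C) (A K d : R) : 0 <= A -> 0 < K -> 0 < d ->
  (forall n h, `|h| < d ->
    normc (F (a + h) - tpoly c n h) <= A * (K * `|h|) ^+ n) -> ana F a.
Proof.
move=> A0 K0 d0 H; exists c, (A + 1), K, (Num.min d K^-1); split => //; first lra.
- by rewrite lt_min d0 invr_gt0.
- by rewrite -ler_pdivlMl// mulr1 ge_min lexx orbT.
- move=> n h; rewrite lt_min => /andP[hd _]; apply: le_trans (H n h hd) _.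
  by rewrite ler_wpM2r ?exprn_ge0 ?mulr_ge0 ?(ltW K0)//; lra.
Qed.

(** The constants may be enlarged at will, at the price of a smaller radius; two functions can thus
    share the same [A] and [K]. *)
Lemma anaE F a : ana F a -> forall A0 K0 : R, exists (c : nat -> C) (A K d : R),
  [/\ A0 <= A /\ 0 < A, K0 <= K /\ 0 < K, 0 < d, K * d <= 1 & forall n h, `|h| < d ->
    normc (F (a + h) - tpoly c n h) <= A * (K * `|h|) ^+ n].
Proof.
move=> [c [A [K [d [A0 K0 d0 Kd H]]]]] A1 K1.
pose K' := Num.max K K1; have KK' : K <= K' by rewrite le_max lexx.
have K'0 : 0 < K' by apply: lt_le_trans KK'.
exists c, (Num.max A A1), K', (Num.min d K'^-1); split => //.
- by rewrite le_max lexx orbT lt_max A0.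
- by rewrite /K' le_max lexx orbT.
- by rewrite lt_min d0 invr_gt0.
- by rewrite -ler_pdivlMl// mulr1 ge_min lexx orbT.
- move=> n h; rewrite lt_min => /andP[hd _]; apply: le_trans (H n h hd) _.
  by apply: ler_geo => //; rewrite ?le_max ?lexx// ltW.
Qed.

Lemma tpolyS c n h : tpoly c n.+1 h = tpoly c n h + c n * h%:C ^+ n.
Proof. by rewrite /tpoly big_nat_recr. Qed.

Lemma tpoly0 c h : tpoly c 0 h = 0. Proof. by rewrite /tpoly big_nil. Qed.

Lemma normc_B (z w : C) : normc (z - w) <= normc z + normc w.
Proof. by apply: le_trans (le_normcD _ _) _; rewrite normcN. Qed.

(** Cauchy estimates: c k h^k is the difference of two consecutive Taylor remainders, taken at h = d
    / 2, where K h <= 1 makes the later bound the smaller. *)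
Lemma ana_coef F a (c : nat -> C) (A K d : R) : 0 < A -> 0 < K -> 0 < d -> K * d <= 1 ->
  (forall n h, `|h| < d -> normc (F (a + h) - tpoly c n h) <= A * (K * `|h|) ^+ n) ->
  forall k, normc (c k) <= 2 * A * K ^+ k.
Proof.
move=> A0 K0 d0 Kd H k; pose h := d / 2.
have h0 : 0 < h by rewrite divr_gt0.
have hd : `|h| < d by rewrite gtr0_norm// /h; lra.
have h1 := H k h hd; have h2 := H k.+1 h hd.
have E : c k * h%:C ^+ k = (F (a + h) - tpoly c k h) - (F (a + h) - tpoly c k.+1 h).
  by rewrite tpolyS; ring.
have : normc (c k * h%:C ^+ k) <= 2 * A * (K * h) ^+ k.
  rewrite E; apply: le_trans (normc_B _ _) _.
  apply: le_trans (lerD h1 h2) _; rewrite (gtr0_norm h0).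
  have Kh1 : K * h <= 1 by rewrite /h; nra.
  have : (K * h) ^+ k.+1 <= (K * h) ^+ k.
    by rewrite exprS ler_piMl// exprn_ge0// mulr_ge0// ltW.
  by move=> e; have := ler_wpM2l (ltW A0) e; lra.
rewrite Normc.normcM normcX normc_real (gtr0_norm h0) [(K * h) ^+ k]exprMn mulrA.
by rewrite ler_pM2r ?exprn_gt0.
Qed.

Lemma tpoly_mul (c1 c2 : nat -> C) n h :
  tpoly (fun k => \sum_(0 <= i < k.+1) c1 i * c2 (k - i)%N) n h =
  \sum_(0 <= i < n) c1 i * h%:C ^+ i * tpoly c2 (n - i) h.
Proof.
elim: n => [|n IH]; first by rewrite tpoly0 big_nil.
have t1 : tpoly c2 1 h = c2 0%N by rewrite /tpoly big_nat1 expr0 mulr1.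
rewrite tpolyS IH [in RHS]big_nat_recr//= subSnn t1.
have -> : \sum_(0 <= i < n) c1 i * h%:C ^+ i * tpoly c2 (n.+1 - i) h =
   \sum_(0 <= i < n) c1 i * h%:C ^+ i * tpoly c2 (n - i) h +
   \sum_(0 <= i < n) c1 i * c2 (n - i)%N * h%:C ^+ n.
  rewrite -big_split/= !big_nat; apply: eq_bigr => i /andP[_ ni].
  rewrite subSn ?(ltnW ni)// tpolyS mulrDr; congr (_ + _).
  have -> : h%:C ^+ n = h%:C ^+ i * h%:C ^+ (n - i) by rewrite -exprD subnKC// ltnW.
  by ring.
rewrite -addrA; congr (_ + _).
by rewrite big_nat_recr//= mulrDl mulr_suml subnn; congr (_ + _); ring.
Qed.

(** With Cauchy product coefficients the remainder is (F - P) G, P the Taylor polynomial of F, plus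
    the terms of P times remainders of G of complementary order. The [n] terms of this sum share the
    bound 2 A^2 (K |h|)^n. *)
Lemma anaM F G a : ana F a -> ana G a -> ana (fun x => F x * G x) a.
Proof.
move=> aF aG.
have [c1 [A1 [K1 [d1 [A10 K10 d10 Kd1 H1]]]]] := aF.
have [c2 [A [K [d2 [[A1A A0] [K1K K0] d20 Kd2 H2]]]]] := anaE aG A1 K1.
have {}H1 n h : `|h| < d1 -> normc (F (a + h) - tpoly c1 n h) <= A * (K * `|h|) ^+ n.
  move=> hd; apply: le_trans (H1 n h hd) _.
  by apply: ler_geo => //; exact: ltW.
pose d := Num.min d1 d2.
have d0 : 0 < d by rewrite lt_min d10.
have Kd : K * d <= 1.
  by apply: le_trans Kd2; rewrite ler_pM2l// ge_min lexx orbT.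
have H1' n h : `|h| < d -> normc (F (a + h) - tpoly c1 n h) <= A * (K * `|h|) ^+ n.
  by rewrite lt_min => /andP[hd _]; exact: H1.
have cb := ana_coef A0 K0 d0 Kd H1'.
apply: (@anaI _ _ (fun k => \sum_(0 <= i < k.+1) c1 i * c2 (k - i)%N)
   (2 * A ^+ 2) (2 * K) d) => //.
- by rewrite mulr_ge0// sqr_ge0.
- by rewrite mulr_gt0.
move=> n h hd; have /andP[hd1 hd2] : (`|h| < d1) && (`|h| < d2) by rewrite -lt_min.
rewrite tpoly_mul.
have -> : F (a + h) * G (a + h) - \sum_(0 <= i < n) c1 i * h%:C ^+ i * tpoly c2 (n - i) h =
   (F (a + h) - tpoly c1 n h) * G (a + h) +
   \sum_(0 <= i < n) c1 i * h%:C ^+ i * (G (a + h) - tpoly c2 (n - i) h).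
  under [X in _ = _ + X]eq_bigr do rewrite mulrBr.
  by rewrite sumrB -mulr_suml -/(tpoly c1 n h); ring.
apply: le_trans (le_normcD _ _) _.
have Kh0 : 0 <= K * `|h| by rewrite mulr_ge0// ltW.
have e1 : normc ((F (a + h) - tpoly c1 n h) * G (a + h)) <= A ^+ 2 * (K * `|h|) ^+ n.
  rewrite Normc.normcM.
  have := H2 0%N h hd2; rewrite tpoly0 subr0 expr0 mulr1 => hG.
  have -> : A ^+ 2 * (K * `|h|) ^+ n = A * (K * `|h|) ^+ n * A by ring.
  by apply: ler_pM; rewrite ?normc_ge0// H1.
have e2 : normc (\sum_(0 <= i < n) c1 i * h%:C ^+ i * (G (a + h) - tpoly c2 (n - i) h))
    <= n%:R * (2 * A ^+ 2 * (K * `|h|) ^+ n).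
  apply: le_trans (normc_sum _ _ _) _.
  rewrite -[n%:R]/(n%:R) mulr_natl -[X in _ *+ X]subn0 -sumr_const_nat.
  rewrite !big_nat; apply: ler_sum => i /andP[_ ni].
  rewrite !Normc.normcM normcX normc_real.
  have -> : 2 * A ^+ 2 * (K * `|h|) ^+ n =
     2 * A * K ^+ i * `|h| ^+ i * (A * (K * `|h|) ^+ (n - i)).
    rewrite -[in LHS](subnKC (ltnW ni)) exprD [in LHS]exprMn; ring.
  apply: ler_pM; rewrite ?mulr_ge0 ?normc_ge0 ?exprn_ge0//; last exact: H2.
  by rewrite ler_wpM2r ?exprn_ge0.
apply: le_trans (lerD e1 e2) _.
have -> : A ^+ 2 * (K * `|h|) ^+ n + n%:R * (2 * A ^+ 2 * (K * `|h|) ^+ n) =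
   (1 + 2 * n%:R) * (A ^+ 2 * (K * `|h|) ^+ n) by ring.
have -> : 2 * A ^+ 2 * (2 * K * `|h|) ^+ n =
   (2 * 2 ^+ n) * (A ^+ 2 * (K * `|h|) ^+ n) by rewrite -[2 * K * `|h|]mulrA [(2 * _) ^+ n]exprMn; ring.
rewrite ler_wpM2r ?mulr_ge0 ?exprn_ge0 ?(ltW A0)//.
(* The factor 1 + 2 n is at most 2 * 2^n; this is why the rate was doubled to 2 K. *)
elim: n {e1 e2} => [|n IH]; first by rewrite expr0; lra.
have p2 : 1 <= 2 ^+ n :> R by rewrite exprn_ege1// ler1n.
by rewrite exprS -natr1; lra.
Qed.

Lemma anaB F G a : ana F a -> ana G a -> ana (fun x => F x - G x) a.
Proof.
move=> aF aG.
have [c1 [A1 [K1 [d1 [A10 K10 d10 Kd1 H1]]]]] := aF.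
have [c2 [A [K [d2 [[A1A A0] [K1K K0] d20 Kd2 H2]]]]] := anaE aG A1 K1.
apply: (@anaI _ _ (fun k => c1 k - c2 k) (A1 + A) K (Num.min d1 d2)) => //.
- by rewrite addr_ge0// ltW.
- by rewrite lt_min d10.
move=> n h; rewrite lt_min => /andP[hd1 hd2].
have -> : F (a + h) - G (a + h) - tpoly (fun k => c1 k - c2 k) n h =
  (F (a + h) - tpoly c1 n h) - (G (a + h) - tpoly c2 n h).
  rewrite /tpoly; under eq_bigr do rewrite mulrBl.
  by rewrite sumrB; ring.
apply: le_trans (normc_B _ _) _; rewrite mulrDl; apply: lerD (H2 n h hd2).
apply: le_trans (H1 n h hd1) _.
by apply: ler_geo => //; exact: ltW.
Qed.

Lemma le_all_small (x B e : R) : 0 < e -> (forall h, 0 < h < e -> x <= B * h) -> x <= 0.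
Proof.
move=> e0 H; rewrite leNgt; apply/negP => x0.
pose h := Num.min (e / 2) (x / (2 * (`|B| + 1))).
have B1 : 0 < `|B| + 1 by rewrite ltr_wpDl.
have h0 : 0 < h by rewrite lt_min !divr_gt0// mulr_gt0.
have he : h < e by apply: le_lt_trans (_ : h <= e / 2) _; [rewrite ge_min lexx|lra].
have := H h; rewrite h0 he => /(_ erefl).
have hx : h * (2 * (`|B| + 1)) <= x.
  by rewrite -ler_pdivlMr ?mulr_gt0// ge_min lexx orbT.
have : B * h <= (`|B| + 1) * h.
  by rewrite ler_wpM2r ?(ltW h0)// (le_trans (ler_norm _))// lerDl.
by move: hx x0; lra.
Qed.

(** Zeros on the right alone suffice: the first nonzero coefficient would satisfy |c k| <= A K^(k+1)
    h for all small h > 0. Once all coefficients vanish, the remainders with K |h| <= 1/2 force F to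
    vanish on both sides. *)
Lemma ana_zero_right F a e : ana F a -> 0 < e ->
  (forall h, 0 < h < e -> F (a + h) = 0) ->
  exists2 e', 0 < e' & forall h, `|h| < e' -> F (a + h) = 0.
Proof.
move=> [c [A [K [d [A0 K0 d0 Kd H]]]]] e0 F0.
have c0 k : c k = 0.
  elim/ltn_ind: k => k IH.
  apply: Normc.eq0_normc; apply/eqP; rewrite eq_le normc_ge0 andbT.
  apply: (@le_all_small _ (A * K ^+ k.+1) (Num.min e d)); first by rewrite lt_min e0.
  move=> h /andP[h0]; rewrite lt_min => /andP[he hd].
  have := H k.+1 h; rewrite (gtr0_norm h0) => /(_ hd).
  rewrite F0 ?h0// sub0r normcN tpolyS.
  have -> : tpoly c k h = 0.
    by rewrite /tpoly big_nat big1// => i /andP[_ ik]; rewrite IH// mul0r.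
  rewrite add0r Normc.normcM normcX normc_real (gtr0_norm h0) exprMn.
  rewrite [h ^+ k.+1]exprS !mulrA ler_pM2r ?exprn_gt0//.
exists (Num.min d (K^-1 / 2)); first by rewrite lt_min d0 divr_gt0// invr_gt0.
move=> h; rewrite lt_min => /andP[hd hK].
apply: Normc.eq0_normc; apply/eqP; rewrite eq_le normc_ge0 andbT.
have Kh : 0 <= K * `|h| <= 2^-1.
  rewrite mulr_ge0 ?(ltW K0)//= -ler_pdivlMl//; exact: ltW.
have hn n : normc (F (a + h)) <= A * 2^-1 ^+ n.
  have := H n h hd; have -> : tpoly c n h = 0.
    by rewrite /tpoly big1// => i _; rewrite c0 mul0r.
  rewrite subr0 => /le_trans; apply; rewrite ler_wpM2l ?(ltW A0)//.
  by move/andP: Kh => [k0 k1]; apply: lerXn2r; rewrite ?nnegrE ?invr_ge0.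
have cv : (fun n => A * 2^-1 ^+ n) @ \oo --> (0 : R).
  by apply: (@cvg_geometric _ A); rewrite ger0_norm ?invr_ge0// invf_lt1// ltr1n.
rewrite -(cvg_lim (@norm_hausdorff _ _) cv); apply: limr_ge; first by apply: cvgP cv.
by near=> n.
Unshelve. all: by end_near. Qed.

(** Let m be the leftmost point down to which F vanishes. [ana_zero_right] extends the zeros past m
    to the left, a contradiction unless m = al. *)
Lemma ana_identity F (al b0 b1 : R) : al <= b0 -> b0 < b1 ->
  (forall x, al <= x <= b0 -> ana F x) ->
  (forall t, b0 < t < b1 -> F t = 0) -> F al = 0.
Proof.
move=> ab0 b01 aF F0.
pose S := [set x | al <= x <= b0 /\ forall t, x < t < b1 -> F t = 0].
have Sb0 : S b0 by split; rewrite ?ab0 ?lexx.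
have hS : has_inf S.
  split; first by exists b0.
  by exists al => x [/andP[]].
pose m := inf S.
have alm : al <= m by apply: lb_le_inf; [exists b0|move=> x [/andP[]]].
have mb0 : m <= b0 by apply: (ge_inf hS.2).
have Fm t : m < t < b1 -> F t = 0.
  move=> /andP[mt tb].
  have [x Sx xt] := inf_lt hS.1 mt.
  by apply: Sx.2; rewrite xt.
have am : ana F m by apply: aF; rewrite alm.
have mb1 : 0 < b1 - m by rewrite subr_gt0 (le_lt_trans mb0).
have [|e e0 Fe] := ana_zero_right am mb1.
  by move=> h /andP[h0 hb]; apply: Fm; apply/andP; split; lra.
move: alm; rewrite le_eqVlt => /predU1P[->|alm].
  by rewrite -[m]addr0; apply: Fe; rewrite normr0.
pose x := Num.max al (m - e / 2).
have xm : x < m by rewrite gt_max alm /=; lra.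
have : m <= x.
  apply: (ge_inf hS.2); split.
    by rewrite le_max lexx/= (le_trans (ltW xm)).
  move=> t /andP[xt tb1]; have [tm|mt] := leP t m; last by apply: Fm; rewrite mt.
  have -> : t = m + (t - m) by ring.
  apply: Fe; rewrite ler0_norm; last by lra.
  by move: xt; rewrite gt_max => /andP[_]; lra.
by rewrite leNgt xm.
Qed.

End Analytic.

(** * Laplace transforms are analytic in the abscissa *)

Section AnalyticLaplace.
Context {R : realType}.
Local Notation C := (R[i]).
Local Notation normc := (@Normc.normc R).
Implicit Types (g : R -> R) (a h y : R).

Lemma pow_fact_le (x : R) n : 0 <= x -> x ^+ n / n`!%:R <= expR x.
Proof.
move=> x0; case: n => [|n]; last by apply: le_trans (expR_ge1Dxn n x0); rewrite lerDr.
by rewrite expr0 divr1 -expR0 ler_expR.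
Qed.

Lemma exp_partial_le (x : R) n : 0 <= x -> \sum_(0 <= k < n) x ^+ k / k`!%:R <= expR x.
Proof.
move=> x0; rewrite /expR -/(series (exp_coeff x) n).
apply: (@nondecreasing_cvgn_le _ (series (exp_coeff x))) => //.
  by apply: nondecreasing_series => i _ _; exact: exp_coeff_ge0.
exact: is_cvg_series_exp_coeff.
Qed.

Lemma exp_taylor (x : R) n :
  `|expR x - \sum_(0 <= k < n) x ^+ k / k`!%:R| <= `|x| ^+ n / n`!%:R * expR `|x|.
Proof.
have cv : (fun N => `|series (exp_coeff x) N - \sum_(0 <= k < n) x ^+ k / k`!%:R|)
    @ \oo --> `|expR x - \sum_(0 <= k < n) x ^+ k / k`!%:R|.
  apply: cvg_norm; apply: cvgB; last exact: cvg_cst.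
  by rewrite /expR; exact: is_cvg_series_exp_coeff.
rewrite -(cvg_lim (@norm_hausdorff _ _) cv); apply: limr_le; first by apply: cvgP cv.
exists n => // N /= nN.
rewrite /series /= (@big_cat_nat _ _ _ n)//= addrAC subrr add0r.
apply: le_trans (ler_norm_sum _ _ _) _.
rewrite -{1}[n]add0n big_addn.
apply: (@le_trans _ _ (\sum_(0 <= k < N - n) `|x| ^+ n / n`!%:R * (`|x| ^+ k / k`!%:R))).
  apply: ler_sum => k _.
  rewrite /exp_coeff/= normrM normrX normfV (ger0_norm (ler0n _ _)) exprD.
  have -> : `|x| ^+ n / n`!%:R * (`|x| ^+ k / k`!%:R) =
      `|x| ^+ k * `|x| ^+ n / (k`!%:R * n`!%:R) by rewrite invfM; ring.
  rewrite ler_wpM2l ?mulr_ge0 ?exprn_ge0//.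
  rewrite lef_pV2 ?posrE -?natrM ?ltr0n ?muln_gt0 ?fact_gt0// ler_nat.
  have := bin_fact (leq_addl k n); rewrite addnK => <-.
  by rewrite [(k`! * _)%N]mulnC leq_pmull// bin_gt0 leq_addl.
rewrite -mulr_sumr ler_wpM2l ?divr_ge0 ?exprn_ge0//.
exact: exp_partial_le.
Qed.

Lemma exp_abs_le (x : R) : expR `|x| <= expR x + expR (- x).
Proof.
have [x0|x0] := leP 0 x; first by rewrite ger0_norm// lerDl expR_ge0.
by rewrite ltr0_norm// lerDr expR_ge0.
Qed.

Lemma Lap_sum (gs : nat -> R -> R) n a y : (forall k, adm (gs k) a) ->
  adm (fun v => \sum_(0 <= k < n) gs k v) a /\
  Lap (fun v => \sum_(0 <= k < n) gs k v) a y = \sum_(0 <= k < n) Lap (gs k) a y.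
Proof.
move=> ags; elim: n => [|n [IH1 IH2]].
  have -> : (fun v => \sum_(0 <= k < 0) gs k v) = (fun v => 0 * gs 0%N v).
    by apply/funext => v; rewrite big_nil mul0r.
  split; first exact: admZ.
  by rewrite Lap_Z// mul0r big_nil.
have -> : (fun v => \sum_(0 <= k < n.+1) gs k v) =
    (fun v => \sum_(0 <= k < n) gs k v + gs n v).
  by apply/funext => v; rewrite big_nat_recr.
by split; [exact: admD|rewrite Lap_D// IH2 big_nat_recr].
Qed.

(** Expand e^(h v) under the integral. Convergence at a - e and a + e makes e^(e |v|) |g v|
    integrable at a, through its majorant [G]. For |h| < e / 2, one half of the exponent absorbs
    |v|^n / n!, at the cost of (2 / e)^n, and the other absorbs e^(|h v|). *)
Lemma ana_Lap g a y e : 0 < e -> adm g (a - e) -> adm g (a + e) ->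
  ana (fun r => Lap g r y) a.
Proof.
move=> e0 am ap.
pose G v := (expR (e * v) + expR (- e * v)) * `|g v|.
have mg : measurable_fun setT g by case: am.
have aabs r : adm g r -> adm (fun v => `|g v|) r.
  move=> ar; case: (ar) => _ i; split; first exact: measurableT_comp.
  by apply: eq_integrable i => // v _ /=; rewrite normr_id.
have aG : adm G a.
  have -> : G = (fun v => expR (e * v) * `|g v| + expR (- e * v) * `|g v|).
    by apply/funext => v; rewrite /G mulrDl.
  by apply: admD; apply: adm_exp; apply: aabs.
have G0 v : 0 <= G v by rewrite mulr_ge0// addr_ge0// expR_ge0.
have Ge v : expR (e * `|v|) * `|g v| <= G v.
  rewrite ler_wpM2r// mulNr -[e in leLHS](gtr0_norm e0) -normrM; exact: exp_abs_le.
pose gk k v := v ^+ k / k`!%:R * g v.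
have mgk k : measurable_fun setT (gk k).
  have mX : measurable_fun setT (fun v : R => v ^+ k).
    by apply: continuous_measurable_fun; exact: exprn_continuous.
  by apply: measurable_funM => //; apply: measurable_funM.
have powe n v : `|v| ^+ n / n`!%:R <= (2 / e) ^+ n * expR (e / 2 * `|v|).
  have -> : `|v| ^+ n / n`!%:R = (2 / e) ^+ n * ((e / 2 * `|v|) ^+ n / n`!%:R).
    have ev : 2 / e * (e / 2 * `|v|) = `|v| by field; rewrite gt_eqF.
    by rewrite mulrA -exprMn ev.
  rewrite ler_wpM2l ?exprn_ge0 ?divr_ge0 ?(ltW e0)//.
  by rewrite pow_fact_le// mulr_ge0// divr_ge0// ltW.
have agk k : adm (gk k) a.
  apply: (@adm_dom _ _ (fun v => (2 / e) ^+ k * G v)) => //; last exact: admZ.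
  move=> v; rewrite /gk 2!normrM normfV normrX (ger0_norm (ler0n _ _)).
  apply: (@le_trans _ _ ((2 / e) ^+ k * expR (e / 2 * `|v|) * `|g v|)).
    by rewrite ler_wpM2r.
  rewrite -mulrA ler_wpM2l ?exprn_ge0 ?divr_ge0 ?(ltW e0)//.
  apply: le_trans (Ge v); rewrite ler_wpM2r// ler_expR ler_wpM2r//.
  by lra.
pose D := 2 * I (fun v => `|G v| * expR (a * v)).
have D0 : 0 <= D.
  rewrite mulr_ge0//; apply: I_ge0 => v.
  by rewrite mulr_ge0// expR_ge0.
apply: (@anaI _ _ _ (fun k => Lap (gk k) a y) D (2 / e) (e / 2)) => //.
- by rewrite divr_gt0.
- by rewrite divr_gt0.
move=> n h hd.
pose r v := (expR (h * v) - \sum_(0 <= k < n) (h * v) ^+ k / k`!%:R) * g v.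
have rG v : `|r v| <= (2 / e * `|h|) ^+ n * G v.
  rewrite normrM; apply: (@le_trans _ _ (`|h * v| ^+ n / n`!%:R * expR `|h * v| * `|g v|)).
    by rewrite ler_wpM2r// exp_taylor.
  have -> : `|h * v| ^+ n / n`!%:R = `|h| ^+ n * (`|v| ^+ n / n`!%:R).
    by rewrite normrM exprMn mulrA.
  apply: (@le_trans _ _ (`|h| ^+ n * ((2 / e) ^+ n * expR (e / 2 * `|v|)) *
     expR (e / 2 * `|v|) * `|g v|)).
    rewrite ler_wpM2r//; apply: ler_pM; rewrite ?expR_ge0 ?mulr_ge0 ?exprn_ge0 ?invr_ge0//.
      by rewrite ler_wpM2l ?exprn_ge0// powe.
    by rewrite ler_expR normrM ler_wpM2r// ltW.
  have -> : `|h| ^+ n * ((2 / e) ^+ n * expR (e / 2 * `|v|)) * expR (e / 2 * `|v|) * `|g v|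
    = (2 / e * `|h|) ^+ n * (expR (e / 2 * `|v|) * expR (e / 2 * `|v|) * `|g v|).
    by rewrite [in RHS]exprMn; ring.
  have qh : 0 <= 2 / e * `|h| by rewrite mulr_ge0// divr_ge0// ltW.
  rewrite ler_wpM2l ?exprn_ge0//.
  apply: le_trans (Ge v); rewrite -expRD; rewrite le_eqVlt; apply/orP; left; apply/eqP.
  by congr (expR _ * _); field.
have [aS LS] := @Lap_sum (fun k v => h ^+ k * gk k v) n a y (fun k => admZ _ (agk k)).
have ah : adm (fun v => expR (h * v) * g v) a.
  apply: (@adm_dom _ _ G) => //.
    by apply: measurable_funM => //; exact: measurable_expZ.
  move=> v; rewrite normrM (ger0_norm (expR_ge0 _)); apply: le_trans (Ge v).
  rewrite ler_wpM2r// ler_expR; apply: le_trans (ler_norm _) _.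
  rewrite normrM ler_wpM2r//; lra.
have ar : adm r a.
  have -> : r = (fun v => expR (h * v) * g v + -1 * \sum_(0 <= k < n) h ^+ k * gk k v).
    apply/funext => v; rewrite /r mulrBl; congr (_ + _).
    rewrite mulN1r mulr_suml; congr (- _); apply: eq_bigr => k _.
    by rewrite /gk exprMn; ring.
  by apply: admD => //; exact: admZ.
have E : Lap g (a + h) y - tpoly (fun k => Lap (gk k) a y) n h = Lap r a y.
  have -> : r = (fun v => expR (h * v) * g v + -1 * \sum_(0 <= k < n) h ^+ k * gk k v).
    apply/funext => v; rewrite /r mulrBl; congr (_ + _).
    rewrite mulN1r mulr_suml; congr (- _); apply: eq_bigr => k _.
    by rewrite /gk exprMn; ring.
  rewrite Lap_D//; last exact: admZ.
  rewrite Lap_exp Lap_Z// LS.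
  have -> : (-1)%:C = -1 :> C by rewrite rmorphN1.
  rewrite mulN1r; congr (_ - _); apply: eq_bigr => k _.
  by rewrite Lap_Z// rmorphXn mulrC.
rewrite E; apply: le_trans (Lap_bound _ ar) _.
have -> : D * (2 / e * `|h|) ^+ n =
    2 * ((2 / e * `|h|) ^+ n * I (fun v => `|G v| * expR (a * v))) by rewrite /D; ring.
rewrite ler_pM2l// -I_Z; last by case: aG.
apply: I_le; [by case: ar|by apply: itgZ; case: aG|].
move=> v; rewrite mulrA ler_wpM2r ?expR_ge0//.
by rewrite (ger0_norm (G0 v)).
Qed.

End AnalyticLaplace.

(** * From complex power series to real-variable estimates *)

Section ComplexConvergence.
Context {R : realType}.
Local Notation C := (R[i]).
Local Notation normc := (@Normc.normc R).

(** The norm of [R[i]] takes its values in [R[i]]; the estimates of this proof live in [R]. *)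
Lemma cvgC_normc (u : nat -> CC R) (l : CC R) (e : R) :
  u @ \oo --> l -> 0 < e ->
  exists N, forall n, (N <= n)%N -> normc (l - u n) < e.
Proof.
move=> /cvgrPdist_lt ul e0.
have e0C : 0 < e%:C :> C by rewrite ltcR.
have [N _ NP] := ul _ e0C.
by exists N => n nN; have := NP n nN; rewrite /= -ltcR.
Qed.

Lemma nearC_normc (P : CC R -> Prop) (a : CC R) :
  (\forall z \near a, P z) -> exists2 r : R, 0 < r & forall z, normc (a - z) < r -> P z.
Proof.
move=> /nbhs_ballP [e /= e0 He].
(* A positive element of [R[i]] has zero imaginary part. *)
have eE : e = (complex.Re e)%:C.
  by move: e0; rewrite ltcE /= => /andP[/eqP ime _]; case: e He ime => ? ? ? /= ->.
have r0 : 0 < complex.Re e by move: e0; rewrite ltcE => /andP[].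
exists (complex.Re e) => // z az; apply: He; rewrite /ball /= eE.
by rewrite -ltcR in az.
Qed.

Lemma normc_lt_all0 (z : C) : (forall e : R, 0 < e -> normc z <= e) -> z = 0.
Proof.
move=> H; apply: Normc.eq0_normc; apply/eqP; rewrite eq_le normc_ge0 andbT.
by apply/ler_addgt0Pr => e e0; rewrite add0r; exact: H.
Qed.

(** Restriction to a horizontal line with s = 2 w, which turns c k into c k 2^k. Bounded terms at
    distance r / 2 from the centre give, for |h| < r / 8, a geometric tail of ratio at most 1/2,
    hence the factor 2 before [B]. *)
Lemma ana_analytic_at (Z : CC R -> CC R) (a y : R) :
  analytic_at Z ((2 * a) +i* (2 * y)) ->
  ana (fun r => Z ((2 * r) +i* (2 * y)) : C) a.
Proof.
move=> [c /nearC_normc [r r0 H]]; set z0 : C := (2 * a) +i* (2 * y) in H *.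
have r20 : 0 < r / 2 by rewrite divr_gt0.
have d0 (x : R) : (2 * (a + x)) +i* (2 * y) - z0 = (2 * x)%:C :> C.
  by rewrite /z0; simpc; congr (_ +i* _); ring.
have Hx (x : R) : `|x| < r / 2 ->
    series (fun n => c n * (2 * x)%:C ^+ n : CC R) @ \oo --> Z ((2 * (a + x)) +i* (2 * y)).
  move=> xr; have := H ((2 * (a + x)) +i* (2 * y)).
  rewrite d0; apply.
  by rewrite -normcN opprB d0 normc_real normrM ger0_norm//; lra.
(* From some rank on, a term is the difference of two partial sums within 1 of the limit, so at most
   2; the finitely many earlier terms are added to the bound. *)
have [B B0 HB] : exists2 B : R, 0 < B & forall n, normc (c n) * (r / 2) ^+ n <= B.
  have xr : `|r / 4| < r / 2 by rewrite gtr0_norm ?divr_gt0//; lra.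
  have [N HN] := cvgC_normc (Hx _ xr) ltr01.
  exists (2 + \sum_(0 <= k < N) normc (c k) * (r / 2) ^+ k).
    by rewrite ltr_wpDr// sumr_ge0// => i _; rewrite mulr_ge0 ?normc_ge0 ?exprn_ge0 ?ltW.
  move=> n; have [nN|Nn] := ltnP n N.
    rewrite (bigD1_seq n) ?mem_index_iota ?iota_uniq//= addrCA lerDl.
    by rewrite addr_ge0// sumr_ge0// => i _; rewrite mulr_ge0 ?normc_ge0 ?exprn_ge0 ?ltW.
  rewrite ler_wpDr//.
    by rewrite sumr_ge0// => i _; rewrite mulr_ge0 ?normc_ge0 ?exprn_ge0 ?ltW.
  have h1 := HN n Nn; have h2 := HN n.+1 (leqW Nn).
  set l : C := Z _ in h1 h2; set S := series _ in h1 h2.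
  have -> : normc (c n) * (r / 2) ^+ n = normc ((l - S n) - (l - S n.+1)).
    have -> : (l - S n) - (l - S n.+1) = c n * (2 * (r / 4))%:C ^+ n.
      by rewrite /S /series /= big_nat_recr//=; ring.
    rewrite Normc.normcM normcX normc_real; congr (_ * _ ^+ _).
    by rewrite gtr0_norm ?mulr_gt0 ?divr_gt0//; field.
  by apply: le_trans (normc_B _ _) _; lra.
apply: (@anaI _ _ _ (fun k => c k * 2%:C ^+ k) (2 * B) (4 / r) (r / 8)).
- by rewrite mulr_ge0// ltW.
- by rewrite divr_gt0.
- by rewrite divr_gt0.
move=> n h hr.
have q2 : 4 / r * `|h| <= 2^-1.
  by rewrite mulrAC ler_pdivrMr//; lra.
have q0 : 0 <= 4 / r * `|h| by rewrite mulr_ge0// divr_ge0// ltW.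
have part N : (n <= N)%N -> \sum_(n <= k < N) normc (c k * (2 * h)%:C ^+ k) <=
     2 * B * (4 / r * `|h|) ^+ n.
  move=> nN; apply: (@le_trans _ _ (\sum_(n <= k < N) B * (4 / r * `|h|) ^+ k)).
    apply: ler_sum => k _; rewrite Normc.normcM normcX normc_real.
    have -> : normc (c k) * `|2 * h| ^+ k =
        normc (c k) * (r / 2) ^+ k * (4 / r * `|h|) ^+ k.
      rewrite -mulrA -exprMn; congr (_ * _ ^+ _).
      by rewrite normrM ger0_norm//; field; rewrite gt_eqF.
    by rewrite ler_wpM2r// exprn_ge0.
  rewrite -mulr_sumr [2 * B * _](_ : _ = B * (2 * (4 / r * `|h|) ^+ n)); last by ring.
  rewrite ler_pM2l//.
  set q := 4 / r * `|h| in q2 q0 *.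
  elim: N nN => [|N IH].
    by rewrite leqn0 => /eqP ->; rewrite big_geq// mulr_ge0.
  rewrite leq_eqVlt => /predU1P[<-|]; first by rewrite big_geq// mulr_ge0// exprn_ge0.
  rewrite ltnS => nN.
  have : \sum_(n <= k < N.+1) q ^+ k <= 2 * (q ^+ n - q ^+ N.+1); last first.
    by move=> /le_trans; apply; rewrite ler_pM2l// gerBl exprn_ge0.
  rewrite -[n in X in X <= _]add0n big_addn.
  have -> : q ^+ N.+1 = q ^+ n * q ^+ (N.+1 - n).
    by rewrite -exprD; congr (_ ^+ _); lia.
  under eq_bigr do rewrite addnC exprD.
  rewrite -mulr_sumr; set M := (N.+1 - n)%N.
  have -> : 2 * (q ^+ n - q ^+ n * q ^+ M) = q ^+ n * (2 * (1 - q ^+ M)) by ring.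
  rewrite ler_wpM2l ?exprn_ge0//.
  elim: M => [|M IHM]; first by rewrite big_nil expr0 subrr mulr0.
  rewrite big_nat_recr//= exprS.
  have := exprn_ge0 M q0; nra.
apply/ler_addgt0Pr => e e0.
have hr2 : `|h| < r / 2 by lra.
have [N0 HN] := cvgC_normc (Hx _ hr2) e0.
pose N := maxn n N0.
have nN : (n <= N)%N by rewrite leq_maxl.
have := HN N (leq_maxr _ _); set S := series _ => hS.
set l : C := Z _ in hS *.
have -> : l - tpoly (fun k => c k * 2%:C ^+ k) n h =
   (l - S N) + \sum_(n <= k < N) c k * (2 * h)%:C ^+ k.
  have -> : S N = \sum_(0 <= k < n) c k * (2 * h)%:C ^+ k +
     \sum_(n <= k < N) c k * (2 * h)%:C ^+ k.
    by rewrite /S /series /= (@big_cat_nat _ _ _ n).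
  rewrite /tpoly; under eq_bigr do rewrite -mulrA -exprMn -rmorphM.
  by ring.
apply: le_trans (le_normcD _ _) _; rewrite addrC; apply: lerD; last exact: ltW.
exact: le_trans (normc_sum _ _ _) (part _ nN).
Qed.

End ComplexConvergence.

(** * The phase of zeta on the critical line *)

Section ZetaMellin.
Context {R : realType}.
Local Notation C := (R[i]).
Local Notation normc := (@Normc.normc R).
Implicit Types (v rho y : R).

Let q : R := expR 4^-1.
Let c0 : R := q + q^-1.

Let q_gt1 : 1 < q. Proof. by rewrite expR_gt1 invr_gt0. Qed.
Let q_gt0 : 0 < q. Proof. exact: expR_gt0. Qed.
Let qV : expR (- 4^-1) = q^-1. Proof. exact: expRN. Qed.

(* The second difference annihilates e^{v/4} and e^{-v/4}; it removes both poles
   of the completed zeta function. *)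
Definition sdiff (g : R -> R) v : R :=
  q * g (v + 1) + (q^-1 * g (v + -1) + - c0 * g v).

Lemma adm_sdiff g rho : adm g rho -> adm (sdiff g) rho.
Proof.
move=> ag; apply: admD; first by apply: admZ; exact: adm_shift.
by apply: admD; apply: admZ => //; exact: adm_shift.
Qed.

Lemma Lap_sdiff g rho y : adm g rho ->
  Lap (sdiff g) rho y =
  (q%:C * cexp ((- rho) +i* (- y)) + q^-1%:C * cexp (rho +i* y) - c0%:C) * Lap g rho y.
Proof.
move=> ag.
have s1 := adm_shift 1 ag; have s2 := adm_shift (-1) ag.
rewrite /sdiff Lap_D; [|exact: admZ|by apply: admD; exact: admZ].
rewrite Lap_D; [|exact: admZ|exact: admZ].
rewrite !Lap_Z// !Lap_shift// !mul1r !mulN1r !opprK.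
by rewrite rmorphN; ring.
Qed.

(** At abscissa 1/4 the weights q and 1/q cancel the moduli of the two shift factors. The multiplier
    is then real, and it does not vanish because c0 > 2. *)
Lemma Lap_sdiff_quarter g y : adm g 4^-1 ->
  Lap (sdiff g) 4^-1 y = (2 * cos y - c0)%:C * Lap g 4^-1 y.
Proof.
move=> ag; rewrite Lap_sdiff//; congr (_ * _).
rewrite /cexp/= qV -/q cosN sinN; simpc.
by congr (_ +i* _); field; rewrite gt_eqF.
Qed.

Lemma sdiff_factor_lt0 y : 2 * cos y - c0 < 0.
Proof.
have h : 2 < c0.
  rewrite /c0 -subr_gt0; have -> : q + q^-1 - 2 = (q - 1) ^+ 2 / q.
    by field; rewrite gt_eqF.
  by rewrite divr_gt0// exprn_gt0// subr_gt0.
by have := cos_le1 y; lra.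
Qed.

Definition omega v : R := theta_tail (expR v).

(** n^2 e^v = e^(v + 2 ln n): each theta term is a translate of [ker], whose transform carries the
    factor n^(-2 w) = n^(-s). *)
Let lnk k : R := 2 * ln k.+1%:R.

Lemma theta_termE v k : theta_term (expR v) k = ker (v + lnk k).
Proof.
rewrite /theta_term /ker /lnk expRD expRM_natl lnK ?posrE ?ltr0n//.
by congr (expR (- _)); ring.
Qed.

Lemma omega_even v : 1 + 2 * omega (- v) = expR (v / 2) * (1 + 2 * omega v).
Proof.
rewrite /omega expRN theta_functional ?expR_gt0//; congr (_ * _).
apply: (@pexpIrn _ 2) => //; rewrite ?nnegrE ?sqrtr_ge0 ?expR_ge0//.
by rewrite sqr_sqrtr ?expR_ge0// -expRM_natl; congr expR; field.
Qed.

Let b k : R := (k.+1%:R ^+ 2)^-1.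

Lemma basel_cvg : cvgn (series b).
Proof.
apply: nondecreasing_is_cvgn.
  apply: nondecreasing_series => i _ _; rewrite invr_ge0; exact: exprn_ge0.
exists 2 => _ [n _ <-].
have h : series b n <= 2 - 2 / n.+1%:R.
  elim: n => [|n IH]; first by rewrite /series/= big_nil divr1 subrr.
  rewrite /series/= big_nat_recr//=; move: IH; rewrite /series/= => IH.
  have n0 : 0 < n.+1%:R :> R by rewrite ltr0n.
  have n1 : 0 < n.+2%:R :> R by rewrite ltr0n.
  have E : n.+2%:R = n.+1%:R + 1 :> R by rewrite natr1.
  have : b n - (n.+1%:R^-1 - n.+2%:R^-1) <= n.+1%:R^-1 - n.+2%:R^-1.
    rewrite /b; set a := n.+1%:R in n0 E *; rewrite E.
    have a1 : 1 <= a by rewrite ler1n.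
    rewrite -subr_ge0.
    have -> : a^-1 - (a + 1)^-1 - ((a ^+ 2)^-1 - (a^-1 - (a + 1)^-1)) = (a - 1) / (a ^+ 2 * (a + 1)).
      by field; rewrite !gt_eqF//; lra.
    by rewrite divr_ge0 ?mulr_ge0 ?exprn_ge0//; lra.
  set i1 := n.+1%:R^-1 in IH *; set i2 := n.+2%:R^-1; lra.
by apply: le_trans h _; rewrite gerBl divr_ge0.
Qed.

Let S : R := limn (series b).

(** Two decay rates are enough: n = 2 serves for v > 0 and n = 1 for v < 0, which together cover 1 <
    rho < 2. In both cases n! <= 2 and the dependence on k is summable. *)
Lemma ker_lnk_le n v k : (1 <= n <= 2)%N -> ker (v + lnk k) <= 2 * expR (- (n%:R * v)) * b k.
Proof.
move=> n12; apply: le_trans (ker_le n _) _.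
rewrite -mulrA; apply: ler_pM; rewrite ?expR_ge0//.
  by case: n n12 => [//|[|[|//]]] _; rewrite ler_nat.
rewrite mulrDr opprD expRD ler_wpM2l ?expR_ge0//.
rewrite /b expRN lef_pV2 ?posrE ?expR_gt0 ?exprn_gt0//.
have -> : k.+1%:R ^+ 2 = expR (lnk k) :> R by rewrite /lnk expRM_natl lnK ?posrE ?ltr0n.
have l0 : 0 <= lnk k by rewrite /lnk mulr_ge0// ln_ge0// ler1n.
have n1 : 1 <= n%:R :> R by rewrite ler1n; case/andP: n12.
by rewrite ler_expR ler_peMl.
Qed.

Lemma omega_tail n v N : (1 <= n <= 2)%N ->
  0 <= omega v - \sum_(0 <= k < N) ker (v + lnk k) <= 2 * expR (- (n%:R * v)) * (S - series b N).
Proof.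
move=> n12; have cO := @theta_series_cvg R (expR v) (expR_gt0 v).
have E M : series (theta_term (expR v)) M = \sum_(0 <= k < M) ker (v + lnk k).
  by rewrite /series/=; apply: eq_bigr => k _; exact: theta_termE.
apply/andP; split.
  rewrite subr_ge0 -E; apply: nondecreasing_cvgn_le => //.
  by apply: nondecreasing_series => i _ _; exact: expR_ge0.
rewrite lerBlDl -E; apply: limr_le => //; exists N => // M /= NM.
rewrite [leLHS]E [in leRHS]E [leLHS](@big_cat_nat _ _ _ N)//= lerD2l.
apply: (@le_trans _ _ (2 * expR (- (n%:R * v)) * \sum_(N <= k < M) b k)).
  rewrite mulr_sumr; apply: ler_sum => k _; exact: ker_lnk_le.
rewrite ler_wpM2l ?mulr_ge0 ?expR_ge0//; apply: series_sub_nonneg => //.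
  by move=> k; rewrite invr_ge0; exact: exprn_ge0.
exact: basel_cvg.
Qed.

Lemma omega_bound n v : (1 <= n <= 2)%N -> 0 <= omega v <= 2 * expR (- (n%:R * v)) * S.
Proof.
move=> n12; have := omega_tail v 0 n12.
have -> : series b 0 = 0 by rewrite /series/= big_nil.
by rewrite big_nil !subr0.
Qed.

Definition omegaN N v : R := \sum_(0 <= k < N) ker (v + lnk k).

Lemma measurable_omegaN N : measurable_fun setT (omegaN N).
Proof.
apply: measurable_sum => k; apply: measurableT_comp; first exact: measurable_ker.
exact: measurable_shift.
Qed.

Lemma measurable_omega : measurable_fun setT omega.
Proof.
apply: (measurable_fun_cvg measurable_omegaN) => v _.
have := @theta_series_cvg R (expR v) (expR_gt0 v).
have -> // : (fun N => omegaN N v) = series (theta_term (expR v)).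
by apply/funext => N; rewrite /omegaN /series/=; apply: eq_bigr => k _; rewrite theta_termE.
Qed.

Lemma measurable_sdiff g : measurable_fun setT g -> measurable_fun setT (sdiff g).
Proof.
move=> mg; have ms c : measurable_fun setT (fun v : R => g (v + c)).
  by apply: measurableT_comp => //; exact: measurable_shift.
by apply: measurable_funD; [|apply: measurable_funD]; apply: measurable_funM => //; exact: ms.
Qed.

(** For n <= 2, a shift by 1 in either direction multiplies e^(-n v) by at most e^2, and 1/q <=
    q. *)
Let K : R := q * expR 2 + q * expR 2 + c0.

Lemma K_gt0 : 0 < K.
Proof.
have := expR_gt0 (2 : R); have := q_gt0; have : 0 < q^-1 by rewrite invr_gt0.
rewrite /K /c0 => h1 h2 h3.
by rewrite !addr_gt0// mulr_gt0.
Qed.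

Lemma sdiff_bound (g : R -> R) (A : R) (n : nat) v : (n <= 2)%N -> 0 <= A ->
  (forall v, `|g v| <= A * expR (- (n%:R * v))) ->
  `|sdiff g v| <= K * A * expR (- (n%:R * v)).
Proof.
move=> n2 A0 gA.
have n2R : n%:R <= 2 :> R by rewrite ler_nat.
have e2 : `|g (v + 1)| <= A * expR (- (n%:R * v)) * expR 2.
  apply: le_trans (gA _) _; rewrite -mulrA -expRD ler_wpM2l// ler_expR.
  by have : 0 <= n%:R :> R by []; lra.
have e3 : `|g (v + -1)| <= A * expR (- (n%:R * v)) * expR 2.
  apply: le_trans (gA _) _; rewrite -mulrA -expRD ler_wpM2l// ler_expR; lra.
have e1 := gA v.
have qi : q^-1 <= q by rewrite (le_trans (_ : q^-1 <= 1)) ?invf_le1 ?ltW.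
have qi0 : 0 < q^-1 by rewrite invr_gt0.
have q0 := q_gt0.
have cp : 0 < c0 by rewrite addr_gt0.
have E0 : 0 <= A * expR (- (n%:R * v)) * expR 2 by rewrite !mulr_ge0// expR_ge0.
rewrite /sdiff; apply: le_trans (ler_normD _ _) _.
have h : `|q^-1 * g (v + -1) + - c0 * g v| <= q^-1 * `|g (v + -1)| + c0 * `|g v|.
  apply: le_trans (ler_normD _ _) _.
  by rewrite !normrM normrN (gtr0_norm qi0) (gtr0_norm cp).
rewrite normrM (gtr0_norm q0).
have h1 : q * `|g (v + 1)| <= q * (A * expR (- (n%:R * v)) * expR 2) by rewrite ler_wpM2l// ltW.
have h2 : q^-1 * `|g (v + -1)| <= q * (A * expR (- (n%:R * v)) * expR 2).
  by apply: ler_pM => //; exact: ltW.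
have h3 : c0 * `|g v| <= c0 * (A * expR (- (n%:R * v))) by rewrite ler_wpM2l// ltW.
have -> : K * A * expR (- (n%:R * v)) =
   q * (A * expR (- (n%:R * v)) * expR 2) + (q * (A * expR (- (n%:R * v)) * expR 2) +
   c0 * (A * expR (- (n%:R * v)))) by rewrite /K; ring.
by lra.
Qed.

(** [omega_even] says that phi v = e^(v/4) (1/2 + omega v) is even. As [sdiff] kills constants,
    e^(v/4) sdiff omega v equals phi (v + 1) + phi (v - 1) - c0 phi v, which is even too. *)
Lemma sdiff_omega_even v :
  sdiff omega (- v) * expR (4^-1 * - v) = sdiff omega v * expR (4^-1 * v).
Proof.
have E1 : omega (- v) = (expR (v / 2) * (1 + 2 * omega v) - 1) / 2.
  by rewrite -omega_even; field.
have E2 : omega (- v + 1) = (expR ((v + -1) / 2) * (1 + 2 * omega (v + -1)) - 1) / 2.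
  by rewrite -omega_even opprD opprK; field.
have E3 : omega (- v + -1) = (expR ((v + 1) / 2) * (1 + 2 * omega (v + 1)) - 1) / 2.
  by rewrite -omega_even opprD; field.
rewrite /sdiff E1 E2 E3.
pose u : R := expR (4^-1 * v).
have u0 : u != 0 by rewrite gt_eqF// expR_gt0.
have q0 : q != 0 by rewrite gt_eqF.
have -> : expR (v / 2) = u ^+ 2 by rewrite /u -expRM_natl; congr expR; field.
have -> : expR ((v + -1) / 2) = u ^+ 2 / q ^+ 2.
  by rewrite /u /q -!expRM_natl -expRN -expRD; congr expR; field.
have -> : expR ((v + 1) / 2) = u ^+ 2 * q ^+ 2.
  by rewrite /u /q -!expRM_natl -expRD; congr expR; field.
have -> : expR (4^-1 * - v) = u^-1 by rewrite mulrN expRN.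
rewrite -/u /c0; clearbody u.
move: (omega (v + 1)) (omega (v + -1)) (omega v) (q) q0 => x y z p p0.
by field; rewrite p0 u0.
Qed.

Lemma sdiff_omega_bound n v : (1 <= n <= 2)%N ->
  `|sdiff omega v| <= K * (2 * S) * expR (- (n%:R * v)).
Proof.
move=> n12; have S0 : 0 <= S.
  have /andP[h1 h2] := omega_bound 0 n12; have := le_trans h1 h2.
  by rewrite mulr0 oppr0 expR0 mulr1 pmulr_rge0.
apply: sdiff_bound; [by case/andP: n12|by rewrite mulr_ge0|move=> w].
have /andP[h1 h2] := omega_bound w n12.
by rewrite ger0_norm//; apply: le_trans h2 _; rewrite mulrAC.
Qed.

(** The decay e^(-2 v) at +oo is carried by evenness to e^(2 v - v/2) = e^(3 v/2) at -oo. The strip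
    so obtained contains both 1/4 and the range of [zeta_Mellin]. *)
Lemma adm_sdiff_omega rho : - (3 / 2) < rho < 2 -> adm (sdiff omega) rho.
Proof.
move=> rr; apply: (@adm_two_sided _ _ _ (K * (2 * S)) (- (3 / 2)) 2) => //.
- by apply: measurable_sdiff; exact: measurable_omega.
- move=> v; have -> : sdiff omega v = sdiff omega (- v) * expR (- (v / 2)).
    have := sdiff_omega_even v; move: (sdiff omega v) (sdiff omega (- v)) => s1 s2.
    move=> /(congr1 (fun z => z * expR (- (4^-1 * v)))).
    rewrite -!mulrA -!expRD subrr expR0 mulr1 => <-.
    by congr (_ * expR _); field.
  rewrite normrM (ger0_norm (expR_ge0 _)).
  have := @sdiff_omega_bound 2 (- v) erefl => /(ler_wpM2r (expR_ge0 (- (v / 2)))) /le_trans; apply.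
  rewrite le_eqVlt; apply/orP; left; apply/eqP.
  by rewrite -[LHS]mulrA -expRD; congr (_ * expR _); field.
- by move=> v; exact: (@sdiff_omega_bound 2 v erefl).
Qed.

Lemma Lap_omegaN N rho y : 0 < rho ->
  adm (sdiff (omegaN N)) rho /\
  Lap (sdiff (omegaN N)) rho y =
  series (fun k => natpowc k.+1 (- ((2 * rho) +i* (2 * y)))) N * Lap (sdiff ker) rho y.
Proof.
move=> r0; have ak := adm_ker r0.
have as_ k : adm (fun v => ker (v + lnk k)) rho by exact: adm_shift.
have [aO LO] := @Lap_sum R (fun k v => ker (v + lnk k)) N rho y as_.
split; first exact: adm_sdiff.
rewrite Lap_sdiff// Lap_sdiff//.
have -> : Lap (omegaN N) rho y =
   series (fun k => natpowc k.+1 (- ((2 * rho) +i* (2 * y)))) N * Lap ker rho y.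
  rewrite /omegaN LO /series/= mulr_suml; apply: eq_bigr => k _.
  rewrite Lap_shift// /natpowc; congr (cexp _ * _); rewrite /lnk; simpc.
  by congr (_ +i* _); ring.
by ring.
Qed.

(** Termwise integration, with an explicit bound for the transform of the tail of theta in place of
    an exchange theorem. Here Re s > 2. *)
Lemma zeta_Mellin (Z : CC R -> CC R) rho y : is_riemann_zeta Z -> 1 < rho < 2 ->
  Lap (sdiff ker) rho y * Z ((2 * rho) +i* (2 * y)) = Lap (sdiff omega) rho y.
Proof.
move=> [Z1 _] r12; have r0 : 0 < rho by case/andP: r12; lra.
pose e := Num.min (rho - 1) (2 - rho).
have e0 : 0 < e by rewrite lt_min; case/andP: r12 => ? ?; rewrite !subr_gt0; apply/andP.
have aO : adm (sdiff omega) rho by apply: adm_sdiff_omega; case/andP: r12 => ? ?; apply/andP; split; lra.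
set s : C := (2 * rho) +i* (2 * y).
have cZ : series (fun n => natpowc n.+1 (- s)) @ \oo --> Z s.
  by apply: Z1; rewrite /s/=; case/andP: r12; lra.
set L := Lap (sdiff ker) rho y.
set J := I (fun v : R => expR (- (e * `|v|))).
(* In the constant 4, one factor 2 comes from [Lap_bound] and the other from [omega_tail]. *)
have tailN N : normc (Lap (sdiff omega) rho y - series (fun n => natpowc n.+1 (- s)) N * L)
    <= (4 * K * J) * (S - series b N).
  have [aN LN] := @Lap_omegaN N rho y r0; rewrite -LN.
  pose D v := sdiff omega v + -1 * sdiff (omegaN N) v.
  have aD : adm D rho by apply: admD => //; exact: admZ.
  have -> : Lap (sdiff omega) rho y - Lap (sdiff (omegaN N)) rho y = Lap D rho y.
    rewrite /D (Lap_D y aO (admZ (-1) aN)) Lap_Z//.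
    have -> : (-1)%:C = -1 :> C by rewrite rmorphN1.
    by rewrite mulN1r.
  have DE : D = sdiff (fun v => omega v - omegaN N v).
    apply/funext => v; rewrite /D /sdiff.
    move: (omega (v + 1)) (omega (v + -1)) (omega v) (omegaN N (v + 1)) (omegaN N (v + -1)) (omegaN N v).
    by move: (q) (c0) => *; ring.
  have T0 : 0 <= S - series b N.
    have /andP[h1 h2] := @omega_tail 1 0 N erefl.
    have := le_trans h1 h2.
    by rewrite mulr0 oppr0 expR0 mulr1 pmulr_rge0.
  have Db n : (1 <= n <= 2)%N -> forall v, `|D v| <= K * (2 * (S - series b N)) * expR (- (n%:R * v)).
    move=> n12 v; rewrite DE; apply: sdiff_bound; first by case/andP: n12.
      by rewrite mulr_ge0.
    move=> w; have /andP[h1 h2] := @omega_tail n w N n12.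
    by rewrite /omegaN ger0_norm//; apply: le_trans h2 _; rewrite mulrAC.
  apply: le_trans (Lap_bound _ aD) _.
  have -> : 4 * K * J * (S - series b N) = 2 * ((K * (2 * (S - series b N))) * J) by ring.
  rewrite ler_pM2l// /J -I_Z; last exact: itg_exp_abs.
  apply: I_le; [by case: aD|by apply: itgZ; exact: itg_exp_abs|move=> v].
  have KT : 0 <= K * (2 * (S - series b N)).
    by rewrite mulr_ge0 ?(ltW K_gt0)// mulr_ge0.
  have [v0|v0] := leP 0 v.
    apply: le_trans (ler_wpM2r (expR_ge0 _) (Db 2 erefl v)) _.
    rewrite -[leLHS]mulrA -expRD ler_wpM2l// ler_expR ger0_norm//.
    have he : e <= 2 - rho by rewrite ge_min lexx orbT.
    by have := ler_wpM2r v0 he; lra.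
  apply: le_trans (ler_wpM2r (expR_ge0 _) (Db 1 erefl v)) _.
  rewrite -[leLHS]mulrA -expRD ler_wpM2l// ler_expR ltr0_norm//.
  have he : e <= rho - 1 by rewrite ge_min lexx.
  have nv : 0 <= - v by lra.
  by have := ler_wpM2r nv he; lra.
apply/eqP; rewrite -subr_eq0; apply/eqP; apply: normc_lt_all0 => ep ep0.
have J0 : 0 <= J by apply: I_ge0 => v; exact: expR_ge0.
have K0 := K_gt0.
have L0 := normc_ge0 L.
have ep1 : 0 < ep / 2 / (1 + normc L) by rewrite !divr_gt0// ltr_pwDl.
have ep2 : 0 < ep / 2 / (1 + 4 * K * J).
  by rewrite !divr_gt0// ltr_pwDl// !mulr_ge0// ltW.
have [N1 H1] := cvgC_normc cZ ep1.
have /cvgrPdist_lt /(_ _ ep2) [N2 _ H2] := basel_cvg.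
pose N := maxn N1 N2.
have h1 := H1 N (leq_maxl _ _); have h2 := H2 N (leq_maxr _ _).
have h3 := tailN N.
set SN := series (fun n => natpowc n.+1 (- s)) N in h1 h3.
have -> : L * Z s - Lap (sdiff omega) rho y = (Z s - SN) * L - (Lap (sdiff omega) rho y - SN * L).
  by move: (Lap (sdiff omega) rho y) (Z s) (L) (SN) => *; ring.
apply: le_trans (normc_B _ _) _; rewrite Normc.normcM.
have a1 : normc (Z s - SN) * normc L <= ep / 2.
  apply: (@le_trans _ _ (ep / 2 / (1 + normc L) * (1 + normc L))).
    by apply: ler_pM; rewrite ?normc_ge0 ?(ltW h1)// lerDr.
  by rewrite divfK// gt_eqF// ltr_pwDl.
have a2 : 4 * K * J * (S - series b N) <= ep / 2.
  apply: (@le_trans _ _ ((1 + 4 * K * J) * (ep / 2 / (1 + 4 * K * J)))).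
    apply: (@le_trans _ _ (4 * K * J * (ep / 2 / (1 + 4 * K * J)))).
      rewrite ler_wpM2l ?mulr_ge0 ?(ltW K0)//.
      by apply: le_trans (ltW h2); exact: ler_norm.
    by rewrite ler_wpM2r ?(ltW ep2)// lerDr.
  by rewrite mulrC divfK// gt_eqF// ltr_pwDl// !mulr_ge0// ltW.
by move: h3 a1 a2; lra.
Qed.

(** As y is nonzero, the line Im s = 2 y avoids the pole, and [zeta_Mellin] propagates along it to
    abscissa 1/4. There the transform of [sdiff omega] is real by evenness, and it is a nonzero real
    multiple of Gamma times zeta. *)
Lemma zeta_phase (Z : CC R -> CC R) y : is_riemann_zeta Z -> y != 0 ->
  complex.Im (Gam 4^-1 y * Z (2^-1 +i* (2 * y)) : C) = 0.
Proof.
move=> hZ y0.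
pose F rho : C := Lap (sdiff ker) rho y * Z ((2 * rho) +i* (2 * y)) - Lap (sdiff omega) rho y.
have F0 : F 4^-1 = 0.
  (* The zeros on (5/4, 3/2) come from [zeta_Mellin]. The radius 1/8 around points of [1/4, 5/4]
     stays inside both strips of convergence. *)
  apply: (@ana_identity _ F 4^-1 (5 / 4) (3 / 2)); [lra|lra| |].
  - move=> x /andP[x1 x2]; apply: anaB; first apply: anaM.
    + by apply: (@ana_Lap _ _ _ _ 8^-1) => //; apply: adm_sdiff; apply: adm_ker; lra.
    + apply: ana_analytic_at; apply: hZ.2.
      by rewrite eq_complex /= negb_and mulf_neq0 ?orbT.
    + by apply: (@ana_Lap _ _ _ _ 8^-1) => //; apply: adm_sdiff_omega; apply/andP; split; lra.
  - move=> t /andP[t1 t2]; rewrite /F zeta_Mellin ?subrr//.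
    by apply/andP; split; lra.
move: F0; rewrite /F => /eqP; rewrite subr_eq0 => /eqP.
have -> : 2 * 4^-1 = 2^-1 :> R by field.
rewrite Lap_sdiff_quarter; last by apply: adm_ker; rewrite invr_gt0.
rewrite -/(Gam 4^-1 y) -mulrA => E.
have : complex.Im (Lap (sdiff omega) 4^-1 y) = 0.
  apply: Lap_even_real; last exact: sdiff_omega_even.
  by apply: adm_sdiff_omega; apply/andP; split; lra.
rewrite -E; case: (Gam 4^-1 y * _) => re im /=; rewrite mul0r addr0 => /eqP.
by rewrite mulf_eq0 (lt_eqF (sdiff_factor_lt0 _))/= => /eqP.
Qed.

End ZetaMellin.

(** * The phase of Gamma *)

Section GammaPhase.
Context {R : realType}.
Local Notation C := (R[i]).
Local Notation normc := (@Normc.normc R).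
Implicit Types (a b v rho y : R).

Definition gam a : R := I (fun v => ker v * expR (a * v)).

Lemma itg_ker a : 0 < a -> itg (fun v : R => ker v * expR (a * v)).
Proof.
move=> a0; have [_] := adm_ker a0; apply: eq_integrable => // v _ /=.
by rewrite (ger0_norm (ltW (ker_gt0 v))).
Qed.

Lemma Gam_real a : Gam a 0 = (gam a)%:C.
Proof.
rewrite /Gam /Lap /gam; congr (_ +i* _).
  by congr I; apply/funext => v; rewrite mul0r cos0 mulr1.
have -> : (fun v : R => ker v * (expR (a * v) * sin (0 * v))) = (fun v => 0 * ker v).
  by apply/funext => v; rewrite mul0r sin0; ring.
rewrite I.unlock /Rintegral; under eq_integral do rewrite mul0r.
by rewrite integral0.
Qed.

Lemma gam_step a : 0 < a -> pi * gam (a + 1) = a * gam a.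
Proof.
move=> a0; have := Gam_step 0 a0; rewrite !Gam_real => /(congr1 (@complex.Re R)) /=.
by rewrite !mul0r !subr0.
Qed.

Lemma gam_gt0 a : 0 < a -> 0 < gam a.
Proof.
move=> a0.
pose m : R := expR (- (pi * expR 1)).
have m0 : 0 < m by exact: expR_gt0.
have hm : itg (\1_(`[0, 1]%classic : set R) : R -> R).
  exact: integrable_indic_itv.
apply: (@lt_le_trans _ _ (I (fun v => m * \1_(`[0, 1]%classic : set R) v))).
  rewrite I_Z// mulr_gt0//.
  rewrite I.unlock /Rintegral integral_indic//= setIT lebesgue_measure_itv/= lte_fin ltr01.
  by rewrite oppr0 adde0.
apply: I_le; [exact: itgZ|exact: itg_ker|move=> v].
rewrite indicE; case: (boolP (v \in _)) => [|_]; last first.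
  by rewrite mulr0 mulr_ge0// expR_ge0.
rewrite inE/= in_itv/= => /andP[v0 v1]; rewrite mulr1.
rewrite -[m]mulr1; apply: ler_pM => //; first exact: ltW.
  by rewrite /m /ker ler_expR lerN2 ler_pM2l ?pi_gt0// ler_expR.
by rewrite -expR0 ler_expR mulr_ge0// ltW.
Qed.

(** It is x^2 <= 4 sinh(x/2)^2. A second moment against the Gamma weight is thus bounded by values
    of [gam] at a - 1, a and a + 1, which [gam_step] evaluates. *)
Lemma sqr_le_cosh (x : R) : x ^+ 2 <= expR x + expR (- x) - 2.
Proof.
wlog x0 : x / 0 <= x.
  move=> H; have [|x0] := leP 0 x; first exact: H.
  have h : 0 <= - x by lra.
  by have := H _ h; rewrite opprK sqrrN [expR (- x) + _]addrC.
pose e := expR (x / 2); pose e' := expR (- (x / 2)).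
have ee : e * e' = 1 by rewrite /e /e' -expRD subrr expR0.
have -> : expR x = e ^+ 2 by rewrite /e -expRM_natl; congr expR; field.
have -> : expR (- x) = e' ^+ 2 by rewrite /e' -expRM_natl; congr expR; field.
have -> : e ^+ 2 + e' ^+ 2 - 2 = (e - e') ^+ 2 + 2 * (e * e' - 1) by ring.
rewrite ee subrr mulr0 addr0.
apply: lerXn2r; rewrite ?nnegrE ?subr_ge0//.
  by rewrite ler_expR; lra.
have d (t : R) : is_derive t (1:R) (fun t => expR (t / 2) - expR (- (t / 2)) - t)
    (expR (t / 2) / 2 + expR (- (t / 2)) / 2 - 1).
  by apply: is_derive_eq; rewrite /GRing.scale/=; field.
have [x00|xp] := eqVneq x 0; first by rewrite /e /e' x00 mul0r oppr0 expR0 subrr.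
have {}xp : 0 < x by rewrite lt_def xp.
have [|t _] := @MVT R (fun t => expR (t / 2) - expR (- (t / 2)) - t)
  (fun t => expR (t / 2) / 2 + expR (- (t / 2)) / 2 - 1) 0 x xp.
- apply: continuous_subspaceT => t.
  by apply/differentiable_continuous/derivable1_diffP; have [] := d t.
move=> E; have {}E : e - e' - x = (expR (t / 2) / 2 + expR (- (t / 2)) / 2 - 1) * x.
  by move: E; rewrite mul0r oppr0 expR0 -/e -/e'; lra.
rewrite -subr_ge0 E mulr_ge0//.
have h1 := expR_ge1Dx (t / 2); have h2 := expR_ge1Dx (- (t / 2)).
have p1 := expR_gt0 (t / 2); have p2 := expR_gt0 (- (t / 2)).
have pp : expR (t / 2) * expR (- (t / 2)) = 1 by rewrite -expRD subrr expR0.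
lra.
Qed.

Lemma cos_ge1 (x : R) : 1 - x ^+ 2 / 2 <= cos x.
Proof.
have [x0|x0] := leP 0 x; first exact: cos_ge_quad.
by rewrite -cosN -sqrrN cos_ge_quad// oppr_ge0 ltW.
Qed.

Lemma abs_sin_le (x : R) : `|sin x| <= `|x|.
Proof.
have H (z : R) : 0 <= z -> `|sin z| <= z.
  move=> z0; rewrite ler_norml sin_le_id// andbT.
  have [zp|zp] := leP z pi; first by apply: le_trans (sin_ge0_pi _); [lra|rewrite z0].
  by apply: le_trans (sin_geN1 _); have := @pi_ge2 R; lra.
have [x0|x0] := leP 0 x; first by rewrite [`|x|]ger0_norm// H.
by rewrite [`|x|]ltr0_norm// -normrN -sinN H// oppr_ge0 ltW.
Qed.

(* Chebyshev: the weight ker v e^{a v} concentrates near v = ln (a / pi). *)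
Lemma Gam_phase a y de : 1 < a -> 0 < de -> de <= 1 -> y ^+ 2 <= de ^+ 2 * (a - 1) ->
  exists x t : R, [/\ 0 < x, `|t| <= 2 * de &
    Gam a y = (x +i* (x * t)) * cexp (0 +i* (y * ln (a / pi)))].
Proof.
move=> a1 de0 de1 yd; have a0 : 0 < a by lra.
have am : 0 < a - 1 by lra.
have p0 := @pi_gt0 R.
(* The exponent a v - pi e^v of the weight is maximal where e^v = a / pi. *)
pose be := ln (a / pi).
have eb : expR be = a / pi by rewrite /be lnK// posrE divr_gt0.
have ebN : expR (- be) = pi / a by rewrite expRN eb invf_div.
have ak := adm_ker a0.
have hc := adm_cos y ak; have hs := adm_sin y ak.
have k0 := itg_ker a0; have kp : itg (fun v : R => ker v * expR ((a + 1) * v)) by apply: itg_ker; lra.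
have km : itg (fun v : R => ker v * expR ((a - 1) * v)) by exact: itg_ker.
pose g := gam a; have g0 : 0 < g by exact: gam_gt0.
have gp : gam (a + 1) = a / pi * g.
  apply: (mulfI (lt0r_neq0 p0)).
  by rewrite gam_step// mulrA [pi * _]mulrCA divff ?mulr1// gt_eqF.
have gm : gam (a - 1) = pi / (a - 1) * g.
  have := gam_step am; rewrite subrK => e.
  by apply: (mulfI (lt0r_neq0 am)); rewrite -e /g; field; rewrite gt_eqF.
pose V v := ker v * (expR (a * v) * (v - be) ^+ 2).
(* The three integrals are g, a g / (a - 1) and - 2 g, whence I W = g / (a - 1): the variance
   bound. *)
pose W v := expR (- be) * (ker v * expR ((a + 1) * v)) +
  (expR be * (ker v * expR ((a - 1) * v)) - 2 * (ker v * expR (a * v))).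
have VW v : V v <= W v.
  have -> : W v = ker v * (expR (a * v) * (expR (v - be) + expR (- (v - be)) - 2)).
    rewrite /W; have -> : (a + 1) * v = a * v + v by ring.
    have -> : (a - 1) * v = a * v - v by ring.
    by rewrite opprB !expRD; ring.
  by rewrite !ler_wpM2l ?expR_ge0// sqr_le_cosh.
have iW : itg W.
  by apply: itgD; [exact: itgZ|apply: itgB; exact: itgZ].
have IW : I W = g / (a - 1).
  rewrite /W I_D; [|exact: itgZ|by apply: itgB; exact: itgZ].
  rewrite I_B; [|exact: itgZ|exact: itgZ].
  rewrite !I_Z// -/(gam (a + 1)) -/(gam (a - 1)) -/(gam a) -/g gp gm eb ebN.
  by move: (pi) p0 => p p0; field; rewrite !gt_eqF.
have cV : continuous V.
  apply: cont_mul; first exact: continuous_ker.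
  apply: cont_mul; first exact: continuous_expZ.
  have -> : (fun z : R => (z - be) ^+ 2) = (fun z => (z - be) * (z - be)).
    by apply/funext => z; rewrite expr2.
  have cb : continuous (fun z : R => z - be).
    by apply: cont_sub; [move=> z; exact: cvg_id|exact: cont_cst].
  exact: (cont_mul cb cb).
have V0 v : 0 <= V v.
  apply: mulr_ge0; first exact: ltW (ker_gt0 v).
  by apply: mulr_ge0; [exact: expR_ge0|exact: sqr_ge0].
have iV : itg V.
  apply: itg_dom iW; first exact: continuous_measurable_fun.
  by move=> v; rewrite ger0_norm.
have IV : y ^+ 2 * I V <= de ^+ 2 * g.
  apply: (@le_trans _ _ (y ^+ 2 * (g / (a - 1)))).
    by rewrite -IW ler_wpM2l ?sqr_ge0// I_le.
  apply: (@le_trans _ _ (de ^+ 2 * (a - 1) * (g / (a - 1)))).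
    by rewrite ler_wpM2r// divr_ge0// ltW.
  by rewrite le_eqVlt; apply/orP; left; apply/eqP; field; rewrite gt_eqF.
have V00 : 0 <= I V by apply: I_ge0.
(* rotate by the expected phase *)
pose cc v := ker v * (expR (a * v) * cos (y * (v - be))).
pose ss v := ker v * (expR (a * v) * sin (y * (v - be))).
have ccE v : cc v = cos (y * be) * (ker v * (expR (a * v) * cos (y * v))) +
    sin (y * be) * (ker v * (expR (a * v) * sin (y * v))).
  by rewrite /cc mulrBr cosB; ring.
have ssE v : ss v = cos (y * be) * (ker v * (expR (a * v) * sin (y * v))) -
    sin (y * be) * (ker v * (expR (a * v) * cos (y * v))).
  by rewrite /ss mulrBr sinB; ring.
have icc : itg cc by rewrite (funext ccE); apply: itgD; exact: itgZ.
have iss : itg ss by rewrite (funext ssE); apply: itgB; exact: itgZ.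
have rot : Gam a y = (I cc +i* I ss) * cexp (0 +i* (y * be)).
  rewrite (funext ccE) (funext ssE) I_D; [|exact: itgZ|exact: itgZ].
  rewrite I_B; [|exact: itgZ|exact: itgZ]; rewrite !I_Z//.
  rewrite /Gam /Lap /cexp /= expR0 !mul1r; simpc.
  set X := I _; set Y := I _.
  by congr (_ +i* _); rewrite -[LHS]mul1r -(cos2Dsin2 (y * be)); ring.
have hcc : g - y ^+ 2 / 2 * I V <= I cc.
  rewrite /g /gam -I_Z// -I_B//; last exact: itgZ.
  apply: I_le => //; first by apply: itgB => //; exact: itgZ.
  move=> v; rewrite /V /cc.
  have -> : ker v * expR (a * v) - y ^+ 2 / 2 * (ker v * (expR (a * v) * (v - be) ^+ 2)) =
     ker v * (expR (a * v) * (1 - (y * (v - be)) ^+ 2 / 2)) by ring.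
  by rewrite !ler_wpM2l ?expR_ge0// cos_ge1.
(* In place of Cauchy-Schwarz: |sin z| <= |z| <= de / 2 + z^2 / (2 de), integrated against the
   weight. *)
have hss : `|I ss| <= de / 2 * g + y ^+ 2 / (2 * de) * I V.
  rewrite /g /gam -!I_Z// -I_D//; [|exact: itgZ|exact: itgZ].
  apply: I_dom => //; first by apply: itgD; exact: itgZ.
  move=> v; rewrite /V /ss.
  have -> : de / 2 * (ker v * expR (a * v)) +
      y ^+ 2 / (2 * de) * (ker v * (expR (a * v) * (v - be) ^+ 2)) =
     ker v * (expR (a * v) * (de / 2 + (y * (v - be)) ^+ 2 / (2 * de))).
    by field; rewrite gt_eqF.
  rewrite !normrM (ger0_norm (expR_ge0 _)) (ger0_norm (ltW (ker_gt0 v))).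
  rewrite !ler_wpM2l ?expR_ge0//; apply: le_trans (abs_sin_le _) _.
  set z := `|y * (v - be)|.
  have -> : (y * (v - be)) ^+ 2 = z ^+ 2 by rewrite real_normK// num_real.
  rewrite -subr_ge0; have -> : de / 2 + z ^+ 2 / (2 * de) - z = (z - de) ^+ 2 / (2 * de).
    by field; rewrite gt_eqF.
  by rewrite divr_ge0 ?sqr_ge0 ?mulr_ge0// ltW.
have x0 : g / 2 <= I cc.
  apply: le_trans hcc.
  have : de ^+ 2 * g <= 1 * g by rewrite ler_wpM2r ?(ltW g0)// expr_le1// ltW.
  by move: IV; lra.
have tb : `|I ss| <= de * g.
  apply: le_trans hss _.
  have -> : y ^+ 2 / (2 * de) * I V = (y ^+ 2 * I V) / (2 * de) by ring.
  have : y ^+ 2 * I V / (2 * de) <= de ^+ 2 * g / (2 * de).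
    by rewrite ler_wpM2r// invr_ge0 mulr_ge0// ltW.
  have -> : de ^+ 2 * g / (2 * de) = de / 2 * g by field; rewrite gt_eqF.
  by lra.
have xp : 0 < I cc by lra.
exists (I cc), (I ss / I cc); split => //.
  rewrite normrM normfV (gtr0_norm xp) ler_pdivrMr//.
  apply: le_trans tb _; have := ler_wpM2l (ltW de0) x0; lra.
by rewrite rot mulrCA divff ?mulr1// gt_eqF.
Qed.

(** The abscissas reached from 1/4 by the functional equation of Gamma. *)
Definition ak k : R := 4^-1 + k%:R.

Lemma ak_gt0 k : 0 < ak k.
Proof. by rewrite ltr_pwDl. Qed.

Lemma akS k : ak k.+1 = ak k + 1.
Proof. by rewrite /ak -[k.+1%:R]natr1 addrA. Qed.

Lemma polar_atan a y : 0 < a ->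
  exists2 r : R, 0 < r & a +i* y = r%:C * cexp (0 +i* atan (y / a)) :> C.
Proof.
move=> a0; pose u := y / a; pose d := Num.sqrt (1 + u ^+ 2).
have d0 : 0 < d by rewrite sqrtr_gt0 ltr_wpDr// sqr_ge0.
exists (a * d); first by rewrite mulr_gt0.
have ca : cos (atan u) = d^-1 by rewrite cos_atan.
have sa : sin (atan u) = u / d.
  have : tan (atan u) = u by exact: atanK.
  by rewrite /tan ca invrK => h; rewrite -[in RHS]h mulfK// gt_eqF.
rewrite -/u /cexp /= expR0 !mul1r ca sa; simpc.
by congr (_ +i* _); rewrite /u; field; rewrite ?gt_eqF.
Qed.

Lemma Gam_iter n y : exists2 r : R, 0 < r &
  Gam (ak n) y = r%:C * cexp (0 +i* \sum_(0 <= k < n) atan (y / ak k)) * Gam 4^-1 y :> C.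
Proof.
elim: n => [|n [r r0 IH]].
  exists 1 => //; rewrite big_nil /ak addr0.
  have -> : 0 +i* 0 = 0 :> C by [].
  by rewrite cexp0 !mul1r.
have p0 := @pi_gt0 R.
have [r' r'0 E] := polar_atan y (ak_gt0 n).
exists (r' / pi * r); first by rewrite mulr_gt0// divr_gt0.
have pC : pi%:C != 0 :> C by rewrite eq_complex /= eqxx andbT gt_eqF.
apply: (mulfI pC); rewrite akS Gam_step ?ak_gt0// E IH big_nat_recr//=.
have -> : 0 +i* (\sum_(0 <= k < n) atan (y / ak k) + atan (y / ak n)) =
   (0 +i* \sum_(0 <= k < n) atan (y / ak k)) + (0 +i* atan (y / ak n)) :> C.
  by simpc.
rewrite cexpD -[r' / pi * r]mulrA !rmorphM/=.
have -> : pi^-1%:C = (pi%:C)^-1 :> C by rewrite fmorphV.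
by move: (pi%:C) pC => P pC; field.
Qed.

(* n steps of the functional equation of Gamma, followed by Gam_phase at ak n. *)
Definition gphase n y : R := y * ln (ak n / pi) - \sum_(0 <= k < n) atan (y / ak k).

(** In place of Stirling's formula: any [n] that is large compared with y^2 gives the argument of
    Gamma up to O(de). *)
Lemma Gam_quarter n y de : (0 < n)%N -> 0 < de -> de <= 1 ->
  y ^+ 2 <= de ^+ 2 * (ak n - 1) ->
  exists x t : R, [/\ 0 < x, `|t| <= 2 * de &
    Gam 4^-1 y = (x +i* (x * t)) * cexp (0 +i* gphase n y)].
Proof.
move=> n0 de0 de1 yd.
have an : 1 < ak n.
  rewrite /ak; have : 1 <= n%:R :> R by rewrite ler1n.
  by have : 0 < 4^-1 :> R by []; lra.
have [x [t [x0 tb E]]] := Gam_phase an de0 de1 yd.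
have [r r0 Er] := Gam_iter n y.
have rC : r%:C != 0 :> C by rewrite eq_complex /= eqxx andbT gt_eqF.
exists (x / r), t; split => //; first by rewrite divr_gt0.
have -> : 0 +i* gphase n y =
   (0 +i* (y * ln (ak n / pi))) - (0 +i* \sum_(0 <= k < n) atan (y / ak k)) :> C.
  by rewrite /gphase; simpc.
set z2 : C := 0 +i* _; set z1 : C := 0 +i* _.
have {}Er : Gam (ak n) y = r%:C * cexp z2 * Gam 4^-1 y := Er.
have e2 : cexp z2 * cexp (- z2) = 1 :> C by rewrite -cexpD subrr cexp0.
rewrite cexpD; apply: (mulfI rC).
have -> : Gam 4^-1 y = cexp z2 * cexp (- z2) * Gam 4^-1 y by rewrite e2 mul1r.
have -> : r%:C * (cexp z2 * cexp (- z2) * Gam 4^-1 y) =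
   (r%:C * cexp z2 * Gam 4^-1 y) * cexp (- z2) by ring.
rewrite -Er E.
have -> : x / r +i* (x / r * t) = (r%:C)^-1 * (x +i* (x * t)) :> C.
  by rewrite -fmorphV; simpc; congr (_ +i* _); ring.
by rewrite !mulrA mulfV// mul1r.
Qed.

End GammaPhase.

(** * Linearisation of the phase on a window of bounded length *)

Section PhaseLinear.
Context {R : realType}.
Implicit Types (a h y Y : R).

(** The derivative of [gphase n] at Y. *)
Definition gslope n Y : R :=
  ln (ak n / pi) - \sum_(0 <= k < n) ak k / (ak k ^+ 2 + Y ^+ 2).

(** By the mean value theorem the slope is taken at some x in (Y, Y + h), and a (x + Y) <= a^2 + x^2
    bounds its variation. The denominator a^2 + Y^2 is kept for the summation over a = [ak k]. *)
Lemma atan_linear a Y h : 0 < a -> 0 < Y -> 0 <= h ->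
  `|atan ((Y + h) / a) - atan (Y / a) - h * (a / (a ^+ 2 + Y ^+ 2))| <=
  h ^+ 2 / (a ^+ 2 + Y ^+ 2).
Proof.
move=> a0 Y0; rewrite le_eqVlt => /predU1P[<-|h0].
  by rewrite addr0 subrr mul0r subrr normr0 expr0n/= mul0r.
have YYh : Y < Y + h by lra.
have d (t : R) : is_derive t (1:R) (fun t => atan (t / a)) (a / (a ^+ 2 + t ^+ 2)).
  apply: is_derive_eq; rewrite /GRing.scale/=; field.
  by rewrite !gt_eqF// ltr_wpDr ?sqr_ge0// exprn_gt0.
have [|x] := @MVT R (fun t => atan (t / a)) (fun t => a / (a ^+ 2 + t ^+ 2)) Y (Y + h) YYh.
- apply: continuous_subspaceT => t.
  by apply/differentiable_continuous/derivable1_diffP; have [] := d t.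
rewrite in_itv/= => /andP[Yx xh] ->.
have -> : Y + h - Y = h by ring.
have p1 : 0 < a ^+ 2 + x ^+ 2 by rewrite ltr_wpDr ?sqr_ge0// exprn_gt0.
have p2 : 0 < a ^+ 2 + Y ^+ 2 by rewrite ltr_wpDr ?sqr_ge0// exprn_gt0.
have -> : a / (a ^+ 2 + x ^+ 2) * h - h * (a / (a ^+ 2 + Y ^+ 2)) =
   - (h * ((x - Y) * (a * (x + Y) / (a ^+ 2 + x ^+ 2))) / (a ^+ 2 + Y ^+ 2)).
  by field; rewrite !gt_eqF.
rewrite normrN ger0_norm; last first.
  have xY : 0 <= x - Y by lra.
  have xY2 : 0 <= x + Y by lra.
  by rewrite !mulr_ge0 ?invr_ge0 ?(ltW h0) ?(ltW a0) ?(ltW p1) ?(ltW p2).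
rewrite ler_wpM2r ?invr_ge0 ?(ltW p2)// expr2 ler_wpM2l ?(ltW h0)//.
rewrite -[leRHS]mulr1; apply: ler_pM; [lra| |lra|].
  by rewrite divr_ge0 ?mulr_ge0 ?(ltW p1) ?(ltW a0)//; lra.
rewrite ler_pdivrMr// mul1r.
have : 0 <= (a - x) ^+ 2 by exact: sqr_ge0.
have : 0 <= a * (x - Y) by rewrite mulr_ge0 ?(ltW a0)//; lra.
lra.
Qed.

(** Telescoping, from (a + Y - 1) (a + Y) <= 2 (a^2 + Y^2). Uniformity in n matters, since n is
    chosen after Y. *)
Lemma sum_inv_sqr n Y : 1 < Y ->
  \sum_(0 <= k < n) (ak k ^+ 2 + Y ^+ 2)^-1 <= 2 / (Y - 1) :> R.
Proof.
move=> Y1.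
have h : \sum_(0 <= k < n) (ak k ^+ 2 + Y ^+ 2)^-1 <= 2 / (ak 0 + Y - 1) - 2 / (ak n + Y - 1) :> R.
  elim: n => [|n IH]; first by rewrite big_nil subrr.
  rewrite big_nat_recr//= akS.
  have a0 := @ak_gt0 R n; set a := ak n in IH a0 *.
  have : (a ^+ 2 + Y ^+ 2)^-1 <= 2 / (a + Y - 1) - 2 / (a + 1 + Y - 1); last by lra.
  have -> : 2 / (a + Y - 1) - 2 / (a + 1 + Y - 1) = 2 / ((a + Y - 1) * (a + Y)).
    by field; rewrite !gt_eqF//; lra.
  rewrite -[leRHS]invf_div lef_pV2 ?posrE; last 2 first.
  - by rewrite ltr_wpDr ?sqr_ge0// exprn_gt0.
  - by rewrite divr_gt0// mulr_gt0//; lra.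
  rewrite ler_pdivrMr//.
  have := sqr_ge0 (a - Y); nra.
apply: le_trans h _.
have a0 := @ak_gt0 R 0; have an := @ak_gt0 R n.
have : 0 <= 2 / (ak n + Y - 1) by rewrite divr_ge0//; lra.
have : 2 / (ak 0 + Y - 1) <= 2 / (Y - 1).
  by rewrite ler_pM2l// lef_pV2 ?posrE; lra.
lra.
Qed.

Lemma gphase_linear n Y h : 1 < Y -> 0 <= h ->
  `|gphase n (Y + h) - gphase n Y - h * gslope n Y| <= 2 * h ^+ 2 / (Y - 1).
Proof.
move=> Y1 h0; have Y0 : 0 < Y by lra.
have -> : gphase n (Y + h) - gphase n Y - h * gslope n Y =
  - \sum_(0 <= k < n) (atan ((Y + h) / ak k) - atan (Y / ak k) -
       h * (ak k / (ak k ^+ 2 + Y ^+ 2))).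
  rewrite !sumrB -mulr_sumr /gphase /gslope; ring.
rewrite normrN; apply: le_trans (ler_norm_sum _ _ _) _.
apply: (@le_trans _ _ (\sum_(0 <= k < n) h ^+ 2 * (ak k ^+ 2 + Y ^+ 2)^-1)).
  by apply: ler_sum => k _; apply: atan_linear => //; exact: ak_gt0.
rewrite -mulr_sumr; apply: le_trans (ler_wpM2l (sqr_ge0 h) (sum_inv_sqr n Y1)) _.
by rewrite le_eqVlt; apply/orP; left; apply/eqP; ring.
Qed.

Lemma sum_inv_ak m n : (m <= n)%N ->
  \sum_(m.+1 <= k < n.+1) (ak k)^-1 <= ln (ak n) - ln (ak m) :> R.
Proof.
elim: n => [|n IH].
  by rewrite leqn0 => /eqP ->; rewrite big_geq// subrr.
rewrite leq_eqVlt => /predU1P[->|]; first by rewrite big_geq// subrr.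
rewrite ltnS => mn; rewrite big_nat_recr//=.
have a0 := @ak_gt0 R n; have a1 := @ak_gt0 R n.+1.
have : (ak n.+1)^-1 <= ln (ak n.+1) - ln (ak n) :> R; last by have := IH mn; lra.
have : ln (ak n / ak n.+1) <= ak n / ak n.+1 - 1 :> R.
  have := @expR_ge1Dx R (ln (ak n / ak n.+1)).
  by rewrite lnK ?posrE ?divr_gt0//; lra.
rewrite ln_div ?posrE//.
have -> : ak n / ak n.+1 - 1 = - (ak n.+1)^-1 :> R.
  by rewrite akS; field; rewrite gt_eqF// -akS.
lra.
Qed.

(** The first m + 1 terms are at most 1 / (2 Y) each, hence 1/2 in all. The others are below 1 /
    [ak k], and their sum is compared with ln (ak n) - ln (ak m), which cancels the dependence on
    n. *)
Lemma gslope_ge m n Y : (m < n)%N -> m.+1%:R <= Y ->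
  ln (ak m) - ln pi - 2^-1 <= gslope n Y.
Proof.
move=> mn mY; have Y0 : 0 < Y by apply: lt_le_trans mY.
have p0 := @pi_gt0 R; have an := @ak_gt0 R n.
rewrite /gslope ln_div ?posrE// (@big_cat_nat _ _ _ m.+1)//=.
have h1 : \sum_(0 <= k < m.+1) ak k / (ak k ^+ 2 + Y ^+ 2) <= 2^-1 :> R.
  apply: (@le_trans _ _ (\sum_(0 <= k < m.+1) (2 * Y)^-1)).
    apply: ler_sum => k _; have a0 := @ak_gt0 R k.
    rewrite ler_pdivrMr ?ltr_wpDr ?sqr_ge0 ?exprn_gt0//.
    rewrite mulrC ler_pdivlMr ?mulr_gt0//.
    have := sqr_ge0 (ak k - Y); lra.
  rewrite sumr_const_nat subn0 -[_ *+ m.+1]mulr_natl ler_pdivrMr ?mulr_gt0//; lra.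
have h2 : \sum_(m.+1 <= k < n) ak k / (ak k ^+ 2 + Y ^+ 2) <= ln (ak n) - ln (ak m) :> R.
  apply: le_trans (sum_inv_ak (ltnW mn)).
  rewrite [leRHS]big_nat_recr//=.
  apply: (@le_trans _ _ (\sum_(m.+1 <= k < n) (ak k)^-1)).
    apply: ler_sum => k _; have a0 := @ak_gt0 R k.
    rewrite ler_pdivrMr ?ltr_wpDr ?sqr_ge0 ?exprn_gt0// mulrDr.
    rewrite [_ * ak k ^+ 2]mulrC expr2 mulfK ?gt_eqF// lerDl.
    by rewrite mulr_ge0 ?sqr_ge0// invr_ge0 ltW.
  by rewrite lerDl invr_ge0 ltW.
lra.
Qed.

Lemma gslope_large (A : R) : exists Y0 : R, forall Y, Y0 <= Y ->
  exists N, forall n, (N <= n)%N -> A <= gslope n Y.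
Proof.
pose B := expR (A + ln pi + 2^-1).
pose m := (Num.truncn B).+1.
have Bm : B <= ak m.
  by apply: le_trans (ltW (truncnS_gt _)) _; rewrite /ak -/m lerDr.
exists m.+1%:R => Y mY; exists m.+1 => n mn.
apply: le_trans (gslope_ge mn mY).
have : ln B <= ln (ak m) by rewrite ler_ln ?posrE ?expR_gt0 ?ak_gt0.
by rewrite /B expRK; lra.
Qed.

(** [al] and [la] may vary with Y in an uncontrolled way; what the oscillation argument uses is that
    they do not depend on [h] and that [la] is large. *)
Lemma Gam_phase_linear (H0 A e : R) : 0 <= H0 -> 0 < e -> exists Y0 : R, forall Y, Y0 <= Y ->
  exists al la : R, A <= la /\ forall h, 0 <= h <= H0 ->
  exists x t d : R, [/\ 0 < x, `|t| <= e, `|d| <= e &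
    Gam 4^-1 (Y + h) = (x +i* (x * t)) * cexp (0 +i* (al + la * h + d))].
Proof.
move=> H00 e0; have [Y1 HY1] := gslope_large A.
pose de := Num.min 1 (e / 2).
have de0 : 0 < de by rewrite lt_min ltr01 divr_gt0.
have de1 : de <= 1 by rewrite ge_min lexx.
have dee : 2 * de <= e by rewrite mulrC -ler_pdivlMr// ge_min lexx orbT.
(* The last bound makes the linearisation error 2 h^2 / (Y - 1) at most [e]. *)
exists (Num.max (Num.max Y1 2) (1 + 2 * H0 ^+ 2 / e)) => Y.
rewrite !ge_max => /andP[/andP[YY1 Y2] Ye].
have [N HN] := HY1 Y YY1.
(* [N] secures the slope; the other term makes [Gam_quarter] applicable on the whole window. *)
pose n := maxn N (Num.truncn ((Y + H0) ^+ 2 / de ^+ 2 + 1)).+1.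
have Nn : (N <= n)%N by rewrite leq_maxl.
have n0 : (0 < n)%N by rewrite leq_max orbT.
have an : (Y + H0) ^+ 2 <= de ^+ 2 * (ak n - 1).
  rewrite mulrC -ler_pdivrMr ?exprn_gt0// lerBrDr.
  apply: le_trans (ltW (truncnS_gt _)) _.
  apply: (@le_trans _ _ n%:R); first by rewrite ler_nat leq_maxr.
  by rewrite /ak lerDr.
exists (gphase n Y), (gslope n Y); split; first exact: HN.
move=> h /andP[h0 hH].
have yd : (Y + h) ^+ 2 <= de ^+ 2 * (ak n - 1).
  by apply: le_trans an; apply: lerXn2r; rewrite ?nnegrE; lra.
have [x [t [x0 tb E]]] := Gam_quarter n0 de0 de1 yd.
exists x, t, (gphase n (Y + h) - gphase n Y - h * gslope n Y); split => //.
- exact: le_trans tb dee.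
- apply: le_trans (gphase_linear n _ h0) _; first by lra.
  rewrite ler_pdivrMr; last by lra.
  have hh : h ^+ 2 <= H0 ^+ 2 by apply: lerXn2r; rewrite ?nnegrE.
  have : 2 * H0 ^+ 2 / e <= Y - 1 by lra.
  rewrite ler_pdivrMr// [_ * e]mulrC.
  lra.
- by rewrite E; congr (_ * cexp (_ +i* _)); ring.
Qed.

End PhaseLinear.

(** * Mean of an oscillating function *)

Section Oscillation.
Context {R : realType}.
Notation mu := (@lebesgue_measure R).
Implicit Types (a b c d al la : R) (f g u w : R -> R).

Definition J a b f : R := \int[mu]_(x in `[a, b]) f x.

Lemma J_integrable a b f : continuous f -> mu.-integrable `[a, b] (EFin \o f).
Proof.
move=> cf; apply: continuous_compact_integrable; first exact: segment_compact.
exact: continuous_subspaceT.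
Qed.

Lemma J_le a b f g : continuous f -> continuous g ->
  (forall x, a <= x <= b -> f x <= g x) -> J a b f <= J a b g.
Proof.
move=> cf cg fg; rewrite /J; apply: le_Rintegral;
  [exact: measurable_itv|exact: J_integrable|exact: J_integrable|].
by move=> x /=; rewrite in_itv/=; exact: fg.
Qed.

Lemma J_cst a b c : a <= b -> J a b (fun=> c) = c * (b - a).
Proof.
move=> ab; rewrite /J Rintegral_cst//= lebesgue_measure_itv/= lte_fin.
by move: ab; rewrite le_eqVlt => /predU1P[->|->//]; rewrite ltxx subrr.
Qed.

Lemma J_cat a b c f : continuous f -> a <= b -> b <= c ->
  J a c f = J a b f + J b c f.
Proof.
move=> cf ab bc; rewrite /J.
have := @Rintegral_itvB R f (BLeft a) (BRight c) b (J_integrable a c cf).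
rewrite !bnd_simp => /(_ ab bc); rewrite Rintegral_itv_obnd_cbnd; last first.
  apply: integrableS (J_integrable b c cf) => //.
  by apply: subset_itvr; rewrite bnd_simp.
by move=> <-; rewrite addrC subrK.
Qed.

Lemma J_sub a b f g : continuous f -> continuous g ->
  J a b (fun x => f x - g x) = J a b f - J a b g.
Proof. by move=> cf cg; rewrite /J RintegralB//; exact: J_integrable. Qed.

Lemma cont_abs f : continuous f -> continuous (fun x => `|f x|).
Proof. by move=> cf x; apply: cvg_norm; exact: cf. Qed.

Lemma J_ge0 a b f : (forall x, 0 <= f x) -> 0 <= J a b f.
Proof. by move=> f0; apply: Rintegral_ge0. Qed.

Lemma J_FTC a b f F : a <= b -> continuous f ->
  (forall x : R, is_derive x (1 : R) F (f x)) -> `|F b - F a| <= J a b (fun x => `|f x|).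
Proof.
rewrite le_eqVlt => /predU1P[->|ab] cf dF.
  by rewrite subrr normr0 J_ge0.
have cF x : {for x, continuous F}.
  by apply/differentiable_continuous/derivable1_diffP; have [] := dF x.
have E : J a b f = F b - F a.
  rewrite /J /Rintegral (@continuous_FTC2 _ f F)//.
  - exact: continuous_subspaceT.
  - split; first by move=> x _; have [] := dF x.
    + by apply/cvg_at_right_filter; exact: cF.
    + by apply/cvg_at_left_filter; exact: cF.
  - by move=> x _; rewrite derive1E; have [_ ->] := dF x.
by rewrite -E; apply: le_normr_Rintegral => //; exact: J_integrable.
Qed.

Lemma cont_phase al la : continuous (fun t : R => al + la * t).
Proof.
apply: cont_add; first exact: cont_cst.
by apply: cont_mul; [exact: cont_cst|move=> x; exact: cvg_id].
Qed.

Lemma cont_sin_phase al la : continuous (fun t : R => sin (al + la * t)).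
Proof.
move=> t; apply: (@continuous_comp _ _ _ (fun t => al + la * t) sin).
  exact: cont_phase.
exact: continuous_sin.
Qed.

Lemma cont_cos_phase al la : continuous (fun t : R => cos (al + la * t)).
Proof.
move=> t; apply: (@continuous_comp _ _ _ (fun t => al + la * t) cos).
  exact: cont_phase.
exact: continuous_cos.
Qed.

(** The imaginary part of (u + i w) e^(i (al + la t)). *)
Definition wave u w al la (t : R) := u t * sin (al + la * t) + w t * cos (al + la * t).

Lemma cont_wave u w al la : continuous u -> continuous w -> continuous (wave u w al la).
Proof.
move=> cu cw; apply: cont_add; apply: cont_mul => //.
  exact: cont_sin_phase.
exact: cont_cos_phase.
Qed.

(** Over a half-period the primitive [P] takes opposite values at the two ends, and at a zero p of
    the integrand |P p| is its amplitude. The variations of P from c to p and from p to d therefore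
    add up to at least 2 |P p|. *)
Lemma wave_piece a b al la c : 0 < la ->
  2 * Num.sqrt (a ^+ 2 + b ^+ 2) / la <=
  J c (c + pi / la) (fun t => `|wave (fun=> a) (fun=> b) al la t|).
Proof.
move=> la0; have p0 := @pi_gt0 R.
set d := c + pi / la; have cd : c <= d by rewrite lerDl divr_ge0// ltW.
set g := wave (fun=> a) (fun=> b) al la.
have cg : continuous g by apply: cont_wave; exact: cont_cst.
pose P t := (- a * cos (al + la * t) + b * sin (al + la * t)) / la.
have lan : la != 0 by rewrite gt_eqF.
have dP t : is_derive t (1 : R) P (g t).
  rewrite /P /g /wave; apply: is_derive_eq.
  by rewrite /GRing.scale/=; field.
have ed : al + la * d = al + la * c + pi by rewrite /d; field.
have gd : g d = - g c by rewrite /g /wave ed sinDpi cosDpi; ring.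
have Pd : P d = - P c by rewrite /P ed sinDpi cosDpi; field.
have [p pcd gp] : exists2 p, p \in `[c, d] & g p = 0.
  apply: IVT => //; first exact: continuous_subspaceT.
  rewrite gd; have [g0|g0] := leP 0 (g c).
    by rewrite ge_min le_max; apply/andP; split; apply/orP; [right|left]; lra.
  by rewrite ge_min le_max; apply/andP; split; apply/orP; [left|right]; lra.
move: pcd; rewrite in_itv/= => /andP[cp pd].
have PP : `|P p| = Num.sqrt (a ^+ 2 + b ^+ 2) / la.
  apply: (mulIf lan); rewrite divfK// -[X in _ * X](gtr0_norm la0) -normrM.
  rewrite -sqrtr_sqr; congr Num.sqrt.
  have -> : (P p * la) ^+ 2 = (P p * la) ^+ 2 + g p ^+ 2 by rewrite gp expr0n addr0.
  rewrite /P divfK// /g /wave; set s := sin _; set co := cos _.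
  have E : s ^+ 2 = 1 - co ^+ 2 by rewrite sin2cos2.
  have -> : (- a * co + b * s) ^+ 2 + (a * s + b * co) ^+ 2 =
     (a ^+ 2 + b ^+ 2) * (co ^+ 2 + s ^+ 2) by ring.
  by rewrite E [co ^+ 2 + _]addrC subrK mulr1.
rewrite (J_cat (cont_abs cg) cp pd).
have h1 := J_FTC cp cg dP; have h2 := J_FTC pd cg dP.
apply: le_trans (lerD h1 h2).
have -> : 2 * Num.sqrt (a ^+ 2 + b ^+ 2) / la = 2 * `|P p| by rewrite PP mulrA.
rewrite Pd.
have := ler_normB (P p - P c) (- P c - P p).
have -> : P p - P c - (- P c - P p) = 2 * P p by ring.
by rewrite normrM (ger0_norm (ler0n _ 2)).
Qed.

Lemma unif_cont u (H e : R) : continuous u -> 0 < e -> exists2 de : R, 0 < de &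
  forall s t : R, 0 <= s <= H -> `|s - t| < de -> `|u s - u t| < e.
Proof.
move=> cu e0.
have /compact_near_coveringP cov := @segment_compact R 0 H.
have := cov R (0^'+) (fun de s => forall t, `|s - t| < de -> `|u s - u t| < e) _.
have h : forall x, `[0, H]%classic x -> \forall x' \near x & i \near 0^'+,
    forall t, `|x' - t| < i -> `|u x' - u t| < e.
  move=> x _; have /cvgrPdist_lt /(_ _ (_ : 0 < e / 2)) := cu x.
  rewrite divr_gt0// => /(_ erefl) /nbhs_ballP[r /= r0 Hr].
  exists (ball x (r / 2), [set i | i < r / 2]).
    split; first by apply: nbhsx_ballx; rewrite divr_gt0.
    by apply: nbhs_right_lt; rewrite divr_gt0.
  move=> [x' i] [/= bx' ir] t x't.
  have b1 : ball x r x'.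
    by apply: le_ball bx'; rewrite ler_pdivrMr// ler_pMr// ler1n.
  have b2 : ball x r t.
    rewrite /ball/=; rewrite /ball/= in bx'.
    have -> : x - t = (x - x') + (x' - t) by ring.
    by apply: le_lt_trans (ler_normD _ _) _; lra.
  have h1 := Hr _ b1; have h2 := Hr _ b2.
  have -> : u x' - u t = (u x - u t) - (u x - u x') by ring.
  apply: le_lt_trans (ler_normB _ _) _; move: h1 h2 => /=; lra.
move=> /(_ _)/(_ h) H1.
have : \forall de \near 0^'+, 0 < de /\ `[0, H] `<=` (fun s => forall t, `|s - t| < de -> `|u s - u t| < e).
  near=> de; split; first by near: de; exact: nbhs_right_gt.
  by near: de; exact: H1.
move=> /filter_ex[de [de0 Hde]]; exists de => // s t sH st.
by apply: Hde => //=; rewrite in_itv.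
Unshelve. all: by end_near. Qed.

Lemma cont_bounded u (H : R) : 0 <= H -> continuous u ->
  exists2 M : R, 0 < M & forall t : R, 0 <= t <= H -> `|u t| <= M.
Proof.
move=> H0 cu.
have [|||c _ cM] := @compact_EVT_max _ R (fun x => `|u x|) `[0, H].
- by exists 0; rewrite /= in_itv/= lexx.
- exact: segment_compact.
- by apply: continuous_subspaceT; exact: cont_abs.
exists (`|u c| + 1); first by rewrite ltr_wpDl.
move=> t tH; apply: le_trans (cM t _) _; last by rewrite lerDl.
by rewrite inE/= in_itv.
Qed.

Definition modul u w (t : R) := Num.sqrt (u t ^+ 2 + w t ^+ 2).

Lemma cont_modul u w : continuous u -> continuous w -> continuous (modul u w).
Proof.
move=> cu cw t; apply: (@continuous_comp _ _ _ (fun t => u t ^+ 2 + w t ^+ 2) Num.sqrt).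
  have -> : (fun t => u t ^+ 2 + w t ^+ 2) = (fun t => u t * u t + w t * w t).
    by apply/funext => z; rewrite !expr2.
  by apply: cont_add; apply: cont_mul.
exact: sqrt_continuous.
Qed.

Lemma modul_tri a b (a' b' : R) : Num.sqrt (a ^+ 2 + b ^+ 2) <=
  Num.sqrt (a' ^+ 2 + b' ^+ 2) + `|a - a'| + `|b - b'|.
Proof.
have s0 (x y : R) : 0 <= x ^+ 2 + y ^+ 2 by rewrite addr_ge0// sqr_ge0.
set S := Num.sqrt (a' ^+ 2 + b' ^+ 2).
have S0 : 0 <= S by exact: sqrtr_ge0.
have Sa : `|a'| <= S by rewrite -sqrtr_sqr ler_wsqrtr// lerDl sqr_ge0.
have Sb : `|b'| <= S by rewrite -sqrtr_sqr ler_wsqrtr// lerDr sqr_ge0.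
have S2 : S ^+ 2 = a' ^+ 2 + b' ^+ 2 by rewrite sqr_sqrtr.
have R0 : 0 <= S + `|a - a'| + `|b - b'| by rewrite !addr_ge0.
rewrite -(@ler_pXn2r _ 2)// ?nnegrE ?sqrtr_ge0// sqr_sqrtr//.
pose x := a - a'; pose y := b - b'.
have -> : a = a' + x by rewrite /x; ring.
have -> : b = b' + y by rewrite /y; ring.
have -> : a' + x - a' = x by ring.
have -> : b' + y - b' = y by ring.
have h1 : a' * x <= S * `|x|.
  by apply: le_trans (ler_norm _) _; rewrite normrM ler_wpM2r.
have h2 : b' * y <= S * `|y|.
  by apply: le_trans (ler_norm _) _; rewrite normrM ler_wpM2r.
have x2 : x ^+ 2 = `|x| ^+ 2 by rewrite real_normK ?num_real.
have y2 : y ^+ 2 = `|y| ^+ 2 by rewrite real_normK ?num_real.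
have xy : 0 <= `|x| * `|y| by rewrite mulr_ge0.
have -> : (a' + x) ^+ 2 + (b' + y) ^+ 2 = S ^+ 2 + 2 * (a' * x) + 2 * (b' * y) + x ^+ 2 + y ^+ 2.
  by rewrite S2; ring.
have -> : (S + `|x| + `|y|) ^+ 2 = S ^+ 2 + 2 * (S * `|x|) + 2 * (S * `|y|) +
   `|x| ^+ 2 + `|y| ^+ 2 + 2 * (`|x| * `|y|) by ring.
by rewrite x2 y2; lra.
Qed.

(** Cut [0, H] into half-periods of length d = pi / la and freeze u and w at the left end of each:
    [wave_piece] then gives 2 / la = (2 / pi) d times the modulus. *)
Lemma wave_mean u w (H e : R) : 0 < H -> 0 < e -> continuous u -> continuous w ->
  exists A : R, forall la al : R, A <= la ->
  2 / pi * J 0 H (modul u w) - e <= J 0 H (fun t => `|wave u w al la t|).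
Proof.
move=> H0 e0 cu cw; have p0 := @pi_gt0 R; have p2 := @pi_ge2 R.
have cm := cont_modul cu cw.
(* The pieces lose at most 8 et per unit of length, that is e / 2 on [0, H]. *)
pose et := e / (16 * H).
have et0 : 0 < et by rewrite divr_gt0// mulr_gt0.
have [d1 d10 Hu] := unif_cont H cu et0.
have [d2 d20 Hw] := unif_cont H cw et0.
have [M M0 HM] := cont_bounded (ltW H0) cm.
(* The last, incomplete half-period contributes at most M d <= e / 2 to the left-hand side. *)
pose dd := Num.min (Num.min d1 d2) (e / (2 * M)).
have dd0 : 0 < dd by rewrite !lt_min d10 d20 divr_gt0// mulr_gt0.
exists (2 * pi / dd) => la al lal.
have la0 : 0 < la by apply: lt_le_trans lal; rewrite divr_gt0// mulr_gt0.
pose d := pi / la; have d0 : 0 < d by rewrite divr_gt0.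
have ddd : d < dd.
  rewrite /d ltr_pdivrMr// -ltr_pdivrMl// mulrC; apply: lt_le_trans lal.
  by rewrite ltr_pM2r ?invr_gt0//; lra.
have := ddd; rewrite !lt_min => /andP[/andP[dd1 dd2] dde].
have cW := cont_abs (cont_wave (al:=al) (la:=la) cu cw).
set W := fun t => `|wave u w al la t| in cW *.
have piece c : 0 <= c -> c + d <= H ->
    2 / pi * J c (c + d) (modul u w) - 8 * et * d <= J c (c + d) W.
  move=> c0 cdH.
  have cl : c <= c + d by lra.
  have near_ t : c <= t <= c + d -> `|u c - u t| <= et /\ `|w c - w t| <= et.
    move=> /andP[ct tc]; split; apply: ltW.
      by apply: Hu; [apply/andP; split; lra|rewrite ler0_norm; lra].
    by apply: Hw; [apply/andP; split; lra|rewrite ler0_norm; lra].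
  have cV : continuous (fun t => `|wave (fun=> u c) (fun=> w c) al la t| - 2 * et).
    by apply: cont_sub; [apply: cont_abs; apply: cont_wave; exact: cont_cst|exact: cont_cst].
  have h1 : J c (c + d) (fun t => `|wave (fun=> u c) (fun=> w c) al la t| - 2 * et) <= J c (c + d) W.
    apply: J_le => // t /near_[ut wt].
    rewrite lerBlDr /W.
    have -> : wave (fun=> u c) (fun=> w c) al la t = wave u w al la t +
       ((u c - u t) * sin (al + la * t) + (w c - w t) * cos (al + la * t)).
      by rewrite /wave; ring.
    apply: le_trans (ler_normD _ _) _; rewrite lerD2l.
    apply: le_trans (ler_normD _ _) _; rewrite !normrM.
    have a1 : `|u c - u t| * `|sin (al + la * t)| <= et * 1 by apply: ler_pM => //; exact: sin_max.
    have a2 : `|w c - w t| * `|cos (al + la * t)| <= et * 1 by apply: ler_pM => //; exact: cos_max.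
    by lra.
  have h2 : J c (c + d) (modul u w) <= (modul u w c + 2 * et) * d.
    have -> : (modul u w c + 2 * et) * d = (modul u w c + 2 * et) * (c + d - c) by ring.
    rewrite -J_cst//; apply: J_le => //; first exact: cont_cst.
    move=> t /near_[ut wt]; have := modul_tri (u t) (w t) (u c) (w c).
    rewrite -/(modul u w c) -/(modul u w t) (distrC (u t)) (distrC (w t)).
    by move: (modul u w c) (modul u w t) ut wt => m1 m2 ut wt hm; lra.
  move: h1; rewrite J_sub; [|by apply: cont_abs; apply: cont_wave; exact: cont_cst|exact: cont_cst].
  rewrite J_cst//; have := wave_piece (u c) (w c) al c la0; rewrite -/d -/(modul u w c) => h3 h1.
  have h4 : 2 / pi * J c (c + d) (modul u w) <= 2 / pi * ((modul u w c + 2 * et) * d).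
    by rewrite ler_wpM2l// divr_ge0// ltW.
  have E : 2 / pi * ((modul u w c + 2 * et) * d) = 2 * modul u w c / la + 2 * et * (2 / la).
    by rewrite /d; move: (pi) p0 => p p0'; field; rewrite !gt_eqF.
  have dl : 2 / la <= d by rewrite /d ler_pM2r// invr_gt0.
  have := ler_wpM2l (ltW et0) dl; have := mulr_ge0 (ltW et0) (ltW d0); lra.
pose N := Num.truncn (H / d).
have Hd0 : 0 <= H / d by rewrite divr_ge0 ?ltW.
have /andP[N1 N2] := truncn_itv Hd0.
have {}N1 : N%:R * d <= H by rewrite -ler_pdivlMr.
have {}N2 : H < N%:R * d + d.
  by move: N2; rewrite ltr_pdivrMr// -natr1 mulrDl mul1r.
have sum n : (n <= N)%N -> 2 / pi * J 0 (n%:R * d) (modul u w) - 8 * et * (n%:R * d) <=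
    J 0 (n%:R * d) W.
  elim: n => [|n IH] nN.
    have J0 f : J 0 (0%:R * d) f = 0.
      by rewrite mul0r /J set_itv1 Rintegral_set1.
    by rewrite !J0 mul0r !mulr0 subrr.
  have nd : 0 <= n%:R * d by rewrite mulr_ge0// ltW.
  have sd : n.+1%:R * d = n%:R * d + d by rewrite -natr1; ring.
  have sN : n%:R * d + d <= H.
    apply: le_trans N1; rewrite -sd ler_pM2r// ler_nat//.
  rewrite sd (J_cat cm nd); last by lra.
  rewrite (J_cat cW nd); last by lra.
  by have := piece _ nd sN; have := IH (ltnW nN); lra.
have := sum N (leqnn N).
have Nd0 : 0 <= N%:R * d by rewrite mulr_ge0// ltW.
rewrite (J_cat cm Nd0 N1) (J_cat cW Nd0 N1).
have r1 : 0 <= J (N%:R * d) H W by apply: J_ge0 => t; exact: normr_ge0.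
have r2 : J (N%:R * d) H (modul u w) <= M * d.
  apply: (@le_trans _ _ (J (N%:R * d) H (fun=> M))).
    apply: J_le => //; first exact: cont_cst.
    move=> t /andP[t1 t2]; apply: le_trans (ler_norm _) (HM t _).
    by apply/andP; split; lra.
  by rewrite J_cst// ler_wpM2l ?(ltW M0)//; lra.
have r3 : 2 / pi * J (N%:R * d) H (modul u w) <= 1 * (M * d).
  apply: ler_pM => //; first by rewrite divr_ge0// ltW.
    by apply: J_ge0 => t; exact: sqrtr_ge0.
  by rewrite ler_pdivrMr// mul1r.
have r4 : M * d <= e / 2.
  have -> : e / 2 = M * (e / (2 * M)) by field; rewrite gt_eqF.
  by rewrite ler_wpM2l ?(ltW M0)// ltW.
have r5 : 8 * et * (N%:R * d) <= e / 2.
  have -> : e / 2 = 8 * et * H by rewrite /et; field; rewrite gt_eqF.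
  by rewrite ler_wpM2l// mulr_ge0// ltW.
by rewrite mulrDr; lra.
Qed.

End Oscillation.

(** * The lower bound *)

Section CompletedLebesgue.
Context {R : realType}.
Notation mu := (@lebesgue_measure R).
Notation cmu := (@completed_lebesgue_measure R).

(** The integral of a nonnegative function is a supremum over the simple functions below it, and
    this supremum is monotone. It serves to compare with a continuous minorant. *)
Lemma ge0_le_integral_nomeas d (T : measurableType d) (m : {measure set T -> \bar R})
    (D : set T) (f g : T -> \bar R) :
  (forall x, D x -> 0 <= f x)%E -> (forall x, D x -> f x <= g x)%E ->
  (\int[m]_(x in D) f x <= \int[m]_(x in D) g x)%E.
Proof.
move=> f0 fg; have g0 x : D x -> (0 <= g x)%E.
  by move=> Dx; apply: le_trans (f0 x Dx) (fg x Dx).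
rewrite !ge0_integralE//.
apply: ereal_sup_le => _ [h hf <-]; exists h => // x; apply: le_trans (hf x) _.
by rewrite /patch; case: ifPn => //; rewrite inE => /fg.
Qed.

(** The identity map from the Caratheodory sigma-algebra to the Borel one is measurable and pushes
    the completed measure forward to Lebesgue measure. *)
Lemma ge0_integral_completed (D : set (measurableTypeR R)) (f : measurableTypeR R -> \bar R) :
  measurable D -> measurable_fun D f -> {in D, forall y, 0 <= f y}%E ->
  (\int[cmu]_(x in D) f x = \int[mu]_(x in D) f x)%E.
Proof.
move=> mD mf f0.
pose phi : caratheodory_type (@wlength R idfun)^*%mu -> measurableTypeR R := idfun.
have mphi : measurable_fun setT phi.
  by move=> _ A mA; rewrite setTI; exact: sub_caratheodory.
have := @ge0_integral_pushforward _ _ _ _ R phi mphi cmu D f mD mf f0.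
move=> E; rewrite -[LHS]E.
exact: eq_measure_integral.
Qed.

End CompletedLebesgue.

(** * Pointwise bound from the phase, and its integration *)

Section PhaseBound.
Context {R : realType}.
Local Notation C := (R[i]).
Local Notation normc := (@Normc.normc R).
Notation mu := (@lebesgue_measure R).
Notation cmu := (@completed_lebesgue_measure R).

Lemma normc_cexpi_sub1 (d : R) : `|d| <= 1 -> normc (cexp (0 +i* d) - 1 : C) <= 2 * `|d|.
Proof.
move=> d1; apply: le_trans (normc_le_sum _) _.
rewrite /cexp/= expR0 !mul1r subr0.
have h1 : `|cos d - 1| <= `|d|.
  rewrite distrC ger0_norm; last by rewrite subr_ge0 cos_le1.
  have := cos_ge1 d; rewrite -[d ^+ 2]real_normK ?num_real//.
  have h : `|d| ^+ 2 <= `|d| * 1 by rewrite expr2 ler_wpM2l.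
  by have := normr_ge0 d; lra.
by have := abs_sin_le d; lra.
Qed.

(** Let P = (1 + i t) e^(i (th + d)). Since P Zv is real, P (F - g Zv) and P F have the same
    imaginary part. Replacing P by e^(i th) costs 3 eta |F|, and |P| <= 1 + eta accounts for the
    remaining eta. *)
Lemma normc_sub_ge_wave (F Zv : C) (g x th t d eta : R) :
  0 < x -> `|t| <= eta -> `|d| <= eta -> eta <= 1 ->
  complex.Im ((x +i* (x * t)) * cexp (0 +i* (th + d)) * Zv) = 0 ->
  `|complex.Re F * sin th + complex.Im F * cos th| - 4 * eta * normc F <=
  normc (F - g%:C * Zv).
Proof.
move=> x0 te de e1 ImZ.
have e0 : 0 <= eta by apply: le_trans te.
set E := cexp (0 +i* th); set D := cexp (0 +i* d).
pose P : C := (1 +i* t) * (E * D).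
have ED : cexp (0 +i* (th + d)) = E * D.
  by rewrite /E /D -cexpD; congr cexp; simpc.
have PZ : complex.Im (P * Zv) = 0.
  move: ImZ; rewrite ED.
  have -> : (x +i* (x * t)) = x%:C * (1 +i* t) :> C by simpc.
  rewrite -mulrA -[X in complex.Im X]mulrA -/P.
  have -> : x%:C * ((1 +i* t) * (E * D * Zv)) = x%:C * (P * Zv) by rewrite /P !mulrA.
  case: (P * Zv) => a b /=; rewrite mul0r addr0 => /eqP.
  by rewrite mulf_eq0 gt_eqF//= => /eqP.
have E1 : normc E = 1 by rewrite /E normc_cexp expR0.
have D1 : normc D = 1 by rewrite /D normc_cexp expR0.
have h1t : normc (1 +i* t : C) <= 1 + eta.
  by apply: le_trans (normc_le_sum _) _; rewrite /= normr1 lerD2l.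
have P1 : normc P <= 1 + eta by rewrite /P !Normc.normcM E1 D1 !mulr1.
have wE : complex.Re F * sin th + complex.Im F * cos th = complex.Im (E * F).
  by rewrite /E /cexp/= expR0 !mul1r; case: F => a b /=; ring.
have w1 : `|complex.Im (E * F)| <= normc F.
  by apply: le_trans (Im_le_normc _) _; rewrite Normc.normcM E1 mul1r.
have PE : normc (E - P) <= 3 * eta.
  have -> : E - P = - (E * ((0 +i* t) * D + (D - 1))).
    have -> : P = (1 + (0 +i* t)) * (E * D) by rewrite /P; congr (_ * _); simpc.
    by ring.
  rewrite normcN Normc.normcM E1 mul1r; apply: le_trans (le_normc_sub _ _) _.
  rewrite Normc.normcM D1 mulr1.
  have a1 : normc (0 +i* t : C) <= eta.
    by apply: le_trans (normc_le_sum _) _; rewrite /= normr0 add0r.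
  have a2 := normc_cexpi_sub1 (le_trans de e1).
  by rewrite -/D in a2; lra.
set N := normc (F - g%:C * Zv).
have N0 : 0 <= N by exact: normc_ge0.
have F0 : 0 <= normc F by exact: normc_ge0.
have key : `|complex.Im (E * F)| <= (1 + eta) * N + 3 * eta * normc F.
  have -> : complex.Im (E * F) = complex.Im (P * (F - g%:C * Zv)) + complex.Im ((E - P) * F).
    have -> : E * F = P * (F - g%:C * Zv) + (E - P) * F + g%:C * (P * Zv) by ring.
    move: PZ; case: (P * Zv) => a b /= ->.
    by rewrite !raddfD/=; ring.
  apply: le_trans (ler_normD _ _) _; apply: lerD.
    apply: le_trans (Im_le_normc _) _; rewrite Normc.normcM.
    by apply: ler_wpM2r.
  apply: le_trans (Im_le_normc _) _; rewrite Normc.normcM.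
  by apply: ler_wpM2r.
(* If |F| <= N, the bound [w1] suffices; otherwise eta N <= eta |F| is absorbed by the error
   term. *)
rewrite wE; have [FN|FN] := leP (normc F) N.
  have : 0 <= 4 * eta * normc F by rewrite !mulr_ge0.
  by lra.
have := ler_wpM2l e0 (ltW FN); lra.
Qed.

Lemma integral_completed_J (H : R) (g : R -> R) : continuous g -> (forall t, 0 <= g t) ->
  (\int[cmu]_(t in `[0%R, H]) (g t)%:E = (J 0 H g)%:E)%E.
Proof.
move=> cg g0; have ig := J_integrable 0 H cg.
have mg : measurable_fun (`[0, H]%classic : set (measurableTypeR R)) (EFin \o g).
  by have /integrableP[] := ig.
rewrite (@ge0_integral_completed R `[0, H]%classic (EFin \o g))//.
  by rewrite /J /Rintegral fineK//; exact: integrable_fin_num.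
by move=> t _; rewrite /= lee_fin.
Qed.

Lemma zeta_approx_ge (Z : CC R -> CC R) (H e : R) (G u w : R -> R) (f : R -> C) :
  is_riemann_zeta Z -> 0 < H -> 0 < e -> continuous u -> continuous w ->
  (forall t, 0 <= t <= H -> f t = u t +i* w t) ->
  exists T0 : R, forall T, T0 < T ->
  ((2 / pi * J 0 H (modul u w) - e)%:E <=
   \int[cmu]_(t in `[0%R, H])
      (normc (f t - (G (t + T))%:C * Z (2^-1 +i* (T + t)))%R)%:E)%E.
Proof.
move=> hZ H0 e0 cu cw fE.
have [M M0 HM] := cont_bounded (ltW H0) (cont_modul cu cw).
(* The phase errors cost at most 4 eta M H <= e / 2; the other half of [e] goes to [wave_mean]. *)
pose eta := Num.min 1 (e / (8 * M * H)).
have eta0 : 0 < eta by rewrite lt_min ltr01 divr_gt0// !mulr_gt0.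
have eta1 : eta <= 1 by rewrite ge_min lexx.
pose ka := 4 * eta * M.
have kaH : ka * H <= e / 2.
  have -> : e / 2 = (4 * M * H) * (e / (8 * M * H)) by field; rewrite !gt_eqF.
  have -> : ka * H = (4 * M * H) * eta by rewrite /ka; ring.
  by rewrite ler_wpM2l ?ge_min ?lexx ?orbT// !mulr_ge0// ltW.
have e20 : 0 < e / 2 by rewrite divr_gt0.
have [A HA] := wave_mean H0 e20 cu cw.
have H20 : 0 <= H / 2 by rewrite divr_ge0// ltW.
(* Gamma is taken at height (T + t) / 2: the window has length H / 2 and the slope in t is la / 2,
   whence 2 A. *)
have [Y0 HY] := Gam_phase_linear (2 * A) H20 eta0.
exists (Num.max (2 * Y0) 0) => T; rewrite gt_max => /andP[T1 T2].
have YT : Y0 <= T / 2 by lra.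
have [al [la [lA HG]]] := HY _ YT.
pose la' := la / 2; have Ala : A <= la' by rewrite /la'; lra.
pose a t := `|wave u w al la' t| - ka.
(* The positive part of [a]: a continuous and nonnegative minorant, as [ge0_le_integral_nomeas] and
   [integral_completed_J] require. *)
pose L t := 2^-1 * (a t + `|a t|).
have ca : continuous a.
  by apply: cont_sub; [apply: cont_abs; exact: cont_wave|exact: cont_cst].
have cL : continuous L.
  apply: cont_mul; first exact: cont_cst.
  by apply: cont_add => //; exact: cont_abs.
have L0 t : 0 <= L t.
  by rewrite /L mulr_ge0//; have := ler_norm (- a t); rewrite normrN; lra.
apply: (@le_trans _ _ (J 0 H L)%:E).
  rewrite lee_fin; apply: (@le_trans _ _ (J 0 H a)).
    rewrite J_sub; [|by apply: cont_abs; exact: cont_wave|exact: cont_cst].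
    by rewrite J_cst ?(ltW H0)// subr0; have := HA _ al Ala; lra.
  by apply: J_le => // t _; rewrite /L; have := ler_norm (a t); lra.
rewrite -integral_completed_J//.
apply: ge0_le_integral_nomeas => t /=; rewrite in_itv/= => /andP[t0 tH].
  by rewrite lee_fin.
rewrite lee_fin.
have t2 : 0 <= t / 2 <= H / 2 by apply/andP; split; lra.
have [x [s [d [x0 sb db EG]]]] := HG _ t2.
have y0 : T / 2 + t / 2 != 0 by rewrite gt_eqF//; lra.
have := zeta_phase hZ y0.
have -> : 2 * (T / 2 + t / 2) = T + t by field.
rewrite EG => ImZ.
have := normc_sub_ge_wave (f t) (G (t + T)) x0 sb db eta1 ImZ.
rewrite fE ?t0// /=.
have -> : la * (t / 2) = la' * t by rewrite /la'; ring.
rewrite -/(wave u w al la' t) -[Num.sqrt _]/(modul u w t).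
set N := normc _; have N0 : 0 <= N by exact: normc_ge0.
have Mt : modul u w t <= M.
  by apply: le_trans (ler_norm _) (HM t _); rewrite t0.
have h4 : 4 * eta * modul u w t <= ka by rewrite /ka ler_wpM2l// mulr_ge0// ltW.
move=> hN; have aN : a t <= N by rewrite /a; lra.
rewrite /L; have [a0|a0] := leP 0 (a t).
  by rewrite ger0_norm//; lra.
by rewrite ltr0_norm//; lra.
Qed.

End PhaseBound.

(** * Continuous extension of f beyond the segment *)

Section Clamp.
Context {R : realType}.
Local Notation normc := (@Normc.normc R).

(* Equal to max 0 (min t H) for 0 <= H. *)
Definition clamp (H t : R) : R := 2^-1 * (H + (`|t| - `|t - H|)).

Lemma continuous_clamp (H : R) : continuous (clamp H).
Proof.
apply: cont_mul; first exact: cont_cst.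
apply: cont_add; first exact: cont_cst.
apply: cont_sub; apply: cont_abs; first by move=> t; exact: cvg_id.
by apply: cont_sub; [move=> t; exact: cvg_id|exact: cont_cst].
Qed.

Lemma clamp_itv (H t : R) : 0 <= H -> 0 <= clamp H t <= H.
Proof.
move=> H0; rewrite /clamp; have [t0|t0] := leP 0 t.
  rewrite (ger0_norm t0); have [tH|tH] := leP H t.
    by rewrite ger0_norm ?subr_ge0//; apply/andP; split; lra.
  by rewrite ltr0_norm ?subr_lt0//; apply/andP; split; lra.
by rewrite (ltr0_norm t0) ltr0_norm; [apply/andP; split; lra|lra].
Qed.

Lemma clamp_id (H t : R) : 0 <= t <= H -> clamp H t = t.
Proof.
move=> /andP[t0 tH]; rewrite /clamp (ger0_norm t0) ler0_norm ?subr_le0//.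
by lra.
Qed.

(** The oscillation lemmas take functions that are continuous on the whole line; composing with the
    retraction of the line onto [0, H] provides them without changing f there. *)
Lemma continuous_extension (H : R) (f : R -> CC R) : 0 <= H ->
  {within `[0, H], continuous f} ->
  continuous (fun t => complex.Re (f (clamp H t))) /\
  continuous (fun t => complex.Im (f (clamp H t))).
Proof.
move=> H0 /subspace_continuousP fc.
have near_clamp t (e : R) : 0 < e ->
    \forall s \near t, normc (f (clamp H t) - f (clamp H s)) < e.
  move=> e0.
  have e0C : 0 < e%:C :> R[i] by rewrite ltcR.
  have tH : (`[0, H]%classic : set R) (clamp H t) by rewrite /= in_itv/= clamp_itv.
  have /cvgrPdist_lt /(_ _ e0C) h := fc _ tH.
  have h' : \forall s \near t, (`[0, H]%classic : set R) (clamp H s) ->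
      `|f (clamp H t) - f (clamp H s)| < e%:C.
    exact: (@continuous_clamp H t _ h).
  apply: filterS h' => s hs.
  have sH : (`[0, H]%classic : set R) (clamp H s) by rewrite /= in_itv/= clamp_itv.
  by rewrite -ltcR; exact: (hs sH).
split=> t; apply/cvgrPdist_lt => e e0; have := near_clamp t e e0;
  apply: filterS => s; apply: le_lt_trans; rewrite -raddfB.
  exact: Re_le_normc.
exact: Im_le_normc.
Qed.

End Clamp.

Lemma limf_einf_pinfty_ge (R : realType) (F : R -> \bar R) (x : R) :
  (forall e : R, 0 < e -> exists T0 : R, forall T, T0 < T -> ((x - e)%:E <= F T)%E) ->
  (x%:E <= limf_einf F (pinfty_nbhs R))%E.
Proof.
move=> h; rewrite limf_einfE; apply/lee_addgt0Pr => e e0.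
have [T0 HT] := h e e0.
rewrite -leeBlDr// -EFinB.
apply: le_ereal_sup_tmp; exists (ereal_inf (F @` [set T | T0 < T])).
  exists [set T | T0 < T] => //.
  by exists T0; split => //; exact: num_real.
by apply: le_ereal_inf_tmp => _ [T TT <-]; exact: HT.
Qed.

Unset Implicit Arguments.
Set Strict Implicit.
Set Printing Implicit Defensive.

Theorem theorem5 (R : realType) (zeta : CC R -> CC R)
    (zetaP : is_riemann_zeta zeta)
    (H : R) (H_gt0 : 0 < H)
    (G : R -> R) (G_locL1 : L1_on_bounded_intervals G)
    (f : R -> CC R) (f_cont : {within `[0, H], continuous f}) :
  ((2 / pi)%R%:E *
     \int[completed_lebesgue_measure]_(t in `[0%R, H]) (Normc.normc (f t))%:E
   <= limf_einf
        (fun T : R => \int[completed_lebesgue_measure]_(t in `[0%R, H])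
           (Normc.normc
              (f t - (G (t + T))%:C * zeta (2^-1 +i* (T + t)))%R)%:E)
        (pinfty_nbhs R))%E.
Proof.
have [cu cw] := continuous_extension (ltW H_gt0) f_cont.
set u := fun t => complex.Re (f (clamp H t)) in cu.
set w := fun t => complex.Im (f (clamp H t)) in cw.
have fE t : 0 <= t <= H -> f t = u t +i* w t.
  by move=> tH; rewrite /u /w clamp_id//; case: (f t).
have -> : (\int[completed_lebesgue_measure]_(t in `[0%R, H]) (Normc.normc (f t))%:E =
    (J 0 H (modul u w))%:E)%E.
  rewrite -integral_completed_J; last 2 first.
  - exact: cont_modul.
  - by move=> t; exact: sqrtr_ge0.
  by apply: eq_integral => t; rewrite inE/= in_itv/= => /fE ->.
rewrite -EFinM; apply: limf_einf_pinfty_ge => e e0.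
exact: zeta_approx_ge.
Qed.
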